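(* Let $c > 2k > 0$ and let $u^c(t,x) = \phi(x - ct)$ be the smooth solitary-wave solution, of traveling speed $c$, of the Degasperis-Procesi equation $$m_t + 2k u_x + 3 m u_x + u m_x = 0,\qquad m = u - u_{xx},\quad x\in\mathbb{R},\ t>0.$$ Then the solitary wave $u^c$ is spectrally stable in $L^2(\mathbb{R})$: the linearized equation $v_t = J L_c v$ admits no exponentially unstable solution, i.e. the spectrum of $J L_c$ on $L^2(\mathbb{R})$ contains no point with positive real part.
   Context: Solitary wave: a solution of the form $u(t,x)=\phi(x-ct)$ for which there exists $\xi_0$ with $\max_{\mathbb{R}} \phi = \phi(\xi_0)$, $\lim_{\xi\to\pm\infty}\phi(\xi)=0$, $\phi$ strictly increasing on $(-\infty,\xi_0)$ and strictly decreasing on $(\xi_0,\infty)$. For $c>2k>0$ the smooth solitary wave of speed $c$ exists and is unique up to translation; write $\phi$ for the even representative. Its profile satisfies $-\frac12\phi^2 - 2k(4-\partial_\xi^2)^{-1}\phi + c(1-\partial_\xi^2)(4-\partial_\xi^2)^{-1}\phi = 0$. The equation has the Hamiltonian form $u_t = J\frac{\delta H}{\delta u}(u)$ with $$J = \partial_x(4-\partial_x^2)(1-\partial_x^2)^{-1},\qquad H(u) = -\frac16\int_{\mathbb{R}}\Big(u^3 + 6k\big((4-\partial_x^2)^{-1/2}u\big)^2\Big)dx.$$ With $\xi = x - ct$ and $S(u) = \frac12\int_{\mathbb{R}} u\cdot(1-\partial_\xi^2)(4-\partial_\xi^2)^{-1}u\, d\xi$, in the traveling frame the equation is $u_t = J\big(\frac{\delta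 H}{\delta u}(u) + c\frac{\delta S}{\delta u}(u)\big)$, and its linearization at $\phi$ is $v_t = J L_c v$, where $$L_c v= (c-\phi)v - (3c+2k)(4-\partial_\xi^2)^{-1}v$$ is the second variation of $H + cS$ at $\phi$, a bounded self-adjoint operator on $L^2(\mathbb{R})$. The operator $J L_c$ is considered as an unbounded operator on (complex) $L^2(\mathbb{R})$ with domain $\{v\in L^2(\mathbb{R}) : L_c v\in H^1(\mathbb{R})\}$ (which equals $H^1(\mathbb{R})$). The solitary wave is called spectrally stable if the linearized equation admits no exponentially unstable solution. *)

(* Defs.v *)
From mathcomp Require Import all_boot all_order all_algebra.
From mathcomp Require Import all_classical all_reals all_analysis.
From mathcomp Require Import complex.
Set Implicit Arguments.
Unset Strict Implicit.
Unset Printing Implicit Defensive.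
Import Order.TTheory GRing.Theory Num.Theory.
Import numFieldNormedType.Exports.
Local Open Scope classical_set_scope.
Local Open Scope ring_scope.
Local Open Scope complex_scope.

Section DegasperisProcesi.
Context {R : realType}.
Implicit Types (phi psi : R -> R) (f g v w : R -> R[i]).

Definition smooth phi : Prop :=
  forall (n : nat) (x : R), derivable (derive1n n phi) x 1.

Definition d_t (u : R -> R -> R) : R -> R -> R :=
  fun t x => derive1 (fun s => u s x) t.
Definition d_x (u : R -> R -> R) : R -> R -> R :=
  fun t x => derive1 (u t) x.

(* The derivatives are total functions, so this is meaningful only for
   differentiable [u]; it is used below for [u t x = phi (x - c * t)] with
   [phi] smooth. *)
Definition solves_DP (k : R) (u : R -> R -> R) : Prop :=
  let m := fun t x => u t x - d_x (d_x u) t x in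
  forall t x : R, 0 < t ->
    d_t m t x + 2 * k * d_x u t x + 3 * m t x * d_x u t x
      + u t x * d_x m t x = 0.

Definition solitary_profile phi : Prop :=
  exists xi0 : R,
    [/\ forall xi, phi xi <= phi xi0,
        phi xi @[xi --> +oo] --> 0,
        phi xi @[xi --> -oo] --> 0,
        forall x y, x < y -> y < xi0 -> phi x < phi y
      & forall x y, xi0 < x -> x < y -> phi y < phi x].

Definition smooth_solitary_wave (c k : R) phi : Prop :=
  [/\ smooth phi, solitary_profile phi
    & solves_DP k (fun t x => phi (x - c * t))].

(* Elements of the complex L^2(R) are functions [R -> R[i]], and equality in
   L^2 is equality almost everywhere. *)
Local Notation mu := (@lebesgue_measure R).
Local Notation re f := (fun x => complex.Re (f x)).
Local Notation im f := (fun x => complex.Im (f x)).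

Definition L2 f : Prop :=
  re f \in Lfun mu 2%:E /\ im f \in Lfun mu 2%:E.

(* [`|z|] lives in [R[i]]; its real part is the modulus as a real number. *)
Definition L2norm f : \bar R :=
  ('N[mu]_2%:E[(fun x => (complex.Re `|f x|)%:E)])%E.

Definition test_function psi : Prop :=
  smooth psi /\ exists M : R, forall x, M < `|x| -> psi x = 0.

Definition is_weak_derivative f g : Prop :=
  forall psi, test_function psi ->
    (\int[mu]_x (complex.Re (f x) * derive1 psi x)
       = - \int[mu]_x (complex.Re (g x) * psi x))%R /\
    (\int[mu]_x (complex.Im (f x) * derive1 psi x)
       = - \int[mu]_x (complex.Im (g x) * psi x))%R.

Definition H1 f : Prop :=
  L2 f /\ exists g, L2 g /\ is_weak_derivative f g.

(* A representative of the L^2 weak derivative of [f]; it is unique up to a.e.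
   equality, and the default value [0] is irrelevant when [f] is in H^1. *)
Definition weakD f : R -> R[i] :=
  xget (fun=> 0) [set g | L2 g /\ is_weak_derivative f g].

Definition H2 f : Prop := H1 f /\ H1 (weakD f).

(* [a - d^2/dx^2], an operator L^2(R) -> L^2(R) with domain H^2(R). *)
Definition helmholtz (a : R) w : R -> R[i] :=
  fun x => a%:C * w x - weakD (weakD w) x.

(* [(a - d^2/dx^2)^-1] on L^2(R), for [0 < a]: a representative of the solution
   [w] in H^2 of [a w - w'' = f], which exists and is unique up to a.e.
   equality for each [f] in L^2. *)
Definition helmholtz_inv (a : R) f : R -> R[i] :=
  xget (fun=> 0) [set w | H2 w /\ helmholtz a w = f %[ae mu]].

(* [T : D -> L^2] with domain [D] included in L^2: [l] is in the resolvent set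
   when [T - l : D -> L^2] is a bijection (modulo a.e. equality) with a bounded
   inverse. *)
Definition resolvent_set (D : set (R -> R[i])) (T : (R -> R[i]) -> (R -> R[i]))
    : set R[i] :=
  [set l | [/\
    forall v w, D v -> D w ->
      (fun x => T v x - l * v x) = (fun x => T w x - l * w x) %[ae mu] ->
      v = w %[ae mu],
    forall f, L2 f ->
      exists2 v, D v & (fun x => T v x - l * v x) = f %[ae mu]
  & exists C : R, forall v, D v ->
      (L2norm v <= C%:E * L2norm (fun x => T v x - l * v x)%R)%E]].

Definition spectrum D T : set R[i] := ~` resolvent_set D T.

(* [d/dx (4 - d^2/dx^2) (1 - d^2/dx^2)^-1], with domain H^1(R): for [w] in H^1,
   [(4 - d^2/dx^2) (1 - d^2/dx^2)^-1 w = w + 3 (1 - d^2/dx^2)^-1 w] is in H^1. *)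
Definition J w : R -> R[i] := weakD (helmholtz 4 (helmholtz_inv 1 w)).

(* The second variation of [H + c S] at [phi]. *)
Definition Lc (c k : R) phi v : R -> R[i] :=
  fun x => (c - phi x)%:C * v x - (3 * c + 2 * k)%:C * helmholtz_inv 4 v x.

Definition dom_JLc (c k : R) phi : set (R -> R[i]) :=
  [set v | L2 v /\ H1 (Lc c k phi v)].

Definition spectrally_stable (c k : R) phi : Prop :=
  forall l, spectrum (dom_JLc c k phi) (fun v => J (Lc c k phi v)) l ->
    ~ 0 < complex.Re l.

End DegasperisProcesi.

(* Main.v *)
Require Import Defs.
From mathcomp Require Import all_boot all_order all_algebra.
From mathcomp Require Import all_classical all_reals all_analysis.
From mathcomp Require Import measurable_realfun complex ring lra.
Set Implicit Arguments.
Unset Strict Implicit.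
Unset Printing Implicit Defensive.
Import Order.TTheory GRing.Theory Num.Theory.
Import numFieldNormedType.Exports.
Local Open Scope classical_set_scope.
Local Open Scope ring_scope.

(* Write [r = c - phi], [L = L_c] and let [s] be the first variation of [S] at [phi].  The profile
   equation reads [(r phi')' = (c - 2 k) phi - 2 phi^2] and has a first integral, which gives the
   positivity, the monotonicity and the exponential decay of [phi] on each side of its crest, the
   identity [L phi' = 0], and an explicit [Y = - d phi / d c] with [L Y = s] and [<Y, s> < 0].

   For [Z] such that [z = (4 - d^2/dx^2)^-1 Z] vanishes at [0], the form [<L Z, Z>] is the sum of
   the integrals of [(L Z)^2 / r] and of a multiple of [z'^2 + V z^2].  As [p = r phi'] solves
   [p'' = V p] and vanishes only at [0], the latter integrand becomes [(z' - (p'/p) z)^2] on each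
   half-line (Jacobi), and controls the distance of [z] to the multiples of [p].  Subtracting a
   multiple of [Y] from an arbitrary [v] leads to
   [|v - h phi'|^2 <= A <L v, v> + B <s, v>^2] for some [h] depending on [v].

   If [(J L - l) v = f] with [a = Re l > 0], the skew-symmetry of [J] bounds [a <L v, v>] and
   [l <s, v>] in terms of [f], and pairing the equation with [phi'] bounds [h].  This resolvent
   estimate is uniform on [Re l >= a].  The equation is solvable for large real [l] by a
   contraction, hence for every [l] with [Re l > 0] by continuation along a segment. *)

(** * Real L^2 functions *)

(** The form of [L] has a negative direction, since [<L Y, Y> = <Y, s> < 0], so it is positive only
    under a constraint. The constraint [z 0 = 0] sits at the only zero of [p], where the Jacobi
    factorization is singular. Its price is that the two half-lines are decoupled: each gives its
    own multiple of [p]. The odd combination of the two is the kernel [phi']; the even one is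
    spurious and is excluded by the pairing with [s]. The sign of [<Y, s>] says that [S] increases
    with the speed along the family of waves, the classical stability criterion. The term [<s, v>^2]
    is harmless in the resolvent estimate because [J s = phi'] and [L phi' = 0] give
    [<s, J L v> = 0]. The estimate alone would give injectivity and a bounded inverse; its
    uniformity is what makes the range full. A complex function is handled as a pair of real ones,
    on which [l = a + i b] acts as a scaled rotation. Weak derivatives and resolvents are all
    reduced to the two explicit exponential kernels that invert [L + d/dx] and [L - d/dx] for a
    constant [L > 0]. *)

Section L2.
Context {R : realType}.
Local Notation mu := (@lebesgue_measure R).
Implicit Types (f g h b : R -> R) (a M : R).

Lemma ae_mono (P Q : R -> Prop) : (forall x, P x -> Q x) ->
  {ae mu, forall x, P x} -> {ae mu, forall x, Q x}.
Proof.
by move=> PQ; apply: filterS; first exact: (ae_filter_ringOfSetsType mu).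
Qed.

Lemma ae1 (U V : Type) (f1 g1 : R -> U) (f g : R -> V) :
  (forall x, f1 x = g1 x -> f x = g x) ->
  f1 = g1 %[ae mu] -> f = g %[ae mu].
Proof.
move=> H; apply: filterS; first exact: (ae_filter_ringOfSetsType mu).
by move=> x /(_ I)/H.
Qed.

Lemma ae2 (U1 U2 V : Type) (f1 g1 : R -> U1) (f2 g2 : R -> U2) (f g : R -> V) :
  (forall x, f1 x = g1 x -> f2 x = g2 x -> f x = g x) ->
  f1 = g1 %[ae mu] -> f2 = g2 %[ae mu] -> f = g %[ae mu].
Proof.
move=> H; apply: filterS2; first exact: (ae_filter_ringOfSetsType mu).
by move=> x /(_ I) h1 /(_ I) h2 _; exact: H.
Qed.

Lemma eq_ae (U : Type) (f g : R -> U) : f =1 g -> f = g %[ae mu].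
Proof. by move=> fg; apply: aeW => x _; exact: fg. Qed.

Lemma ae_sym (U : Type) (f g : R -> U) : f = g %[ae mu] -> g = f %[ae mu].
Proof. exact: ae1. Qed.

Lemma ae_trans (U : Type) (f g h : R -> U) :
  f = g %[ae mu] -> g = h %[ae mu] -> f = h %[ae mu].
Proof. by apply: ae2 => x -> . Qed.

Definition L2r f : Prop :=
  measurable_fun setT f /\ mu.-integrable setT (EFin \o (fun x => f x ^+ 2)).

Lemma L2rP f : (f \in Lfun mu 2%:E) <-> L2r f.
Proof.
split=> [fL|[mf /integrableP[_ fi]]].
  split; last exact: Lfun2_integrable_sqr.
  by move: fL; rewrite inE => /andP[/[!inE]].
rewrite inE; apply/andP; split; first by rewrite inE.
rewrite inE /= /finite_norm unlock poweR_lty//.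
apply: le_lt_trans fi; rewrite le_eqVlt; apply/orP; left; apply/eqP.
apply: eq_integral => x _ /=.
by rewrite [in RHS]ger0_norm ?sqr_ge0// -[LHS]/((`|f x| `^ 2%:R)%:E) powR_mulrn// real_normK ?num_real.
Qed.

Lemma L2r_meas f : L2r f -> measurable_fun setT f. Proof. by case. Qed.

Lemma L2r_mul_int f g : L2r f -> L2r g ->
  mu.-integrable setT (EFin \o (fun x => f x * g x)).
Proof.
move=> /L2rP Lf /L2rP Lg.
exact/(Lfun1_integrable mu (f \* g)).1/Lfun2_mul_Lfun1.
Qed.

Lemma L2r_le f g : measurable_fun setT f -> L2r g ->
  (forall x, `|f x| <= `|g x|) -> L2r f.
Proof.
move=> mf [mg ig] fg; split=> //.
apply: le_integrable ig => //; first exact/measurable_EFinP/measurable_funX.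
move=> x _ /=; rewrite lee_fin !normrX.
by rewrite lerXn2r// nnegrE.
Qed.

Lemma L2r0 : L2r (fun=> 0).
Proof.
split; first exact: measurable_cst.
rewrite (_ : _ \o _ = cst 0%E); first exact: integrable0.
by apply/funext => x /=; rewrite expr0n.
Qed.

Lemma L2rZ a f : L2r f -> L2r (fun x => a * f x).
Proof.
move=> [mf fi]; split; first exact: measurable_funM.
rewrite (_ : _ \o _ = (fun x => (a ^+ 2)%:E * (EFin \o (fun x => f x ^+ 2)%R) x)%E).
  exact: integrableZl.
by apply/funext => x /=; rewrite exprMn EFinM.
Qed.

Lemma L2rD f g : L2r f -> L2r g -> L2r (fun x => f x + g x).
Proof.
move=> Lf Lg; have [mf fi] := Lf; have [mg gi] := Lg.
split; first exact: measurable_funD.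
have h : mu.-integrable setT
    ((EFin \o (fun x => f x ^+ 2)%R) \+ ((EFin \o (fun x => f x * g x)%R) \+ (EFin \o (fun x => f x * g x)%R)
      \+ (EFin \o (fun x => g x ^+ 2)%R)))%E.
  apply: integrableD => //; apply: integrableD => //.
  by apply: integrableD => //; exact: L2r_mul_int.
apply: eq_integrable h => // x _ /=.
by rewrite -!EFinD; congr EFin; ring.
Qed.

Lemma L2rN f : L2r f -> L2r (fun x => - f x).
Proof.
by move=> /(L2rZ (-1)); congr L2r; apply/funext => x; rewrite mulN1r.
Qed.

Lemma L2rB f g : L2r f -> L2r g -> L2r (fun x => f x - g x).
Proof. by move=> Lf /L2rN; exact: L2rD. Qed.

Lemma L2rM M b f : measurable_fun setT b -> (forall x, `|b x| <= M) ->
  L2r f -> L2r (fun x => b x * f x).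
Proof.
move=> mb bM Lf; apply: (@L2r_le _ (fun x => M * f x)).
- by apply: measurable_funM => //; exact: L2r_meas.
- exact: L2rZ.
- move=> x; rewrite !normrM ler_wpM2r//.
  by rewrite (le_trans (bM x))// ler_norm.
Qed.

(** [Rintegral] takes a default value on functions that are not integrable, so linearity asks for
    [L2r] arguments, while symmetry and positivity do not. *)
Definition ip f g : R := \int[mu]_x (f x * g x).
Definition nsq f : R := ip f f.

Lemma ipE f g : ip f g = \int[mu]_x (f x * g x). Proof. by []. Qed.

Lemma nsqE f : nsq f = ip f f. Proof. by []. Qed.

Lemma eq_ip f f' g g' : f =1 f' -> g =1 g' -> ip f g = ip f' g'.
Proof. by move=> /funext -> /funext ->. Qed.

Lemma ipC f g : ip f g = ip g f.
Proof. by apply: eq_Rintegral => x _; rewrite mulrC. Qed.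

Lemma ipMA b f g : ip (fun x => b x * f x) g = ip f (fun x => b x * g x).
Proof. by apply: eq_Rintegral => x _; rewrite mulrCA mulrA. Qed.

Lemma ip0l g : ip (fun=> 0) g = 0.
Proof.
rewrite /ip (@eq_Rintegral _ _ _ _ _ (fun=> 0)) => [|x _]; last by rewrite mul0r.
by rewrite Rintegral_cst// mul0r.
Qed.

Lemma ipZl a f g : L2r f -> L2r g -> ip (fun x => a * f x) g = a * ip f g.
Proof.
move=> Lf Lg; rewrite /ip -RintegralZl//; last exact: L2r_mul_int.
by apply: eq_Rintegral => x _; rewrite mulrA.
Qed.

Lemma ipDl f1 f2 g : L2r f1 -> L2r f2 -> L2r g ->
  ip (fun x => f1 x + f2 x) g = ip f1 g + ip f2 g.
Proof.
move=> Lf1 Lf2 Lg; rewrite /ip -RintegralD//; [|exact: L2r_mul_int..].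
by apply: eq_Rintegral => x _; rewrite mulrDl.
Qed.

Lemma ipBl f1 f2 g : L2r f1 -> L2r f2 -> L2r g ->
  ip (fun x => f1 x - f2 x) g = ip f1 g - ip f2 g.
Proof.
move=> Lf1 Lf2 Lg; rewrite /ip -RintegralB//; [|exact: L2r_mul_int..].
by apply: eq_Rintegral => x _; rewrite mulrBl.
Qed.

Lemma ipNl f g : L2r f -> L2r g -> ip (fun x => - f x) g = - ip f g.
Proof.
move=> Lf Lg; rewrite -mulN1r -ipZl//; apply: eq_ip => // x.
by rewrite mulN1r.
Qed.

Lemma ipZr a f g : L2r f -> L2r g -> ip f (fun x => a * g x) = a * ip f g.
Proof. by move=> *; rewrite ipC ipZl// ipC. Qed.

Lemma ipDr f1 f2 g : L2r f1 -> L2r f2 -> L2r g ->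
  ip g (fun x => f1 x + f2 x) = ip g f1 + ip g f2.
Proof. by move=> *; rewrite ipC ipDl// ipC; congr +%R; rewrite ipC. Qed.

Lemma ipBr f1 f2 g : L2r f1 -> L2r f2 -> L2r g ->
  ip g (fun x => f1 x - f2 x) = ip g f1 - ip g f2.
Proof. by move=> *; rewrite ipC ipBl// ipC; congr (_ - _); rewrite ipC. Qed.

Lemma ipNr f g : L2r f -> L2r g -> ip f (fun x => - g x) = - ip f g.
Proof. by move=> *; rewrite ipC ipNl// ipC. Qed.

Lemma nsq_ge0 f : 0 <= nsq f.
Proof. by apply: Rintegral_ge0 => x _; rewrite -expr2 sqr_ge0. Qed.

Lemma nsqZ a f : L2r f -> nsq (fun x => a * f x) = a ^+ 2 * nsq f.
Proof. by move=> Lf; rewrite /nsq ipZl ?ipZr//; [ring|exact: L2rZ]. Qed.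

Lemma nsqD f g : L2r f -> L2r g ->
  nsq (fun x => f x + g x) = nsq f + 2 * ip f g + nsq g.
Proof.
move=> Lf Lg; rewrite /nsq ipDl ?ipDr//; last exact: L2rD.
by rewrite (ipC g f); ring.
Qed.

Lemma nsqB f g : L2r f -> L2r g ->
  nsq (fun x => f x - g x) = nsq f - 2 * ip f g + nsq g.
Proof.
move=> Lf Lg; rewrite /nsq ipBl ?ipBr//; last exact: L2rB.
by rewrite (ipC g f); ring.
Qed.

Lemma CS f g : L2r f -> L2r g -> ip f g ^+ 2 <= nsq f * nsq g.
Proof.
move=> Lf Lg.
have H (a e : R) : 0 <= a ^+ 2 * nsq f - 2 * a * e * ip f g + e ^+ 2 * nsq g.
  have := nsq_ge0 (fun x => a * f x - e * g x).
  rewrite nsqB ?nsqZ//; [|exact: L2rZ..].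
  by rewrite ipZl ?ipZr//; [lra|exact: L2rZ].
have [g0|g0] := eqVneq (nsq g) 0.
  (* When [nsq g] vanishes, the quadratic form at this point equals [- (ip f g)^2 (nsq f + 2)],
     which forces [ip f g = 0]. *)
  have := H (ip f g) (nsq f + 1); rewrite g0 => H1.
  have := nsq_ge0 f; nra.
have := H (nsq g) (ip f g).
have {}g0 : 0 < nsq g by rewrite lt_neqAle eq_sym g0 nsq_ge0.
rewrite (_ : _ + _ = nsq g * (nsq f * nsq g - ip f g ^+ 2)); last by ring.
by rewrite pmulr_rge0// subr_ge0.
Qed.

Lemma ip_le f g : L2r f -> L2r g -> `|ip f g| <= Num.sqrt (nsq f) * Num.sqrt (nsq g).
Proof.
move=> Lf Lg; rewrite -sqrtrM ?nsq_ge0// -sqrtr_sqr ler_sqrt ?CS//.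
by rewrite mulr_ge0 ?nsq_ge0.
Qed.

Lemma ip_le_half f g : L2r f -> L2r g -> 2 * `|ip f g| <= nsq f + nsq g.
Proof.
move=> Lf Lg; rewrite -[nsq f + _](@ger0_norm R); last by rewrite addr_ge0 ?nsq_ge0.
rewrite -[2](@ger0_norm R)// -normrM -ler_sqr ?nnegrE//.
rewrite !real_normK ?num_real//.
have := CS Lf Lg; have := sqr_ge0 (nsq f - nsq g); nra.
Qed.

Lemma nsq_le f g : L2r f -> L2r g -> (forall x, `|f x| <= `|g x|) -> nsq f <= nsq g.
Proof.
move=> Lf Lg fg; apply: le_Rintegral => //; [exact: L2r_mul_int..|].
by move=> x _; rewrite -!expr2 -(@real_normK _ (f x)) ?num_real// -(@real_normK _ (g x)) ?num_real// ler_sqr ?nnegrE.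
Qed.

Lemma nsqM M b f : measurable_fun setT b -> (forall x, `|b x| <= M) ->
  L2r f -> nsq (fun x => b x * f x) <= M ^+ 2 * nsq f.
Proof.
move=> mb bM Lf; rewrite -nsqZ//; apply: nsq_le.
- exact: L2rM bM Lf.
- exact: L2rZ.
- move=> x; rewrite !normrM ler_wpM2r//.
  by rewrite (le_trans (bM x))// ler_norm.
Qed.

Lemma nsqD_le f g : L2r f -> L2r g ->
  nsq (fun x => f x + g x) <= 2 * (nsq f + nsq g).
Proof.
by move=> Lf Lg; rewrite nsqD//; have := ip_le_half Lf Lg; have := ler_norm (ip f g); lra.
Qed.

Lemma nsqN f : nsq (fun x => - f x) = nsq f.
Proof. by apply: eq_Rintegral => x _; rewrite mulrNN. Qed.

Lemma nsqB_le f g : L2r f -> L2r g ->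
  nsq (fun x => f x - g x) <= 2 * (nsq f + nsq g).
Proof. by move=> Lf Lg; rewrite -(nsqN g); apply: nsqD_le => //; exact: L2rN. Qed.

Definition nrm f := Num.sqrt (nsq f).

Lemma nrm_ge0 f : 0 <= nrm f. Proof. exact: sqrtr_ge0. Qed.

Lemma nrm_sqr f : nrm f ^+ 2 = nsq f. Proof. by rewrite sqr_sqrtr ?nsq_ge0. Qed.

Lemma nrmD f g : L2r f -> L2r g -> nrm (fun x => f x + g x) <= nrm f + nrm g.
Proof.
move=> Lf Lg; rewrite -ler_sqr ?nnegrE ?addr_ge0 ?nrm_ge0//.
rewrite sqrrD !nrm_sqr nsqD//.
by have := ip_le Lf Lg; rewrite -/(nrm f) -/(nrm g); have := ler_norm (ip f g); lra.
Qed.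

Lemma nrmN f : nrm (fun x => - f x) = nrm f.
Proof. by rewrite /nrm nsqN. Qed.

Lemma nrmB f g : L2r f -> L2r g -> nrm (fun x => f x - g x) <= nrm f + nrm g.
Proof. by move=> Lf Lg; rewrite -(nrmN g); apply: nrmD => //; exact: L2rN. Qed.

Lemma nrmZ a f : L2r f -> nrm (fun x => a * f x) = `|a| * nrm f.
Proof. by move=> Lf; rewrite /nrm nsqZ// sqrtrM ?sqr_ge0// sqrtr_sqr. Qed.

Lemma nrmM M b f : 0 <= M -> measurable_fun setT b -> (forall x, `|b x| <= M) ->
  L2r f -> nrm (fun x => b x * f x) <= M * nrm f.
Proof.
move=> M0 mb bM Lf; rewrite -ler_sqr ?nnegrE ?mulr_ge0 ?nrm_ge0//.
by rewrite exprMn !nrm_sqr nsqM.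
Qed.

Lemma ae_ip f f' g g' : measurable_fun setT f -> measurable_fun setT f' ->
  measurable_fun setT g -> measurable_fun setT g' ->
  f = f' %[ae mu] -> g = g' %[ae mu] -> ip f g = ip f' g'.
Proof.
move=> mf mf' mg mg' ff' gg'; congr fine; apply: ae_eq_integral => //.
- by apply/measurable_EFinP/measurable_funM.
- by apply/measurable_EFinP/measurable_funM.
- by apply: ae2 ff' gg' => x /= -> -> .
Qed.

Lemma ae_nsq f g : measurable_fun setT f -> measurable_fun setT g ->
  f = g %[ae mu] -> nsq f = nsq g.
Proof. by move=> mf mg fg; exact: ae_ip. Qed.

Lemma nsq_eq0 f : L2r f -> nsq f = 0 -> f = (fun=> 0) %[ae mu].
Proof.
move=> Lf f0; have mf := L2r_meas Lf.
have /= fi := integrable_fin_num measurableT (L2r_mul_int Lf Lf).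
have : (\int[mu]_x `|(EFin \o (fun x => f x * f x)%R) x| = 0)%E.
  transitivity (\int[mu]_x (f x * f x)%:E)%E.
    by apply: eq_integral => x _ /=; rewrite ger0_norm// -expr2 sqr_ge0.
  by rewrite -[LHS]fineK// -[fine _]/(nsq f) f0.
move=> /(ae_eq_integral_abs _ _ _).1 H.
have {}H := H measurableT (measurable_int _ (L2r_mul_int Lf Lf)).
apply: ae1 H => x /= [] /eqP.
by rewrite mulf_eq0 orbb => /eqP.
Qed.

End L2.

(** * Completeness of L^2 along geometrically convergent sequences *)

Section complete.
Context {R : realType}.
Local Notation mu := (@lebesgue_measure R).
Implicit Types (f g h b : R -> R) (a M : R).

Lemma integral_sqr_nsq f : L2r f -> (\int[mu]_x (f x ^+ 2)%:E = (nsq f)%:E)%E.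
Proof.
move=> Lf; rewrite /nsq /ip /Rintegral fineK; first by apply: eq_integral => x _; rewrite expr2.
exact: (integrable_fin_num measurableT (L2r_mul_int Lf Lf)).
Qed.

Lemma L2r_norm f : L2r f -> L2r (fun x => `|f x|).
Proof.
move=> Lf; apply: (@L2r_le _ _ f) => [|//|x]; last by rewrite normr_id.
by apply: measurableT_comp => //; exact: L2r_meas.
Qed.

Lemma nsq_norm f : nsq (fun x => `|f x|) = nsq f.
Proof. by apply: eq_Rintegral => x _; rewrite -normrM ger0_norm -?expr2 ?sqr_ge0. Qed.

(* The Riesz-Fischer argument: the partial sums of [|u_(n+1) - u_n|] are bounded in L^2. *)
Lemma L2r_geometric_cvg (u : nat -> R -> R) (C q : R) : 0 <= C -> 0 <= q -> q < 1 ->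
  (forall n, L2r (u n)) ->
  (forall n, nrm (fun x => u n.+1 x - u n x) <= C * q ^+ n) ->
  exists2 v, L2r v & forall n, nrm (fun x => u n x - v x) <= C / (1 - q) * q ^+ n.
Proof.
move=> C0 q0 q1 Lu hu.
have q1' : 0 < 1 - q by rewrite subr_gt0.
pose d k x := `|u k.+1 x - u k x|.
have Ld k : L2r (d k) by apply: L2r_norm; exact: L2rB.
pose g N x := \sum_(k < N) d k x.
have gS N : g N.+1 = (fun x => g N x + d N x) by apply/funext => x; rewrite /g big_ord_recr.
have Lg N : L2r (g N).
  elim: N => [|N IH]; last by rewrite gS; exact: L2rD.
  by rewrite (_ : g 0%N = fun=> 0); [exact: L2r0 | apply/funext => x; rewrite /g big_ord0].
have ng N : nrm (g N) <= C / (1 - q) * (1 - q ^+ N).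
  elim: N => [|N IH].
    rewrite (_ : g 0%N = fun=> 0); last by apply/funext => x; rewrite /g big_ord0.
    by rewrite /nrm /nsq ip0l sqrtr0 expr0 subrr mulr0.
  rewrite gS (le_trans (nrmD _ _))//.
  rewrite (_ : _ * _ = C / (1 - q) * (1 - q ^+ N) + C * q ^+ N); last first.
    by rewrite exprS; field; rewrite gt_eqF.
  apply: lerD => //; rewrite /nrm nsq_norm; exact: hu.
have g0 N x : 0 <= g N x by apply: sumr_ge0 => k _; rewrite normr_ge0.
have gnd x : {homo (g ^~ x) : m n / (m <= n)%N >-> m <= n}.
  apply/nondecreasing_seqP => n.
  by rewrite (_ : g n.+1 x = g n x + d n x) ?gS// lerDl normr_ge0.
pose h N x := (g N x ^+ 2)%:E.
have mh N : measurable_fun setT (h N).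
  by apply/measurable_EFinP/measurable_funX; exact: L2r_meas.
have hnd x : {homo (h ^~ x) : m n / (m <= n)%N >-> (m <= n)%E}.
  move=> m n mn; rewrite /h lee_fin ler_sqr ?nnegrE//.
  exact: gnd.
have h0 N x : (0 <= h N x)%E by rewrite /h lee_fin sqr_ge0.
pose K := C / (1 - q).
have K0 : 0 <= K by rewrite /K divr_ge0// ltW.
have intlim : (\int[mu]_x limn (h ^~ x) <= (K ^+ 2)%:E)%E.
  rewrite monotone_convergence//.
  have ndI : nondecreasing_seq (fun n => \int[mu]_x h n x)%E.
    move=> m n mn; apply: ge0_le_integral; [by []|by move=> ? ?; exact: h0|exact: mh|exact: mh|].
    by move=> x _; exact: hnd.
  apply: lime_le; first exact: ereal_nondecreasing_is_cvgn.
  apply: nearW => N; rewrite integral_sqr_nsq// lee_fin -nrm_sqr.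
  rewrite ler_sqr ?nnegrE ?nrm_ge0// (le_trans (ng N))//.
  by rewrite ler_piMr// lerBlDr lerDl exprn_ge0.
have lim0 x : (0 <= limn (h ^~ x))%E.
  apply: lime_ge; first by apply: ereal_nondecreasing_is_cvgn; exact: hnd.
  exact: nearW.
have mlim : measurable_fun setT (fun x => limn (h ^~ x)).
  apply: (emeasurable_fun_cvg h) => // x _.
  by apply: ereal_nondecreasing_is_cvgn; exact: hnd.
have ilim : mu.-integrable setT (fun x => limn (h ^~ x)).
  apply/integrableP; split => //.
  under eq_integral do rewrite gee0_abs//.
  by rewrite (le_lt_trans intlim)// ltry.
have fin := integrable_ae measurableT ilim.
(* The limit superior is measurable whether or not the sequence converges; [cv] identifies it with
   the limit almost everywhere. *)
pose v x := fine (limn_esup (fun n => (u n x)%:E)).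
have mv : measurable_fun setT v.
  apply: measurableT_comp => //.
  apply: measurable_fun_limn_esup => n.
  by apply/measurable_EFinP; exact: L2r_meas.
have cv : {ae mu, forall x, setT x -> u n x @[n --> \oo] --> v x}.
  apply: ae_mono fin => x /(_ I) xfin _.
  have gx : cvgn (series (d ^~ x)).
    apply: nondecreasing_is_cvgn.
      by apply/nondecreasing_seqP => n; rewrite seriesEord/= big_ord_recr/= lerDl normr_ge0.
    exists (fine (limn (h ^~ x)) + 1) => _ [N _ <-].
    rewrite seriesEord/= -/(g N x).
    have : (h N x <= limn (h ^~ x))%E.
      apply: lime_ge; first by apply: ereal_nondecreasing_is_cvgn; exact: hnd.
      by exists N => // n /= Nn; exact: hnd.
    rewrite -[limn _]fineK// lee_fin; have := g0 N x; nra.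
  have : cvgn (series (telescope (u ^~ x))) by apply: normed_cvg.
  move=> cs; have cu : cvgn (u ^~ x).
    rewrite (_ : u ^~ x = (fun n => u 0%N x + series (telescope (u ^~ x)) n)); last first.
      by apply/funext => n; exact: eq_sum_telescope.
    by apply: is_cvgD => //; exact: is_cvg_cst.
  have cE : (fun n => (u n x)%:E) @ \oo --> (limn (u ^~ x))%:E.
    by apply/fine_cvgP; split; [exact: nearW | exact: cu].
  rewrite /v is_cvg_limn_esupE; last by apply/cvg_ex; eexists; exact: cE.
  by rewrite (cvg_lim _ cE).
have num n m : (n <= m)%N -> nrm (fun x => u n x - u m x) <= K * q ^+ n.
  move=> nm; apply: (@le_trans _ _ (K * (q ^+ n - q ^+ m))); last first.
    by rewrite ler_wpM2l// lerBlDr lerDl exprn_ge0.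
  move: nm; elim: m => [|m IH].
    rewrite leqn0 => /eqP ->; rewrite subrr mulr0.
    by rewrite (_ : (fun x => _) = fun=> 0) ?/nrm /nsq ?ip0l ?sqrtr0//; apply/funext => x; rewrite subrr.
  rewrite leq_eqVlt => /orP[/eqP->|]; last first.
    rewrite ltnS => /IH {}IH.
    rewrite (_ : (fun x => _) = (fun x => (u n x - u m x) - (u m.+1 x - u m x))); last first.
      by apply/funext => x; ring.
    apply: (le_trans (nrmB (L2rB (Lu n) (Lu m)) (L2rB (Lu m.+1) (Lu m)))).
    rewrite (_ : K * (q ^+ n - q ^+ m.+1) = K * (q ^+ n - q ^+ m) + C * q ^+ m); first exact: lerD.
    by rewrite /K exprS; field; rewrite gt_eqF.
  rewrite subrr mulr0.
  by rewrite (_ : (fun x => _) = fun=> 0) ?/nrm /nsq ?ip0l ?sqrtr0//; apply/funext => x; rewrite subrr.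
(* Fatou's lemma in [m] transfers the Cauchy estimate [num] to the limit; membership of [v] in L^2
   also comes from it. *)
have key n : (\int[mu]_x ((u n x - v x) ^+ 2)%:E <= ((K * q ^+ n) ^+ 2)%:E)%E.
  pose F m x := ((u n x - u m x) ^+ 2)%:E.
  have mF m : measurable_fun setT (F m).
    by apply/measurable_EFinP; exact: measurable_funX (L2r_meas (L2rB (Lu n) (Lu m))).
  have F0 m x : (0 <= F m x)%E by rewrite lee_fin sqr_ge0.
  have := @fatou _ _ _ mu setT measurableT F mF (fun m x _ => F0 m x).
  have -> : (\int[mu]_x limn_einf (F^~ x) = \int[mu]_x ((u n x - v x) ^+ 2)%:E)%E.
    apply: ae_eq_integral => //.
    - apply: (eq_measurable_fun (fun x => - limn_esup (fun m => - F m x))%E).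
        by move=> x _; rewrite limn_esupN oppeK.
      apply: measurableT_comp => //.
      by apply: measurable_fun_limn_esup => m; apply: measurableT_comp => //; exact: mF.
    - by apply/measurable_EFinP/measurable_funX/measurable_funB => //; exact: L2r_meas.
    - apply: ae_mono cv => x /(_ I) cvx _.
      have cF : F m x @[m --> \oo] --> ((u n x - v x) ^+ 2)%:E.
        apply/fine_cvgP; split; first exact: nearW.
        rewrite /F /comp /=; under eq_fun do rewrite expr2.
        by rewrite expr2; apply: cvgM; (apply: cvgB; [exact: cvg_cst|exact: cvx]).
      by rewrite is_cvg_limn_einfE ?(cvg_lim _ cF)//; apply/cvg_ex; eexists; exact: cF.
  move/le_trans; apply.
  have le m : (n <= m)%N -> (\int[mu]_x F m x <= ((K * q ^+ n) ^+ 2)%:E)%E.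
    move=> nm; rewrite integral_sqr_nsq; last exact: L2rB.
    have KqN : 0 <= K * q ^+ n by rewrite mulr_ge0// exprn_ge0.
    rewrite lee_fin -nrm_sqr ler_sqr ?nnegrE ?nrm_ge0//.
    exact: num.
  rewrite limn_einf_lim; apply: lime_le; first exact: is_cvg_einfs.
  apply: nearW => m; apply: (@le_trans _ _ (\int[mu]_x F (maxn m n) x)%E).
    by apply: ereal_inf_lbound; exists (maxn m n) => //=; rewrite leq_maxl.
  by apply: le; rewrite leq_maxr.
have Lv : L2r v.
  have L0 : L2r (fun x => u 0%N x - v x).
    split; first by apply: measurable_funB => //; exact: L2r_meas.
    apply/integrableP; split.
      by apply/measurable_EFinP/measurable_funX/measurable_funB => //; exact: L2r_meas.
    under eq_integral do rewrite gee0_abs ?lee_fin ?sqr_ge0//.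
    by rewrite (le_lt_trans (key 0%N))// ltry.
  rewrite (_ : v = fun x => u 0%N x - (u 0%N x - v x)); last by apply/funext => x; ring.
  exact: L2rB.
exists v => // n.
have := key n; rewrite integral_sqr_nsq; last exact: L2rB.
have KqN : 0 <= K * q ^+ n by rewrite mulr_ge0// exprn_ge0.
by rewrite lee_fin -nrm_sqr ler_sqr ?nnegrE ?nrm_ge0.
Qed.

End complete.

(** * Fixed points of contractions on pairs of L^2 functions *)

Section contraction.
Context {R : realType}.
Local Notation mu := (@lebesgue_measure R).
Implicit Types (f g h b : R -> R) (a M : R).

Lemma le_geometric_eq0 (x C q : R) : 0 <= q -> q < 1 -> 0 <= x ->
  (forall n : nat, x <= C * q ^+ n) -> x = 0.
Proof.
move=> q0 q1 x0 xC; apply/eqP; rewrite eq_le x0 andbT.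
have cq : (fun n : nat => C * q ^+ n) @ \oo --> (C * 0 : R).
  by apply: cvgMr; apply: cvg_expr; rewrite ger0_norm.
rewrite mulr0 in cq; rewrite -(cvg_lim _ cq)//.
apply: limr_ge; first by apply/cvg_ex; exists 0.
exact: nearW.
Qed.

Lemma nrm_eq0 f : L2r f -> nrm f = 0 -> f = (fun=> 0) %[ae mu].
Proof. by move=> Lf f0; apply: nsq_eq0 => //; rewrite -nrm_sqr f0 expr0n. Qed.

(** Banach's theorem for the sum of two seminorms; the components will be real and imaginary parts.
    As [nrm] is only a seminorm, the fixed point is one almost everywhere. *)
Lemma L2r_contraction (N1 N2 : (R -> R) -> (R -> R) -> R -> R) (q : R) :
  0 <= q -> q < 1 ->
  (forall u1 u2, L2r u1 -> L2r u2 -> L2r (N1 u1 u2) /\ L2r (N2 u1 u2)) ->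
  (forall u1 u2 v1 v2, L2r u1 -> L2r u2 -> L2r v1 -> L2r v2 ->
    nrm (fun x => N1 u1 u2 x - N1 v1 v2 x) + nrm (fun x => N2 u1 u2 x - N2 v1 v2 x)
    <= q * (nrm (fun x => u1 x - v1 x) + nrm (fun x => u2 x - v2 x))) ->
  exists v1 v2, [/\ L2r v1, L2r v2,
    N1 v1 v2 = v1 %[ae mu] & N2 v1 v2 = v2 %[ae mu]].
Proof.
move=> q0 q1 LN cN.
pose N (u : (R -> R) * (R -> R)) := (N1 u.1 u.2, N2 u.1 u.2).
pose u n := iter n N ((fun=> 0) : R -> R, (fun=> 0) : R -> R).
have Lu n : L2r (u n).1 /\ L2r (u n).2.
  elim: n => [|n [IH1 IH2]]; first by split; exact: L2r0.
  exact: LN.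
pose dl n := nrm (fun x => (u n.+1).1 x - (u n).1 x) + nrm (fun x => (u n.+1).2 x - (u n).2 x).
have dlq n : dl n <= dl 0%N * q ^+ n.
  elim: n => [|n IH]; first by rewrite expr0 mulr1.
  have [a1 a2] := Lu n; have [b1 b2] := Lu n.+1.
  apply: (le_trans (cN _ _ _ _ b1 b2 a1 a2)).
  by rewrite exprS mulrCA; exact: ler_wpM2l.
have dl0 n : 0 <= dl n by rewrite addr_ge0 ?nrm_ge0.
have [v1 Lv1 cv1] : exists2 v, L2r v & forall n, nrm (fun x => (u n).1 x - v x) <= dl 0%N / (1 - q) * q ^+ n.
  apply: (L2r_geometric_cvg (u := fun n => (u n).1)) => // [n|n]; first by case: (Lu n).
  by apply: le_trans (dlq n); rewrite /dl lerDl nrm_ge0.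
have [v2 Lv2 cv2] : exists2 v, L2r v & forall n, nrm (fun x => (u n).2 x - v x) <= dl 0%N / (1 - q) * q ^+ n.
  apply: (L2r_geometric_cvg (u := fun n => (u n).2)) => // [n|n]; first by case: (Lu n).
  by apply: le_trans (dlq n); rewrite /dl lerDr nrm_ge0.
have [LN1 LN2] := LN _ _ Lv1 Lv2.
pose e := nrm (fun x => N1 v1 v2 x - v1 x) + nrm (fun x => N2 v1 v2 x - v2 x).
have e0 : e = 0.
  (* With [K = dl 0 / (1 - q)], comparison with the iterate [u n] costs [2 q K q^n] for the images
     and [2 K q^n] for the distance of [u n.+1] to the limit. *)
  apply: (le_geometric_eq0 (C := (2 * q + 2) * (dl 0%N / (1 - q))) q0 q1).
    by rewrite addr_ge0 ?nrm_ge0.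
  move=> n; have [a1 a2] := Lu n; have [b1 b2] := Lu n.+1.
  have := cN _ _ _ _ Lv1 Lv2 a1 a2.
  have sym f g : nrm (fun x => f x - g x) = nrm (fun x => g x - f x).
    by rewrite -nrmN; congr nrm; apply/funext => x; rewrite opprB.
  rewrite (sym v1) (sym v2) => H.
  have T1 : nrm (fun x => N1 v1 v2 x - v1 x) <=
      nrm (fun x => N1 v1 v2 x - (u n.+1).1 x) + nrm (fun x => (u n.+1).1 x - v1 x).
    rewrite (_ : (fun x => _) = (fun x => (N1 v1 v2 x - (u n.+1).1 x) + ((u n.+1).1 x - v1 x))); last first.
      by apply/funext => x; ring.
    by apply: nrmD; exact: L2rB.
  have T2 : nrm (fun x => N2 v1 v2 x - v2 x) <=
      nrm (fun x => N2 v1 v2 x - (u n.+1).2 x) + nrm (fun x => (u n.+1).2 x - v2 x).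
    rewrite (_ : (fun x => _) = (fun x => (N2 v1 v2 x - (u n.+1).2 x) + ((u n.+1).2 x - v2 x))); last first.
      by apply/funext => x; ring.
    by apply: nrmD; exact: L2rB.
  have c1 := cv1 n.+1; have c2 := cv2 n.+1.
  have d1 := cv1 n; have d2 := cv2 n.
  have : q * (nrm (fun x => (u n).1 x - v1 x) + nrm (fun x => (u n).2 x - v2 x)) <=
      q * (2 * (dl 0%N / (1 - q) * q ^+ n)) by apply: ler_wpM2l => //; lra.
  have : dl 0%N / (1 - q) * q ^+ n.+1 <= dl 0%N / (1 - q) * q ^+ n.
    rewrite ler_wpM2l//; first by rewrite divr_ge0// subr_ge0 ltW.
    by rewrite exprS ler_piMl ?exprn_ge0// ltW.
  rewrite /e; move: H T1 T2 c1 c2; rewrite /u /= -/(u n); lra.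
have /andP[/eqP n1 /eqP n2] : (nrm (fun x => N1 v1 v2 x - v1 x) == 0) && (nrm (fun x => N2 v1 v2 x - v2 x) == 0).
  by rewrite -paddr_eq0 ?nrm_ge0//; exact/eqP.
exists v1, v2; split=> //.
- by move/nrm_eq0: n1 => /(_ (L2rB LN1 Lv1)); apply: ae1 => x /eqP; rewrite subr_eq0 => /eqP.
- by move/nrm_eq0: n2 => /(_ (L2rB LN2 Lv2)); apply: ae1 => x /eqP; rewrite subr_eq0 => /eqP.
Qed.

End contraction.

(** * Integral operators and the resolvents of d/dx *)

Section kernel.
Context {R : realType}.
Local Notation mu := (@lebesgue_measure R).
Implicit Types (f g h b : R -> R) (a M : R) (K : R -> R -> R).

Definition kernel_op K f x : R := \int[mu]_y (K x y * f y).

(** Hypotheses of the Schur test, with one constant for rows and columns. The pointwise bound by [1]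
    makes [K x y * f y ^+ 2] integrable in [y] for every [x], not only for almost every one. *)
Definition schur M K : Prop :=
  [/\ measurable_fun setT (fun p : R * R => K p.1 p.2),
      forall x y, 0 <= K x y <= 1,
      forall x, (\int[mu]_y (K x y)%:E <= M%:E)%E
    & forall y, (\int[mu]_x (K x y)%:E <= M%:E)%E].

Lemma schur_sym M K : schur M K -> schur M (fun x y => K y x).
Proof.
move=> [mK K01 K1 K2]; split => //.
rewrite (_ : (fun p => _) = (fun p => K p.1 p.2) \o (fun p => (p.2, p.1)))//.
by apply: measurableT_comp => //; exact: measurable_fun_pair.
Qed.

Lemma measurable_kernelr M K x : schur M K -> measurable_fun setT (K x).
Proof.
move=> [mK _ _ _].
rewrite (_ : K x = (fun p : R * R => K p.1 p.2) \o pair x)//.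
exact: measurableT_comp.
Qed.

Lemma kernel_integrable M K x : schur M K -> mu.-integrable setT (EFin \o K x).
Proof.
move=> KS; have [_ K01 K1 _] := KS; apply/integrableP; split.
  by apply/measurable_EFinP; exact: measurable_kernelr KS.
apply: le_lt_trans (ltry M); apply: le_trans (K1 x).
rewrite le_eqVlt; apply/orP; left; apply/eqP; apply: eq_integral => y _ /=.
by rewrite ger0_norm//; case/andP: (K01 x y).
Qed.

Lemma kernel_sqr_integrable M K x f : schur M K -> L2r f ->
  mu.-integrable setT (EFin \o (fun y => K x y * f y ^+ 2)).
Proof.
move=> KS [mf fi]; have [_ K01 K1 _] := KS.
apply: le_integrable fi => //.
  apply/measurable_EFinP/measurable_funM; first exact: measurable_kernelr KS.
  exact: measurable_funX.
move=> y _ /=; rewrite lee_fin normrM ler_piMl//.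
by have /andP[k0 k1] := K01 x y; rewrite ger0_norm.
Qed.

Lemma kernel_mul_integrable M K x f : schur M K -> L2r f ->
  mu.-integrable setT (EFin \o (fun y => K x y * f y)).
Proof.
move=> KS Lf; have [_ K01 K1 _] := KS; have mf := L2r_meas Lf.
have h := integrableD measurableT (kernel_integrable x KS) (kernel_sqr_integrable x KS Lf).
apply: le_integrable h => //.
  by apply/measurable_EFinP/measurable_funM => //; exact: measurable_kernelr KS.
move=> y _ /=; rewrite lee_fin normrM.
have /andP[k0 k1] := K01 x y.
rewrite [X in _ <= X]ger0_norm; last by rewrite addr_ge0// mulr_ge0// sqr_ge0.
rewrite ger0_norm// -{2}[K x y]mulr1 -mulrDr ler_wpM2l//.
have := sqr_ge0 (`|f y| - 1); rewrite -(@real_normK _ (f y)) ?num_real//.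
have := sqr_ge0 `|f y|; nra.
Qed.

(** Cauchy-Schwarz for the measure [K x y dy], of mass at most [M]: the integral of
    [K x y (t - f y)^2] is nonnegative for every [t], and [t = a / M] is the best choice. *)
Lemma kernel_op_le M K x f : 0 < M -> schur M K -> L2r f ->
  kernel_op K f x ^+ 2 <= M * kernel_op K (fun y => f y ^+ 2) x.
Proof.
move=> M0 KS Lf; have [_ K01 K1 _] := KS.
set A := kernel_op K (fun y => f y ^+ 2) x; set a := kernel_op K f x.
have KM : \int[mu]_y K x y <= M.
  have := K1 x; rewrite -[leLHS]fineK ?lee_fin//.
  exact: (integrable_fin_num measurableT (kernel_integrable x KS)).
have H t : 2 * t * a <= t ^+ 2 * M + A.
  rewrite /a /kernel_op -RintegralZl//; last exact: kernel_mul_integrable KS Lf.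
  apply: (@le_trans _ _ (\int[mu]_y (t ^+ 2 * K x y + K x y * f y ^+ 2))); last first.
    rewrite RintegralD//; last 2 first.
    - by apply: (integrableZl measurableT (t ^+ 2) (kernel_integrable x KS)).
    - exact: kernel_sqr_integrable KS Lf.
    rewrite RintegralZl//; last exact: kernel_integrable KS.
    by apply: lerD => //; rewrite ler_wpM2l// sqr_ge0.
  apply: le_Rintegral => //.
  - exact: (integrableZl measurableT (2 * t) (kernel_mul_integrable x KS Lf)).
  - exact: (integrableD measurableT (integrableZl measurableT (t ^+ 2) (kernel_integrable x KS)) (kernel_sqr_integrable x KS Lf)).
  - move=> y _; have /andP[k0 _] := K01 x y.
    rewrite -subr_ge0 (_ : _ - _ = K x y * (t - f y) ^+ 2); last by ring.
    by rewrite mulr_ge0// sqr_ge0.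
have := H (a / M).
rewrite (_ : 2 * (a / M) * a = 2 * (a ^+ 2 / M)); last by field; rewrite gt_eqF.
rewrite (_ : (a / M) ^+ 2 * M = a ^+ 2 / M); last by field; rewrite gt_eqF.
rewrite mulrDl mul1r lerD2l ler_pdivrMr//; first by rewrite mulrC.
Qed.

Lemma measurable_kernel_op M K f : schur M K -> measurable_fun setT f ->
  measurable_fun setT (kernel_op K f).
Proof.
move=> [mK K01 _ _] mf.
apply: measurableT_comp => //.
pose F (p : R * R) := (K p.1 p.2 * f p.2)%:E.
have mF : measurable_fun setT F.
  by apply/measurable_EFinP; apply: measurable_funM => //; exact: measurableT_comp.
rewrite (_ : (fun x => _) = (fun x => \int[mu]_y F^\+ (x, y) - \int[mu]_y F^\- (x, y))%E); last first.
  apply/funext => x; rewrite integralE.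
  by congr (_ - _)%E; apply: eq_integral => y _; rewrite unlock.
apply: emeasurable_funB.
- apply: (@measurable_fun_fubini_tonelli_F _ _ _ _ _ mu F^\+%E) => //.
  exact: measurable_funepos.
- apply: (@measurable_fun_fubini_tonelli_F _ _ _ _ _ mu F^\-%E) => //.
  exact: measurable_funeneg.
Qed.

(** The Schur test: [kernel_op_le] is integrated in [x], Tonelli's theorem exchanges the integrals,
    and the column bound gives the second factor [M]. *)
Lemma kernel_op_L2r M K f : 0 < M -> schur M K -> L2r f ->
  L2r (kernel_op K f) /\ nsq (kernel_op K f) <= M ^+ 2 * nsq f.
Proof.
move=> M0 KS Lf; have [mK K01 K1 K2] := KS.
have mop := measurable_kernel_op KS (L2r_meas Lf).
have [mf _] := Lf.
have key : (\int[mu]_x (kernel_op K f x ^+ 2)%:E <= (M ^+ 2 * nsq f)%:E)%E.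
  apply: (@le_trans _ _ (\int[mu]_x (M%:E * \int[mu]_y (K x y * f y ^+ 2)%:E))%E).
    apply: ge0_le_integral => //.
    - by move=> x _; rewrite lee_fin sqr_ge0.
    - by apply/measurable_EFinP/measurable_funX.
    - apply: measurable_funeM.
      apply: (@measurable_fun_fubini_tonelli_F _ _ _ _ _ mu (fun p : R * R => (K p.1 p.2 * f p.2 ^+ 2)%:E)) => //.
      + apply/measurable_EFinP/measurable_funM => //.
        by apply: measurable_funX; exact: measurableT_comp.
      + move=> p; rewrite lee_fin mulr_ge0 ?sqr_ge0//.
        by case/andP: (K01 p.1 p.2).
    - move=> x _; have h := kernel_op_le x M0 KS Lf.
      rewrite -lee_fin (EFinM M) in h; apply: le_trans h _.
      rewrite /kernel_op /Rintegral fineK//.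
      exact: (integrable_fin_num measurableT (kernel_sqr_integrable x KS Lf)).
  have mG : measurable_fun setT (fun p : R * R => (K p.1 p.2 * f p.2 ^+ 2)%:E).
    apply/measurable_EFinP/measurable_funM => //.
    by apply: measurable_funX; exact: measurableT_comp.
  have G0 (p : R * R) : (0 <= (K p.1 p.2 * f p.2 ^+ 2)%:E)%E.
    by rewrite lee_fin mulr_ge0 ?sqr_ge0//; case/andP: (K01 p.1 p.2).
  rewrite ge0_integralZl//; last 3 first.
  - exact: (@measurable_fun_fubini_tonelli_F _ _ _ _ _ mu _ mG).
  - by move=> x _; apply: integral_ge0 => y _; exact: (G0 (x, y)).
  - by rewrite lee_fin ltW.
  rewrite expr2 -mulrA EFinM lee_pmul2l//.
  have -> := @fubini_tonelli _ _ _ _ _ mu mu _ mG G0.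
  apply: (@le_trans _ _ (\int[mu]_y (M%:E * (f y ^+ 2)%:E))%E).
    apply: ge0_le_integral => //.
    - by move=> y _; apply: integral_ge0 => x _; exact: (G0 (x, y)).
    - exact: (@measurable_fun_fubini_tonelli_G _ _ _ _ _ mu _ mG).
    - by apply: measurable_funeM; apply/measurable_EFinP/measurable_funX.
    - move=> y _; rewrite /fubini_G /=.
      under eq_integral do rewrite EFinM.
      rewrite ge0_integralZr//.
      + by rewrite lee_wpmul2r// lee_fin sqr_ge0.
      + by apply/measurable_EFinP; exact: (measurable_kernelr y (schur_sym KS)).
      + by move=> x _; rewrite lee_fin; case/andP: (K01 x y).
      + by rewrite lee_fin sqr_ge0.
  rewrite ge0_integralZl//; last 3 first.
  - by apply/measurable_EFinP/measurable_funX.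
  - by move=> y _; rewrite lee_fin sqr_ge0.
  - by rewrite lee_fin ltW.
  by rewrite integral_sqr_nsq// EFinM.
have Lop : L2r (kernel_op K f).
  split => //; apply/integrableP; split.
    by apply/measurable_EFinP/measurable_funX.
  under eq_integral do rewrite gee0_abs ?lee_fin ?sqr_ge0//.
  by rewrite (le_lt_trans key)// ltry.
by split=> //; rewrite -lee_fin -integral_sqr_nsq.
Qed.

(** Fubini's theorem applies because the kernel applied to [|f|] is again in L^2, so that its
    product with [|g|] is integrable. *)
Lemma kernel_op_adj M K f g : 0 < M -> schur M K -> L2r f -> L2r g ->
  ip (kernel_op K f) g = ip f (kernel_op (fun x y => K y x) g).
Proof.
move=> M0 KS Lf Lg; have [mK K01 K1 K2] := KS.
have mf := L2r_meas Lf; have mg := L2r_meas Lg.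
have L1 h y : L2r h -> mu.-integrable setT (EFin \o (fun x => K x y * h x)).
  by move=> Lh; exact: (kernel_mul_integrable y (schur_sym KS) Lh).
pose F (p : R * R) := (K p.1 p.2 * f p.2 * g p.1)%:E.
have mF : measurable_fun setT F.
  apply/measurable_EFinP; apply: measurable_funM; last exact: measurableT_comp.
  by apply: measurable_funM => //; exact: measurableT_comp.
have FI : (mu \x mu)%E.-integrable setT F.
  apply/(@integrable12ltyP _ _ _ _ R mu mu F mF).
  have LA : L2r (kernel_op K (fun y => `|f y|)) by apply: (kernel_op_L2r M0 KS _).1; exact: L2r_norm.
  have /integrableP[_] := L2r_mul_int LA (L2r_norm Lg).
  apply: le_lt_trans; apply: ge0_le_integral => //.
  - by move=> x _; apply: integral_ge0.
  - apply: (@measurable_fun_fubini_tonelli_F _ _ _ _ _ mu (fun p => `|F p|%E)) => //.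
    exact: measurableT_comp.
  - apply: measurableT_comp => //; apply/measurable_EFinP/measurable_funM.
    + exact: L2r_meas.
    + exact: measurableT_comp.
  - move=> x _ /=.
    rewrite ger0_norm; last first.
      by rewrite mulr_ge0//; apply: Rintegral_ge0 => y _; rewrite mulr_ge0//; case/andP: (K01 x y).
    rewrite /kernel_op EFinM /Rintegral fineK; last first.
      exact: (integrable_fin_num measurableT (kernel_mul_integrable x KS (L2r_norm Lf))).
    rewrite -ge0_integralZr//.
    + rewrite le_eqVlt; apply/orP; left; apply/eqP; apply: eq_integral => y _.
      by rewrite -EFinM !normrM (ger0_norm (proj1 (andP (K01 x y)))).
    + by apply: measurable_int; exact: (kernel_mul_integrable x KS (L2r_norm Lf)).
    + by move=> y _; rewrite lee_fin mulr_ge0//; case/andP: (K01 x y).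
have := Fubini FI.
rewrite /ip /Rintegral => FF; congr fine.
transitivity (\int[mu]_x \int[mu]_y F (x, y))%E.
  apply: eq_integral => x _; rewrite EFinM /kernel_op /Rintegral fineK; last first.
    exact: (integrable_fin_num measurableT (kernel_mul_integrable x KS Lf)).
  rewrite -integralZr//; first exact: kernel_mul_integrable KS Lf.
rewrite FF; apply: eq_integral => y _; rewrite EFinM /kernel_op /Rintegral fineK; last first.
  exact: (integrable_fin_num measurableT (L1 g y Lg)).
rewrite -integralZl//; last exact: (L1 g y Lg).
by apply: eq_integral => x _; rewrite -EFinM /F /=; congr EFin; ring.
Qed.

End kernel.

(** * Derivatives of functions of one variable *)

Section calculus.
Context {R : realType}.
Local Notation mu := (@lebesgue_measure R).
Implicit Types (f g F G : R -> R) (x a b : R).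

Definition der f x a : Prop := is_derive x 1 f a.

Lemma derE f x a b : der f x a -> a = b -> der f x b.
Proof. by move=> + <-. Qed.

Lemma eq_der f g x a : f =1 g -> der f x a -> der g x a.
Proof. by move=> /funext ->. Qed.

Lemma der_id x : der (fun x => x) x 1.
Proof. exact: is_derive_id. Qed.

Lemma der_cst (k x : R) : der (fun=> k) x 0.
Proof. exact: is_derive_cst. Qed.

Lemma derD f g x a b : der f x a -> der g x b -> der (fun x => f x + g x) x (a + b).
Proof. by move=> fa gb; exact: is_deriveD. Qed.

Lemma derB f g x a b : der f x a -> der g x b -> der (fun x => f x - g x) x (a - b).
Proof. by move=> fa gb; exact: is_deriveB. Qed.

Lemma derN f x a : der f x a -> der (fun x => - f x) x (- a).
Proof. by move=> fa; exact: is_deriveN. Qed.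

Lemma derM f g x a b : der f x a -> der g x b -> der (fun x => f x * g x) x (a * g x + f x * b).
Proof.
move=> fa gb; apply: (derE (is_deriveM fa gb)).
by rewrite /GRing.scale /= addrC (mulrC (g x)).
Qed.

Lemma derZ k f x a : der f x a -> der (fun x => k * f x) x (k * a).
Proof. by move=> fa; apply: (derE (derM (der_cst k x) fa)); rewrite mul0r add0r. Qed.

Lemma der_sqr f x a : der f x a -> der (fun x => f x ^+ 2) x (2 * f x * a).
Proof.
move=> fa; apply: (@eq_der (fun x => f x * f x)) => [y|]; first by rewrite expr2.
by apply: (derE (derM fa fa)); ring.
Qed.

Lemma derV f x a : f x != 0 -> der f x a -> der (fun x => (f x)^-1) x (- a / f x ^+ 2).
Proof.
move=> fx fa; apply: (derE (is_deriveV fx fa)).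
by rewrite /GRing.scale /= mulrC mulrN mulNr.
Qed.

Lemma der_comp f g x a b : der f (g x) a -> der g x b -> der (fun x => f (g x)) x (a * b).
Proof. exact: is_derive1_comp. Qed.

Lemma der_exp f x a : der f x a -> der (fun x => expR (f x)) x (a * expR (f x)).
Proof.
by move=> fa; apply: (derE (der_comp (is_derive_expR (f x)) fa)); rewrite mulrC.
Qed.

Lemma der_derivable f x a : der f x a -> derivable f x 1.
Proof. by case. Qed.

Lemma derP f x a : derivable f x 1 -> derive1 f x = a -> der f x a.
Proof. by move=> df <-; rewrite /der derive1E; exact: derivableP. Qed.

Lemma der_val f x a : der f x a -> derive1 f x = a.
Proof. by move=> fa; rewrite derive1E; have [_ ->] := fa. Qed.

Lemma derive1_der f x : derivable f x 1 -> der f x (derive1 f x).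
Proof. by move=> df; exact: derP. Qed.

Lemma der_unique f x a b : der f x a -> der f x b -> a = b.
Proof. by move=> /der_val <- /der_val <-. Qed.

Lemma der_continuous f x a : der f x a -> {for x, continuous f}.
Proof.
move=> /der_derivable fa; apply: differentiable_continuous.
exact/derivable1_diffP.
Qed.

Lemma der_continuousT f g : (forall x, der f x (g x)) -> continuous f.
Proof. by move=> fg x; exact: der_continuous (fg x). Qed.

Lemma near_eq_der f g x a e : 0 < e -> (forall y, `|y - x| < e -> f y = g y) ->
  der f x a -> der g x a.
Proof.
move=> e0 fg fa; have fgn : {near x, f =1 g}.
  exists e => //= y /=; rewrite distrC; exact: fg.
have dg : derivable g x 1.
  by move/der_derivable : fa; exact: near_eq_derivable.
apply: derP => //; rewrite derive1E -(near_eq_derive _ fgn).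
by rewrite -derive1E; exact: der_val.
Qed.

Lemma near_eq_continuous f g x e : 0 < e -> (forall y, `|y - x| < e -> f y = g y) ->
  {for x, continuous f} -> {for x, continuous g}.
Proof.
move=> e0 fg; have fgn : {near x, f =1 g}.
  exists e => //= y /=; rewrite distrC; exact: fg.
rewrite /prop_for /continuous_at -(fg x) ?subrr ?normr0//.
by move=> cf; exact: cvg_trans (near_eq_cvg fgn) cf.
Qed.

Lemma continuous_itv_int f a b : (forall x, a <= x <= b -> {for x, continuous f}) ->
  mu.-integrable `[a, b] (EFin \o f).
Proof.
move=> cf; apply: continuous_compact_integrable; first exact: segment_compact.
apply: continuous_in_subspaceT => x; rewrite inE /= in_itv /= => xab.
exact: cf.
Qed.

Lemma FTC2 f F a b : a <= b -> (forall x, a <= x <= b -> {for x, continuous f}) ->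
  (forall x, a <= x <= b -> der F x (f x)) -> \int[mu]_(x in `[a, b]) f x = F b - F a.
Proof.
rewrite le_eqVlt => /predU1P[<- _ _|ab cf dF].
  by rewrite set_itv1 Rintegral_set1 subrr.
rewrite /Rintegral (@continuous_FTC2 _ f F)//.
- apply: continuous_in_subspaceT => x; rewrite inE /= in_itv /= => xab.
  exact: cf.
- split.
  + move=> x; rewrite in_itv /= => /andP[ax xb]; apply: der_derivable (dF x _).
    by rewrite !ltW.
  + apply: cvg_at_right_filter; apply: (der_continuous (dF a _)).
    by rewrite lexx ltW.
  + apply: cvg_at_left_filter; apply: (der_continuous (dF b _)).
    by rewrite lexx ltW.
- move=> x; rewrite in_itv /= => /andP[ax xb]; apply: der_val (dF x _).
  by rewrite !ltW.
Qed.

Lemma continuousMfun f g x : {for x, continuous f} -> {for x, continuous g} ->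
  {for x, continuous (fun x => f x * g x)}.
Proof. by move=> cf cg; exact: cvgM. Qed.

Lemma continuousDfun f g x : {for x, continuous f} -> {for x, continuous g} ->
  {for x, continuous (fun x => f x + g x)}.
Proof. by move=> cf cg; exact: cvgD. Qed.

Lemma continuous_meas f : continuous f -> measurable_fun setT f.
Proof. exact: continuous_measurable_fun. Qed.

Lemma nondecreasing_der f g a b : a <= b ->
  (forall x, a <= x <= b -> der f x (g x)) -> (forall x, a <= x <= b -> 0 <= g x) ->
  f a <= f b.
Proof.
move=> ab dfg g0.
have inab x : x \in `]a, b[ -> a <= x <= b.
  by rewrite in_itv /= => /andP[ax xb]; rewrite !ltW.
apply: (@ger0_derive1_le_cc _ f a b) => //.
- by move=> x /inab xab; apply: der_derivable (dfg x xab).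
- by move=> x /inab xab; rewrite (der_val (dfg x xab)) g0.
- apply: continuous_in_subspaceT => x; rewrite inE /= in_itv /= => xab.
  exact: der_continuous (dfg x xab).
- by rewrite in_itv /= lexx.
- by rewrite in_itv /= lexx andbT.
Qed.

Lemma der0_cst f : (forall x, der f x 0) -> forall x y, f x = f y.
Proof.
move=> df; suff H x y : x <= y -> f x = f y.
  by move=> x y; have [/H|/ltW/H/esym] := leP x y.
move=> xy; apply/eqP; rewrite eq_le; apply/andP; split.
  exact: (nondecreasing_der xy (g := fun=> 0)).
rewrite -lerN2; apply: (nondecreasing_der (f := fun x => - f x) xy (g := fun=> 0)) => //.
by move=> z _; apply: (derE (derN (df z))); rewrite oppr0.
Qed.

End calculus.

(** * The exponential kernels and the regularity of their operators *)

Section exponential_kernel.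
Context {R : realType}.
Local Notation mu := (@lebesgue_measure R).
Implicit Types (f g F G : R -> R) (x a b L : R).

Lemma ge0_integral_oppr (f : R -> \bar R) : measurable_fun setT f ->
  (forall x, (0 <= f x)%E) -> (\int[mu]_x f (- x)%R = \int[mu]_x f x)%E.
Proof.
move=> mf f0.
transitivity (\int[pushforward mu (-%R : _ -> measurableTypeR R)]_x f x)%E.
  by rewrite ge0_integral_pushforward.
by apply: eq_measure_integral => A mA _; exact: lebesgue_measureN.
Qed.

Lemma measurable_oppr f : measurable_fun setT f -> measurable_fun setT (fun x => f (- x)).
Proof. by move=> mf; exact: (measurableT_comp mf). Qed.

Lemma Rintegral_oppr f : measurable_fun setT f -> \int[mu]_x f (- x) = \int[mu]_x f x.
Proof.
move=> /measurable_EFinP mf; congr fine; rewrite integralE [RHS]integralE.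
rewrite -(ge0_integral_oppr (measurable_funepos mf))// -(ge0_integral_oppr (measurable_funeneg mf))//.
by congr (_ - _)%E; apply: eq_integral => x _; rewrite !unlock.
Qed.

(** The fundamental solution of [L + d/dx], supported on [y <= x]. *)
Definition expk L x y : R := if y <= x then expR (- (L * (x - y))) else 0.

Lemma measurable_expk L : measurable_fun setT (fun p : R * R => expk L p.1 p.2).
Proof.
apply: measurable_fun_ifT => //.
  by apply: measurable_fun_ler => //; exact: measurableT_comp.
apply: measurableT_comp; first exact: measurable_expR.
by apply: measurableT_comp => //; apply: measurable_funM => //; apply: measurable_funB.
Qed.

Lemma expk01 L x y : 0 < L -> 0 <= expk L x y <= 1.
Proof.
move=> L0; rewrite /expk; case: ifPn => [yx|_]; last by rewrite lexx ler01.
by rewrite expR_ge0 /= -expR0 ler_expR oppr_le0 mulr_ge0 ?subr_ge0// ltW.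
Qed.

Lemma integral_expk L y : 0 < L -> (\int[mu]_x (expk L x y)%:E = (L^-1)%:E)%E.
Proof.
move=> L0.
have -> : (\int[mu]_x (expk L x y)%:E = \int[mu]_(x in `[y, +oo[) (expR (- (L * (x - y))))%:E)%E.
  rewrite [RHS]integral_mkcond; apply: eq_integral => x _.
  rewrite /expk patchE; case: ifPn => yx; first by rewrite mem_set//= in_itv /= yx.
  by rewrite memNset//= in_itv /= andbT; exact/negP.
have dF x : der (fun x => - (L^-1 * expR (- (L * (x - y))))) x (expR (- (L * (x - y)))).
  apply: (derE (derN (derZ L^-1 (der_exp (derN (derZ L (derB (der_id x) (der_cst y x)))))))).
  by rewrite subr0; field; rewrite gt_eqF.
rewrite (@ge0_continuous_FTC2y _ _ (fun x => - (L^-1 * expR (- (L * (x - y))))) y 0).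
- by rewrite subrr mulr0 oppr0 expR0 mulr1 EFinN oppeK add0e.
- by move=> x _; exact: expR_ge0.
- apply: continuous_subspaceT.
  apply: (der_continuousT (g := fun x => - L * expR (- (L * (x - y))))) => x.
  apply: (derE (der_exp (derN (derZ L (derB (der_id x) (der_cst y x)))))).
  by rewrite subr0; ring.
- rewrite -[X in _ --> X]oppr0 -[X in _ --> - X](mulr0 L^-1).
  apply: cvgN; apply: cvgMr.
  rewrite (_ : (fun x => _) = (fun x => expR (- x)) \o (fun x => L * (x - y)))//.
  apply: cvg_comp (@cvgr_expR R).
  apply/cvgryPge => A; exists (y + A / L); split; first exact: num_real.
  move=> x /ltW /= h; rewrite mulrC -ler_pdivrMr//; lra.
- by move=> x _; exact: der_derivable (dF x).
- by apply: cvg_at_right_filter; exact: der_continuous (dF y).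
- by move=> x _; exact: der_val (dF x).
Qed.

Lemma expk_oppr L x y : expk L (- x) (- y) = expk L y x.
Proof.
rewrite /expk lerN2; case: ifPn => // _; congr expR; ring.
Qed.

Lemma schur_expk L : 0 < L -> schur L^-1 (expk L).
Proof.
move=> L0; split.
- exact: measurable_expk.
- by move=> x y; exact: expk01.
(* By [expk_oppr], reflection turns this row integral into a column integral, which is already
   known. *)
- move=> x; have mk : measurable_fun setT (fun y => (expk L x y)%:E).
    apply/measurable_EFinP.
    exact: (measurableT_comp (measurable_expk L) (pair1_measurable x)).
  rewrite -(ge0_integral_oppr mk); last by move=> y; rewrite lee_fin; case/andP: (expk01 x y L0).
  rewrite -(integral_expk (- x) L0) le_eqVlt; apply/orP; left; apply/eqP.
  by apply: eq_integral => y _; rewrite -expk_oppr opprK.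
- by move=> y; rewrite integral_expk.
Qed.

(* [Rp L] inverts [L + d/dx] and its adjoint [Rm L] inverts [L - d/dx]. *)
Definition Rp L f := kernel_op (expk L) f.
Definition Rm L f := kernel_op (fun x y => expk L y x) f.

Lemma Rp_L2r L f : 0 < L -> L2r f -> L2r (Rp L f).
Proof.
move=> L0 Lf; have iL0 : 0 < L^-1 by rewrite invr_gt0.
exact: (kernel_op_L2r iL0 (schur_expk L0) Lf).1.
Qed.

Lemma Rm_L2r L f : 0 < L -> L2r f -> L2r (Rm L f).
Proof.
move=> L0 Lf; have iL0 : 0 < L^-1 by rewrite invr_gt0.
exact: (kernel_op_L2r iL0 (schur_sym (schur_expk L0)) Lf).1.
Qed.

Lemma Rp_nrm L f : 0 < L -> L2r f -> nrm (Rp L f) <= L^-1 * nrm f.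
Proof.
move=> L0 Lf; rewrite -ler_sqr ?nnegrE ?nrm_ge0//; last by rewrite mulr_ge0 ?nrm_ge0 ?invr_ge0// ltW.
rewrite exprMn !nrm_sqr.
have iL0 : 0 < L^-1 by rewrite invr_gt0.
exact: (kernel_op_L2r iL0 (schur_expk L0) Lf).2.
Qed.

Lemma Rm_nrm L f : 0 < L -> L2r f -> nrm (Rm L f) <= L^-1 * nrm f.
Proof.
move=> L0 Lf; rewrite -ler_sqr ?nnegrE ?nrm_ge0//; last by rewrite mulr_ge0 ?nrm_ge0 ?invr_ge0// ltW.
rewrite exprMn !nrm_sqr.
have iL0 : 0 < L^-1 by rewrite invr_gt0.
exact: (kernel_op_L2r iL0 (schur_sym (schur_expk L0)) Lf).2.
Qed.

Lemma Rp_adj L f g : 0 < L -> L2r f -> L2r g -> ip (Rp L f) g = ip f (Rm L g).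
Proof.
by move=> L0 Lf Lg; rewrite (kernel_op_adj _ (schur_expk L0) Lf Lg)// invr_gt0.
Qed.

(** Reflection conjugates the two operators, so the regularity of [Rm] follows from that of [Rp]. *)
Lemma Rm_reflect L f x : measurable_fun setT f -> Rm L f x = Rp L (fun y => f (- y)) (- x).
Proof.
move=> mf; rewrite /Rm /Rp /kernel_op -Rintegral_oppr; last first.
  apply: measurable_funM => //.
  exact: (measurableT_comp (measurable_expk L) (pair2_measurable x)).
by apply: eq_Rintegral => y _; rewrite -[in RHS](opprK y) expk_oppr opprK.
Qed.

Lemma L2r_oppr f : L2r f -> L2r (fun x => f (- x)).
Proof.
move=> [mf /integrableP[_ fi]]; split; first exact: measurable_oppr.
apply/integrableP; split.
  by apply/measurable_EFinP; apply: measurable_funX; exact: measurable_oppr.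
rewrite (ge0_integral_oppr (f := fun x => `|(EFin \o (fun x => f x ^+ 2)%R) x|%E))//.
by apply: measurableT_comp => //; apply/measurable_EFinP/measurable_funX.
Qed.

Lemma expk_mulE L f x :
  (fun y => expk L x y * f y) =
  (fun y => expR (- (L * x)) * ((fun y => expR (L * y) * f y) \_ `]-oo, x]) y).
Proof.
apply/funext => y; rewrite /expk patchE mem_setE in_itv /=; case: ifPn => yx.
  by rewrite mulrA -expRD; congr (expR _ * _); ring.
by rewrite mul0r mulr0.
Qed.

Lemma exp_int L f x : 0 < L -> L2r f ->
  mu.-integrable `]-oo, x] (EFin \o (fun y => expR (L * y) * f y)).
Proof.
move=> L0 Lf.
have h := kernel_mul_integrable x (schur_expk L0) Lf.
apply/(integrable_mkcond _ _) => //=.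
have := integrableZl measurableT (expR (L * x)) h.
apply: eq_integrable => // y _.
rewrite restrict_EFin /= -EFinM; congr EFin.
have := congr1 (fun h => h y) (expk_mulE L f x) => /= ->.
by rewrite mulrA -expRD subrr expR0 mul1r.
Qed.

(** Variation of constants: [x] enters only through a factor and the upper limit of the integral,
    the form to which the fundamental theorem of calculus applies. *)
Lemma Rp_formula L f x :
  0 < L -> L2r f ->
  Rp L f x = expR (- (L * x)) * \int[mu]_(y in `]-oo, x]) (expR (L * y) * f y).
Proof.
move=> L0 Lf; rewrite /Rp /kernel_op expk_mulE.
rewrite RintegralZl//; first by rewrite -Rintegral_mkcond.
have /(integrable_mkcond _ _).1 := exp_int x L0 Lf.
by rewrite -restrict_EFin; apply.
Qed.

Lemma Rp_continuous L f : 0 < L -> L2r f -> continuous (Rp L f).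
Proof.
move=> L0 Lf x.
have -> : Rp L f = (fun x => expR (- (L * x)) * \int[mu]_(y in `]-oo, x]) (expR (L * y) * f y)).
  by apply/funext => y; rewrite Rp_formula.
apply: cvgM.
  exact: der_continuous (der_exp (derN (derZ L (der_id x)))).
set g := fun y => expR (L * y) * f y.
have gi c d : mu.-integrable `[c, d] (EFin \o g).
  by apply: integrableS (exp_int d L0 Lf) => // y /=; rewrite !in_itv /= => /andP[].
have x1 : x - 1 < x + 1 by lra.
have := @parameterized_integral_continuous _ (x - 1) (x + 1) g (ltW x1) (gi _ _).
move=> /(continuous_within_itvP _ x1)[+ _ _] => /(_ x).
rewrite in_itv /= ltrBlDr ltrDl ltr01 => /(_ isT) cF.
have {}cF : {for x, continuous (fun y => \int[mu]_(t in `]-oo, x - 1]) g t +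
    parameterized_integral mu (x - 1) y g)}.
  by apply: continuousDfun => //; exact: cst_continuous.
apply: (near_eq_continuous ltr01 _ cF) => y; rewrite ltr_distl => /andP[y1 y2].
rewrite /parameterized_integral.
have := @Rintegral_itvB _ g -oo%O (BRight y) (x - 1).
rewrite Rintegral_itv_obnd_cbnd; last first.
  by apply: integrableS (gi (x - 1) y) => // z /=; rewrite !in_itv /= => /andP[/ltW -> ->].
move=> <- //; first by rewrite subrKC.
- exact: exp_int.
- by rewrite bnd_simp ltW.
Qed.

Lemma Rp_der L f x : 0 < L -> L2r f -> {for x, continuous f} ->
  der (Rp L f) x (f x - L * Rp L f x).
Proof.
move=> L0 Lf cf.
have RE y : Rp L f y = expR (- (L * y)) * \int[mu]_(y in `]-oo, y]) (expR (L * y) * f y).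
  by rewrite Rp_formula.
set g := fun y => expR (L * y) * f y in RE.
have cg : {for x, continuous g}.
  by apply: continuousMfun => //; exact: der_continuous (der_exp (derZ L (der_id x))).
have x1 : x < x + 1 by lra.
have [dF F'] := @continuous_FTC1 _ g -oo%O x (x + 1) x1 (exp_int _ L0 Lf) (ltNyr _) cg.
have := derP dF F'.
move=> /(derM (der_exp (derN (derZ L (der_id x))))) H.
apply: eq_der (derE H _) => [y|]; first by rewrite RE.
have eE : expR (- (L * x)) * expR (L * x) = 1 by rewrite -expRD addNr expR0.
transitivity ((expR (- (L * x)) * expR (L * x)) * f x - L * Rp L f x); last by rewrite eE mul1r.
by rewrite RE /g; ring.
Qed.

Lemma Rm_continuous L f : 0 < L -> L2r f -> continuous (Rm L f).
Proof.
move=> L0 Lf x; have mf := L2r_meas Lf.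
have -> : Rm L f = (fun x => Rp L (fun y => f (- y)) (- x)).
  by apply/funext => y; rewrite Rm_reflect.
apply: (@continuous_comp _ _ _ -%R); first exact: opp_continuous.
by apply: Rp_continuous => //; exact: L2r_oppr.
Qed.

Lemma Rm_der L f x : 0 < L -> L2r f -> {for x, continuous f} ->
  der (Rm L f) x (L * Rm L f x - f x).
Proof.
move=> L0 Lf cf; have mf := L2r_meas Lf.
have RE y : Rm L f y = Rp L (fun y => f (- y)) (- y) by rewrite Rm_reflect.
have cf' : {for - x, continuous (fun y => f (- y))}.
  apply: (@continuous_comp _ _ _ -%R f); first exact: opp_continuous.
  by rewrite opprK.
have := Rp_der L0 (L2r_oppr Lf) cf'.
move=> /der_comp /(_ (derN (der_id x))) H.
by apply: eq_der (derE H _) => [y|]; rewrite RE// opprK; ring.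
Qed.

End exponential_kernel.

(** * Test functions *)

Section smooth.
Context {R : realType}.
Local Notation mu := (@lebesgue_measure R).
Implicit Types (f g psi : R -> R) (x a b L : R).

(** Peels off the innermost derivative, unlike [derive1n], which suits inductions over sums and
    products. [Ck n] provides derivatives up to order [n.+1]. *)
Fixpoint Ck (n : nat) f : Prop :=
  (forall x, derivable f x 1) /\ (if n is m.+1 then Ck m (derive1 f) else True).

Lemma smoothP f : smooth f <-> forall n, Ck n f.
Proof.
split=> [sf n|Cf n].
  elim: n f sf => [|n IH] f sf; first by split=> // x; exact: (sf 0%N x).
  split; first by move=> x; exact: (sf 0%N x).
  by apply: IH => m x; have := sf m.+1 x; rewrite /derive1n iterSr.
have := Cf n; elim: n f {Cf} => [|n IH] f; first by case.
by case=> _ /IH H x; rewrite /derive1n iterSr; exact: H.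
Qed.

Lemma Ck_le n f : Ck n.+1 f -> Ck n f.
Proof.
elim: n f => [|n IH] f; first by case.
by move=> [df /IH ?]; split.
Qed.

Lemma CkD n f g : Ck n f -> Ck n g -> Ck n (fun x => f x + g x).
Proof.
elim: n f g => [|n IH] f g [df Cf] [dg Cg].
  split=> // x; exact: der_derivable (derD (derive1_der (df x)) (derive1_der (dg x))).
have H x := derD (derive1_der (df x)) (derive1_der (dg x)).
split=> [x|]; first exact: der_derivable (H x).
by rewrite (_ : derive1 _ = fun x => derive1 f x + derive1 g x); [exact: IH|apply/funext => x; exact: der_val].
Qed.

Lemma CkM n f g : Ck n f -> Ck n g -> Ck n (fun x => f x * g x).
Proof.
elim: n f g => [|n IH] f g Cf Cg.
  have [df _] := Cf; have [dg _] := Cg.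
  split=> // x; exact: der_derivable (derM (derive1_der (df x)) (derive1_der (dg x))).
have [df Cf'] := Cf; have [dg Cg'] := Cg.
have H x := derM (derive1_der (df x)) (derive1_der (dg x)).
split=> [x|]; first exact: der_derivable (H x).
rewrite (_ : derive1 _ = fun x => derive1 f x * g x + f x * derive1 g x); last first.
  by apply/funext => x; exact: der_val.
by apply: CkD; apply: IH => //; exact: Ck_le.
Qed.

Lemma smoothM f g : smooth f -> smooth g -> smooth (fun x => f x * g x).
Proof. by move=> /smoothP Cf /smoothP Cg; apply/smoothP => n; exact: CkM. Qed.

Lemma smooth_derivable f x : smooth f -> derivable f x 1.
Proof. by move=> /(_ 0%N x). Qed.

Lemma smooth_derive1 f : smooth f -> smooth (derive1 f).
Proof. by move=> sf n x; have := sf n.+1 x; rewrite /derive1n iterSr. Qed.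

Lemma smooth_cst (k : R) : smooth (fun=> k).
Proof.
apply/smoothP => n; elim: n k => [|n IH] k; split=> [x|//].
- exact: der_derivable (der_cst k x).
- exact: der_derivable (der_cst k x).
- by rewrite (_ : derive1 _ = fun=> (0:R)); [exact: IH|apply/funext => x; exact: der_val (der_cst k x)].
Qed.

Lemma smooth_id : smooth (fun x : R => x).
Proof.
apply/smoothP => -[|n]; split=> [x|//].
- exact: der_derivable (der_id x).
- exact: der_derivable (der_id x).
- rewrite (_ : derive1 _ = fun=> (1:R)); last by apply/funext => x; exact: der_val (der_id x).
  by have /smoothP := @smooth_cst (1:R); apply.
Qed.

Lemma smooth_affine_comp (p q : R) f : smooth f -> smooth (fun x => f (p * x + q)).
Proof.
have H (n : nat) h x : derivable h (p * x + q) 1 ->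
    der (fun x => h (p * x + q)) x (p * derive1 h (p * x + q)).
  move=> dh; have := @der_comp _ h (fun x => p * x + q) x _ _ (derive1_der dh) (derD (derZ p (der_id x)) (der_cst q x)).
  by move/derE; apply; ring.
move=> /smoothP Cf; apply/smoothP => n; have := Cf n.
elim: n f {Cf} => [|n IH] f [df Cf]; split=> [x|//].
- exact: der_derivable (H 0%N _ x (df _)).
- exact: der_derivable (H 0%N _ x (df _)).
- rewrite (_ : derive1 _ = fun x => p * derive1 f (p * x + q)); last first.
    by apply/funext => x; exact: der_val (H 0%N _ x (df _)).
  by apply: CkM; [have /smoothP := @smooth_cst p; exact|exact: IH].
Qed.

Lemma smooth_exp L : smooth (fun x => expR (L * x)).
Proof.
have H x : der (fun x => expR (L * x)) x (L * expR (L * x)).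
  by apply: (derE (der_exp (derZ L (der_id x)))); rewrite mulr1.
apply/smoothP; elim=> [|n IH]; split=> [x|//].
- exact: der_derivable (H x).
- exact: der_derivable (H x).
- rewrite (_ : derive1 _ = fun x => L * expR (L * x)); last by apply/funext => x; exact: der_val (H x).
  by apply: CkM => //; have /smoothP := @smooth_cst L; exact.
Qed.

Lemma der_pow (n : nat) x : der (fun x => x ^+ n) x (n%:R * x ^+ n.-1).
Proof.
elim: n => [|n IH].
  by apply: (eq_der (f := fun=> 1)) (derE (der_cst 1 x) _) => [y|]; rewrite ?expr0 ?mul0r.
apply: (eq_der (f := fun x => x * x ^+ n)) => [y|]; first by rewrite exprS.
apply: (derE (derM (der_id x) IH)) => /=.
by case: n {IH} => [|n]; rewrite -?natr1 ?exprS /=; ring.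
Qed.

(** The span of the functions [x^-k e^(-1/x)], extended by [0], is stable under differentiation, so
    a single induction makes all of them smooth. *)
Definition ebump (k : nat) (x : R) : R := if 0 < x then x ^- k * expR (- x^-1) else 0.

Lemma ebump_ge0 k x : 0 <= ebump k x.
Proof.
by rewrite /ebump; case: ifPn => // x0; rewrite mulr_ge0 ?expR_ge0// invr_ge0 exprn_ge0// ltW.
Qed.

(** The inequality [y^n <= n! e^y] at [y = 1 / x]. The power [j = 2] gives the derivative at [0],
    and [j = 0] gives boundedness. *)
Lemma ebump_le k j x : 0 <= x -> ebump k x <= (k + j)`!%:R * x ^+ j.
Proof.
move=> x0; rewrite /ebump; case: ifPn => [{}x0|_]; last by rewrite mulr_ge0// exprn_ge0.
have y0 : 0 <= x^-1 by rewrite invr_ge0 ltW.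
have h : x^-1 ^+ (k + j) <= (k + j)`!%:R * expR x^-1.
  case: (k + j)%N => [|n].
    by rewrite expr0 fact0 mul1r -expR0 ler_expR.
  have := expR_ge1Dxn n y0.
  have f0 : (0 : R) < n.+1`!%:R by rewrite ltr0n fact_gt0.
  by rewrite -ler_pdivrMl// (mulrC _^-1); lra.
have -> : x ^- k * expR (- x^-1) = x^-1 ^+ (k + j) * x ^+ j / expR x^-1.
  have xj : x^-1 ^+ j * x ^+ j = 1 by rewrite -exprMn mulVf ?expr1n ?gt_eqF.
  by rewrite expRN exprD -(exprVn x k) -(mulrA _ _ (x ^+ j)) xj mulr1.
rewrite ler_pdivrMr ?expR_gt0// [leRHS]mulrAC.
by apply: ler_wpM2r => //; rewrite exprn_ge0// ltW.
Qed.

Lemma der_ebump k x : der (ebump k) x (ebump k.+2 x - k%:R * ebump k.+1 x).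
Proof.
have [x0|x0|->] := ltgtP x 0.
- have -> : ebump k.+2 x - k%:R * ebump k.+1 x = 0.
    by rewrite /ebump ltNge ltW//= mulr0 subrr.
  have xp : 0 < - x by rewrite oppr_gt0.
  apply: (near_eq_der (f := fun=> 0) xp); last exact: der_cst.
  move=> y; rewrite ltr_distl => /andP[_]; rewrite subrr => y0.
  by rewrite /ebump ltNge ltW.
- have H : der (fun x => x ^- k * expR (- x^-1)) x (ebump k.+2 x - k%:R * ebump k.+1 x).
    have xn : x != 0 by rewrite gt_eqF.
    have dk := der_pow k x.
    have xkn : x ^+ k != 0 by rewrite expf_neq0.
    apply: (derE (derM (derV (f := fun x => x ^+ k) xkn dk) (der_exp (derN (derV (f := fun x => x) xn (der_id x)))))).
    rewrite /ebump x0; case: k {dk xkn} => [|k]; rewrite /= ?expr0 ?expr1 ?mul0r.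
      by field.
    by rewrite !exprS; field; rewrite xn expf_neq0.
  apply: (near_eq_der x0 _ H) => y; rewrite ltr_distl subrr => /andP[y0 _].
  by rewrite /ebump y0.
- have -> : ebump k.+2 0 - k%:R * ebump k.+1 0 = 0.
    by rewrite /ebump ltxx mulr0 subrr.
  have cv : (h^-1 *: (ebump k (h *: 1 + 0) - ebump k 0) @[h --> (0:R)^']) --> (0 : R).
    pose C : R := (k + 2)`!%:R.
    have C0 : 0 < C by rewrite ltr0n fact_gt0.
    apply/cvgr0Pnorm_le => e e0; have eC : 0 < e / C by rewrite divr_gt0.
    near=> h.
    rewrite addr0 {2}/ebump ltxx subr0 /GRing.scale /= mulr1 normrM normfV.
    have hn : h != 0 by near: h; exact: nbhs_dnbhs_neq.
    rewrite mulrC ler_pdivrMr ?normr_gt0// (ger0_norm (ebump_ge0 _ _)).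
    have [h0|h0] := leP 0 h; last first.
      by rewrite /ebump ltNge (ltW h0)/= mulr_ge0 ?normr_ge0// ltW.
    apply: (le_trans (ebump_le k 2 h0)); rewrite ger0_norm// expr2 mulrA ler_wpM2r//.
    rewrite -/C mulrC -ler_pdivlMr//.
    have : `|h| <= e / C by near: h; exact: dnbhs0_le eC.
    by rewrite ger0_norm.
  have dv : derivable (ebump k) 0 1 by apply/cvg_ex; exists 0.
  apply: derP => //; rewrite derive1E; exact: cvg_lim cv.
Unshelve. all: by end_near. Qed.

Lemma smooth_ebump k : smooth (ebump k).
Proof.
apply/smoothP => n; elim: n k => [|n IH] k; split=> [x|//].
- exact: der_derivable (der_ebump k x).
- exact: der_derivable (der_ebump k x).
- rewrite (_ : derive1 _ = fun x => ebump k.+2 x + (- k%:R) * ebump k.+1 x); last first.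
    by apply/funext => x; rewrite (der_val (der_ebump k x)) mulNr.
  apply: CkD => //; apply: CkM => //.
  by have /smoothP := @smooth_cst (- k%:R); exact.
Qed.

End smooth.

(** * Test functions and the weak equation D' = - L D in L^2 *)

Section weak_derivative.
Context {R : realType}.
Local Notation mu := (@lebesgue_measure R).
Implicit Types (f g psi : R -> R) (x a b L : R).

Lemma compact_support_L2r M f : continuous f -> (forall x, M < `|x| -> f x = 0) -> L2r f.
Proof.
move=> cf f0; split; first exact: continuous_meas.
have h : mu.-integrable `[- M, M] (EFin \o (fun x => f x ^+ 2)).
  apply: continuous_itv_int => x _.
  rewrite (_ : (fun x => _) = (fun x => f x * f x)); last by apply/funext => y; rewrite expr2.
  by apply: continuousMfun; exact: cf.
have /(integrable_mkcond _ _).1 := h => /(_ (measurable_itv _)).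
apply: eq_integrable => // x _; rewrite restrict_EFin /= patchE mem_setE in_itv /= -ler_norml.
by case: ifPn => //; rewrite -ltNge => /f0 ->; rewrite expr0n.
Qed.

Lemma test_derive1 psi : test_function psi -> test_function (derive1 psi).
Proof.
move=> [spsi [M psi0]]; split; first exact: smooth_derive1.
exists M => x Mx; apply: der_val.
apply: (@near_eq_der _ (fun=> 0) _ _ _ (`|x| - M)); last exact: der_cst.
  by rewrite subr_gt0.
move=> y yx; rewrite psi0//.
have := ler_normB y (y - x); rewrite opprB addrC subrK => h; lra.
Qed.

Lemma test_continuous psi : test_function psi -> continuous psi.
Proof.
by move=> [spsi _]; apply: (der_continuousT (g := derive1 psi)) => x; apply: derive1_der; exact: smooth_derivable.
Qed.

Lemma test_L2r psi : test_function psi -> L2r psi.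
Proof.
move=> tpsi; have [_ [M psi0]] := tpsi.
exact: compact_support_L2r (test_continuous tpsi) psi0.
Qed.

Lemma test_der psi x : test_function psi -> der psi x (derive1 psi x).
Proof. by move=> [spsi _]; apply: derive1_der; exact: smooth_derivable. Qed.

Lemma test_oppr psi : test_function psi -> test_function (fun x => psi (- x)).
Proof.
move=> [spsi [M psi0]]; split.
  have := @smooth_affine_comp _ (-1) 0 _ spsi.
  by congr smooth; apply/funext => x; rewrite mulN1r addr0.
by exists M => x Mx; rewrite psi0// normrN.
Qed.

Lemma bump0_le1 x : ebump 0 x <= 1.
Proof.
have [x0|x0] := leP 0 x; first by have := ebump_le 0 0 x0; rewrite fact0 expr0 mulr1.
by rewrite /ebump ltNge (ltW x0).
Qed.

Lemma bump2_le2 x : ebump 2 x <= 2.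
Proof.
have [x0|x0] := leP 0 x; first by have := ebump_le 2 0 x0; rewrite expr0 mulr1.
by rewrite /ebump ltNge (ltW x0).
Qed.

(** The derivative of the cutoff [ebump 0 (n (X - y))] carries a factor [n]; after multiplication by
    [X - y] it becomes a value of [ebump 1], bounded uniformly in [n]. *)
Lemma mul_bump2 x : x * ebump 2 x = ebump 1 x.
Proof.
rewrite /ebump; case: ifPn => x0; last by rewrite mulr0.
by rewrite mulrA; congr (_ * _); rewrite exprS expr1; field; rewrite gt_eqF.
Qed.

Lemma ebump_le_inv k x : 0 < x -> ebump k.+1 x <= x^-1 ^+ k.+1.
Proof.
move=> x0; rewrite /ebump x0 exprVn ler_piMr//.
  by rewrite invr_ge0 exprn_ge0// ltW.
by rewrite -expR0 ler_expR oppr_le0 invr_ge0 ltW.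
Qed.

Lemma cvg_bumpS k (u : nat -> R) : u n @[n --> \oo] --> +oo -> ebump k.+1 (u n) @[n --> \oo] --> (0 : R).
Proof.
move=> uoo; apply: (@squeeze_cvgr _ _ _ _ (fun=> 0) (fun n => (u n)^-1 ^+ k.+1)).
- near=> n; rewrite ebump_ge0 /= ebump_le_inv//.
  by near: n; move/cvgryPgt: uoo; apply.
- exact: cvg_cst.
- rewrite -[X in _ --> X](expr0n _ k.+1); apply: (cvg_comp (fun n => (u n)^-1) (fun x => x ^+ k.+1)); last exact: exprn_continuous.
  by apply/gtr0_cvgV0 => //; move/cvgryPgt: uoo; apply.
Unshelve. all: by end_near. Qed.

Lemma cvg_bump0 (u : nat -> R) : u n @[n --> \oo] --> +oo -> ebump 0 (u n) @[n --> \oo] --> (1 : R).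
Proof.
move=> uoo.
have c1 : expR (- (u n)^-1) @[n --> \oo] --> (1 : R).
  rewrite -(@expR0 R); apply: (cvg_comp (fun n => - (u n)^-1) expR); last exact: continuous_expR.
  rewrite -oppr0; apply: cvgN.
  by apply/gtr0_cvgV0 => //; move/cvgryPgt: uoo; apply.
apply: cvg_trans c1; apply: near_eq_cvg; near=> n.
rewrite /ebump ifT ?expr0 ?invr1 ?mul1r//.
by near: n; move/cvgryPgt: uoo; apply.
Unshelve. all: by end_near. Qed.

(** The hypothesis says that [D' = - L D] weakly, so [D] is a multiple of [e^(- L x)], which is not
    square integrable near minus infinity. Uniqueness of weak derivatives and the inversion formulas
    below all rest on this. *)
Lemma weak_exp_eq0 L (D : R -> R) : 0 < L -> L2r D ->
  (forall psi, test_function psi -> ip D (derive1 psi) = L * ip D psi) ->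
  D = (fun=> 0) %[ae mu].
Proof.
move=> L0 LD H; have mD := L2r_meas LD.
pose g y := expR (L * y) * D y.
(* Lebesgue differentiation of these integrals in [X] gives [g x = 0] for almost every [x]. *)
suff F0 X : \int[mu]_(y in `]-oo, X]) g y = 0.
  have locg : locally_integrable setT g.
    split.
    - by apply: measurable_funM => //; apply: measurableT_comp => //; exact: measurable_funM.
    - exact: openT.
    - move=> K _ cK.
      have [N [_ HN]] := compact_bounded cK.
      have KN : K `<=` `]-oo, N + 1].
        move=> y Ky /=; rewrite in_itv /=.
        have := HN (N + 1); rewrite ltrDl ltr01 => /(_ isT y Ky) /=.
        by apply: le_trans; exact: ler_norm.
      have mK := compact_measurable cK.
      suff /integrableP[] : mu.-integrable K (EFin \o g) by [].
      by apply: integrableS (exp_int (N + 1) L0 LD).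
  have := FTC1Ny (fun y => exp_int y L0 LD) locg.
  apply: ae_mono => x [_ +] _.
  rewrite (_ : (fun x => _) = fun=> 0); last by apply/funext => y; exact: F0.
  rewrite (der_val (der_cst 0 x)) => /esym/eqP.
  by rewrite mulf_eq0 gt_eqF ?expR_gt0//= => /eqP.
(* [P n] approximates [e^(L y) (X - y)] on [y < X], whose image under [d/dy - L] is [- e^(L y)]. The
   cutoffs make it smooth at [X] and zero below [- n.+1]. *)
pose P (n : nat) y := expR (L * y) * (X - y) * ebump 0 (n.+1%:R * (X - y)) * ebump 0 (n.+1%:R + y).
pose h (n : nat) y := expR (L * y) * (- (ebump 0 (n.+1%:R * (X - y)) * ebump 0 (n.+1%:R + y))
  - ebump 1 (n.+1%:R * (X - y)) * ebump 0 (n.+1%:R + y)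
  + (X - y) * ebump 0 (n.+1%:R * (X - y)) * ebump 2 (n.+1%:R + y)).
have dP n y : der (P n) y (L * P n y + h n y).
  have d1 := der_exp (derZ L (der_id y)).
  have d2 := derB (der_cst X y) (der_id y).
  have d3 := der_comp (f := ebump 0) (g := fun y => n.+1%:R * (X - y)) (der_ebump 0 (n.+1%:R * (X - y))) (derZ n.+1%:R d2).
  have d4 := der_comp (f := ebump 0) (g := fun y => n.+1%:R + y) (der_ebump 0 (n.+1%:R + y)) (derD (der_cst n.+1%:R y) (der_id y)).
  apply: (derE (derM (derM (derM d1 d2) d3) d4)).
  by rewrite /P /h -mul_bump2; ring.
have P0 n y : Num.max `|X| n.+1%:R < `|y| -> P n y = 0.
  rewrite gt_max => /andP[Xy ny].
  have [y0|y0] := leP 0 y.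
    have : ebump 0 (n.+1%:R * (X - y)) = 0.
      rewrite /ebump ltNge pmulr_rle0 ?ltr0n//.
      have := ler_norm X; move: Xy; rewrite (ger0_norm y0) => h1 h2.
      by rewrite (_ : X - y <= 0)//; lra.
    by rewrite /P => ->; rewrite mulr0 mul0r.
  have : ebump 0 (n.+1%:R + y) = 0.
    by rewrite /ebump ltNge; move: ny; rewrite ltr0_norm// => hn; rewrite (_ : n.+1%:R + y <= 0)//; lra.
  by rewrite /P => ->; rewrite mulr0.
have tP n : test_function (P n).
  split; last by exists (Num.max `|X| n.+1%:R); exact: P0.
  apply: smoothM; last first.
    have := @smooth_affine_comp _ 1 n.+1%:R _ (@smooth_ebump R 0).
    by congr smooth; apply/funext => y; rewrite mul1r addrC.
  apply: smoothM; last first.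
    have := @smooth_affine_comp _ (- n.+1%:R) (n.+1%:R * X) _ (@smooth_ebump R 0).
    by congr smooth; apply/funext => y; congr ebump; ring.
  apply: smoothM; first exact: smooth_exp.
  have := @smooth_affine_comp _ (-1) X _ (@smooth_id R).
  by congr smooth; apply/funext => y; ring.
have hE n : h n = (fun y => derive1 (P n) y - L * P n y).
  by apply/funext => y; rewrite (der_val (dP n y)); ring.
have Lh n : L2r (h n).
  rewrite hE; apply: L2rB; first by apply: test_L2r; exact: test_derive1.
  by apply: L2rZ; exact: test_L2r.
have h0 n : ip D (h n) = 0.
  have LdP : L2r (derive1 (P n)) by apply: test_L2r; exact: test_derive1.
  have LP := test_L2r (tP n).
  by rewrite hE ipBr ?ipZr ?H ?subrr//; exact: L2rZ.
(* Constant of the domination: half of the exponential absorbs the linear factor [X - y], and the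
   other half stays integrable against [|D|]. *)
pose C := expR (L / 2 * X) * (2 + 4 / L).
have hle n y : `|h n y * D y| <= C * (expR (L / 2 * y) * `|D y|) * (y <= X)%R%:R.
  have [yX|Xy] := leP y X; last first.
    have -> : h n y = 0.
      have b0 k : ebump k (n.+1%:R * (X - y)) = 0.
        by rewrite /ebump ltNge pmulr_rle0 ?ltr0n// (_ : X - y <= 0)//; lra.
      by rewrite /h !b0; ring.
    by rewrite mul0r normr0 mulr0.
  rewrite mulr1 normrM mulrA ler_wpM2r// /h normrM ger0_norm ?expR_ge0//.
  have b1 : ebump 1 (n.+1%:R * (X - y)) <= 1.
    have [t0|t0] := leP 0 (n.+1%:R * (X - y)); first by have := ebump_le 1 0 t0; rewrite expr0 mulr1.
    by rewrite /ebump ltNge (ltW t0).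
  set p0 := ebump 0 (n.+1%:R * (X - y)); set p1 := ebump 1 _ in b1 *.
  set q0 := ebump 0 _; set q2 := ebump 2 _.
  have p00 : 0 <= p0 <= 1 by rewrite ebump_ge0 bump0_le1.
  have q00 : 0 <= q0 <= 1 by rewrite ebump_ge0 bump0_le1.
  have q20 : 0 <= q2 <= 2 by rewrite ebump_ge0 bump2_le2.
  have p10 : 0 <= p1 by exact: ebump_ge0.
  have Xy0 : 0 <= X - y by rewrite subr_ge0.
  have B : `|- (p0 * q0) - p1 * q0 + (X - y) * p0 * q2| <= 2 + 2 * (X - y).
    have h1 : 0 <= p0 * q0 <= 1 by nra.
    have h2 : 0 <= p1 * q0 <= 1 by nra.
    have h3 : 0 <= p0 * q2 <= 2 by nra.
    have h4 : 0 <= (X - y) * (p0 * q2) <= 2 * (X - y) by nra.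
    by rewrite ler_norml -mulrA; apply/andP; split; lra.
  apply: (le_trans (ler_wpM2l (expR_ge0 _) B)).
  have e1 : expR (L * y) <= expR (L / 2 * X) * expR (L / 2 * y).
    by rewrite -expRD ler_expR; nra.
  have e2 : expR (L * y) * (X - y) <= 2 / L * (expR (L / 2 * X) * expR (L / 2 * y)).
    have := expR_ge1Dx (L / 2 * (X - y)).
    move=> e; have {}e : X - y <= 2 / L * expR (L / 2 * (X - y)).
      rewrite -ler_pdivrMl ?divr_gt0//.
      rewrite (_ : (2 / L)^-1 = L / 2); first lra.
      by field; rewrite gt_eqF.
    apply: (le_trans (ler_wpM2l (expR_ge0 _) e)).
    rewrite mulrCA ler_wpM2l ?divr_ge0// ?(ltW L0)// -!expRD ler_expR.
    by rewrite le_eqVlt; apply/orP; left; apply/eqP; field.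
  rewrite /C (_ : _ * (2 + 4 / L) * _ = 2 * (expR (L / 2 * X) * expR (L / 2 * y)) + 2 * (2 / L * (expR (L / 2 * X) * expR (L / 2 * y)))); last first.
    by field; rewrite gt_eqF.
  by rewrite mulrDr mulrCA [_ * 2]mulrC mulrCA; lra.
have gI : mu.-integrable setT (EFin \o (fun y => C * (expR (L / 2 * y) * `|D y|) * (y <= X)%R%:R)).
  have L20 : 0 < L / 2 by rewrite divr_gt0.
  have /(integrable_mkcond _ _).1 := exp_int X L20 (L2r_norm LD) => /(_ (measurable_itv _)).
  move/(integrableZl measurableT C); apply: eq_integrable => // y _.
  rewrite restrict_EFin /= -EFinM patchE mem_setE in_itv /=.
  by case: ifPn => _; rewrite ?mulr1 ?mulr0.
have cvh y : h n y * D y @[n --> \oo] --> - (expR (L * y) * D y * (y < X)%R%:R).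
  have nyoo (z : R) : (fun n : nat => n.+1%:R + z : R) @ \oo --> +oo.
    apply/cvgryPge => A; near=> n.
    have : A - z <= n%:R by near: n; exact: nbhs_infty_ger.
    rewrite -natr1; lra.
  have [yX|Xy] := ltP y X; last first.
    rewrite mulr0 oppr0 (_ : (fun n => _) = fun=> 0); first exact: cvg_cst.
    apply/funext => n; have b0 k : ebump k (n.+1%:R * (X - y)) = 0.
      by rewrite /ebump ltNge pmulr_rle0 ?ltr0n// (_ : X - y <= 0)//; lra.
    by rewrite /h !b0; ring.
  have Xy0 : 0 < X - y by rewrite subr_gt0.
  have noo : (fun n : nat => n.+1%:R * (X - y) : R) @ \oo --> +oo.
    apply/cvgryPge => A; near=> n.
    rewrite -ler_pdivrMr//.
    have : A / (X - y) <= n%:R by near: n; exact: nbhs_infty_ger.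
    rewrite -natr1; lra.
  have -> : - (expR (L * y) * D y * true%:R) =
      expR (L * y) * (- (1 * 1) - 0 * 1 + (X - y) * 1 * 0) * D y.
    by rewrite (_ : true%:R = 1 :> R)//; ring.
  apply: cvgMl; apply: cvgMr; apply: cvgD; [apply: cvgB|].
  - by apply: cvgN; apply: cvgM; exact: cvg_bump0.
  - by apply: cvgM; [exact: cvg_bumpS|exact: cvg_bump0].
  - by apply: cvgM; [apply: cvgMr; exact: cvg_bump0|exact: cvg_bumpS].
have mlim : measurable_fun setT (EFin \o (fun y => - (expR (L * y) * D y * (y < X)%R%:R))).
  apply/measurable_EFinP; apply: measurableT_comp => //.
  rewrite (_ : (fun y => _) = g \_ `]-oo, X[); last first.
    apply/funext => y; rewrite patchE mem_setE in_itv /=.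
    by case: ifPn => _; rewrite ?mulr1 ?mulr0.
  apply/measurable_restrict => //; apply: measurable_funTS.
  by apply: measurable_funM => //; apply: measurableT_comp => //; exact: measurable_funM.
have cvE y : (h n y * D y)%:E @[n --> \oo] --> (- (expR (L * y) * D y * (y < X)%R%:R))%:E.
  by apply/fine_cvgP; split; [exact: nearW|exact: cvh].
have leE n y : (`|(h n y * D y)%:E| <= (C * (expR (L / 2 * y) * `|D y|) * (y <= X)%R%:R)%:E)%E.
  by rewrite lee_fin; exact: hle.
have mg : measurable_fun setT g.
  by apply: measurable_funM => //; apply: measurableT_comp => //; exact: measurable_funM.
pose F n := EFin \o (fun y => h n y * D y).
pose f := EFin \o (fun y => - (expR (L * y) * D y * (y < X)%R%:R)).
have A1 n : measurable_fun setT (F n) by exact: (measurable_int _ (L2r_mul_int (Lh n) LD)).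
have A3 : {ae mu, forall y, setT y -> F ^~ y @ \oo --> f y}.
  by apply: aeW => y _; exact: cvE.
have A5 : {ae mu, forall y n, setT y -> (`|F n y| <= (C * (expR (L / 2 * y) * `|D y|) * (y <= X)%R%:R)%:E)%E}.
  by apply: aeW => y n _; exact: leE.
have [fI _ cvI] := @dominated_convergence _ _ _ mu setT measurableT F f _ A1 mlim A3 gI A5.
have I0 : (\int[mu]_y f y = 0)%E.
  rewrite -(cvg_lim _ cvI)//; apply: cvg_lim => //.
  rewrite (_ : (fun n => _) = fun=> 0%E); first exact: cvg_cst.
  apply/funext => n /=; rewrite -[LHS]fineK; last exact: (integrable_fin_num measurableT (L2r_mul_int (Lh n) LD)).
  by congr EFin; rewrite -(h0 n) ipC.
rewrite -Rintegral_itv_bndo_bndc; last first.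
  by apply: integrableS (exp_int X L0 LD) => // y /=; rewrite !in_itv /= => /ltW.
apply/eqP; rewrite Rintegral_mkcond -oppr_eq0 -mulN1r -RintegralZl//; last first.
  have /(integrable_mkcond _ _).1 := exp_int X L0 LD => /(_ (measurable_itv _)).
  apply: le_integrable => //.
  - apply/measurable_EFinP/measurable_restrict => //; apply: measurable_funTS.
    by apply: measurable_funM => //; apply: measurableT_comp => //; exact: measurable_funM.
  - move=> y _; rewrite /= !patchE !mem_setE !in_itv /=.
    by case: ltgtP => //=; rewrite ?normr0 ?lee_fin ?normr_ge0.
rewrite /Rintegral (_ : integral _ _ _ = 0%E)// -[RHS]I0.
apply: eq_integral => y _; rewrite /f /= mulN1r patchE mem_setE in_itv /=.
by case: ifPn => _; rewrite ?mulr1 ?mulr0.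
Unshelve. all: by end_near. Qed.

End weak_derivative.

(** * Weak derivatives and the resolvents of d^2/dx^2 *)

Section wd.
Context {R : realType}.
Local Notation mu := (@lebesgue_measure R).
Implicit Types (f g h psi v w : R -> R) (x a b L : R).

Definition wd f g : Prop :=
  forall psi, test_function psi -> ip f (derive1 psi) = - ip g psi.

Lemma test_support psi : test_function psi ->
  exists2 N : R, 0 < N & forall x, N <= `|x| -> psi x = 0 /\ derive1 psi x = 0.
Proof.
move=> tpsi; have [_ [M psi0]] := tpsi; have [_ [M' psi'0]] := test_derive1 tpsi.
exists (`|M| + `|M'| + 1); first by rewrite ltr_wpDl ?addr_ge0.
move=> x xN; have h1 := ler_norm M; have h2 := ler_norm M'.
have n1 := normr_ge0 M; have n2 := normr_ge0 M'.
by split; [apply: psi0|apply: psi'0]; lra.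
Qed.

Lemma classical_wd f g : (forall x, der f x (g x)) -> continuous g -> L2r f -> L2r g -> wd f g.
Proof.
move=> dfg cg Lf Lg psi tpsi.
have [N N0 psi0] := test_support tpsi.
have Lp := test_L2r tpsi; have Lp' := test_L2r (test_derive1 tpsi).
apply/eqP; rewrite -addr_eq0 /ip -RintegralD//; [|exact: L2r_mul_int..].
have cf := der_continuousT dfg.
have := @FTC2 _ (fun x => f x * derive1 psi x + g x * psi x) (fun x => f x * psi x) (- N) N.
rewrite (psi0 N _).1; last by rewrite ger0_norm// ltW.
rewrite (psi0 (- N) _).1; last by rewrite normrN ger0_norm// ltW.
rewrite !mulr0 subrr => H; apply/eqP; rewrite -[RHS]H.
- rewrite [RHS]Rintegral_mkcond; apply: eq_Rintegral => x _.
  rewrite patchE mem_setE in_itv /= -ler_norml; case: ifPn => //.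
  by rewrite -ltNge => /ltW /psi0[-> ->]; rewrite !mulr0 addr0.
- lra.
- move=> x _; apply: continuousDfun; apply: continuousMfun.
  + exact: cf.
  + exact: test_continuous (test_derive1 tpsi) x.
  + exact: cg.
  + exact: test_continuous tpsi x.
- move=> x _; apply: (derE (derM (dfg x) (test_der x tpsi))); ring.
Qed.

(** The difference [u] of the two sides satisfies [u' = L u], so [e^(- L x) u] is constant; it
    vanishes at the right end of the support, because [Rm] only looks to the right. *)
Lemma Rm_test L psi x : 0 < L -> test_function psi ->
  Rm L (derive1 psi) x = L * Rm L psi x - psi x.
Proof.
move=> L0 tpsi; have [N N0 psi0] := test_support tpsi.
have Lp := test_L2r tpsi; have Lp' := test_L2r (test_derive1 tpsi).
pose u x := Rm L (derive1 psi) x - (L * Rm L psi x - psi x).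
have du y : der u y (L * u y).
  apply: (derE (derB (Rm_der L0 Lp' _) (derB (derZ L (Rm_der L0 Lp _)) (test_der y tpsi)))).
  - exact: test_continuous (test_derive1 tpsi) y.
  - exact: test_continuous tpsi y.
  - by rewrite /u; ring.
have dk y : der (fun y => expR (- L * y) * u y) y 0.
  apply: (derE (derM (der_exp (derZ (- L) (der_id y))) (du y))); ring.
have RN f : (forall y, N <= `|y| -> f y = 0) -> Rm L f N = 0.
  move=> f0; rewrite /Rm /kernel_op (@eq_Rintegral _ _ _ _ _ (fun=> 0)) => [|y _].
    by rewrite Rintegral_cst// mul0r.
  rewrite /expk; case: ifPn => [Ny|]; last by rewrite mul0r.
  by rewrite f0 ?mulr0// (le_trans Ny)// ler_norm.
have uN : u N = 0.
  have NN : N <= `|N| by exact: ler_norm.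
  rewrite /u !RN ?(psi0 N NN).1 ?subr0 ?mulr0 ?subr0//.
  - by move=> y /psi0[].
  - by move=> y /psi0[].
have : expR (- L * x) * u x = 0 by rewrite (der0_cst dk x N) uN mulr0.
by move/eqP; rewrite mulf_eq0 gt_eqF ?expR_gt0//= subr_eq0 => /eqP.
Qed.

Lemma eq_kernel_op K f g : measurable_fun setT f -> measurable_fun setT g ->
  (forall x, measurable_fun setT (K x)) -> f = g %[ae mu] -> kernel_op K f =1 kernel_op K g.
Proof.
move=> mf mg mK fg x; apply: (ae_ip (f := K x) (f' := K x)) => //.
exact: eq_ae.
Qed.

Lemma measurable_expkr L x : measurable_fun setT (expk L x).
Proof. exact: (measurableT_comp (measurable_expk L) (pair1_measurable x)). Qed.

Lemma measurable_expkl L x : measurable_fun setT ((expk L)^~ x).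
Proof. exact: (measurableT_comp (measurable_expk L) (pair2_measurable x)). Qed.

Lemma eq_Rp L f g : measurable_fun setT f -> measurable_fun setT g ->
  f = g %[ae mu] -> Rp L f =1 Rp L g.
Proof. by move=> mf mg; apply: eq_kernel_op => // x; exact: measurable_expkr. Qed.

Lemma eq_Rm L f g : measurable_fun setT f -> measurable_fun setT g ->
  f = g %[ae mu] -> Rm L f =1 Rm L g.
Proof. by move=> mf mg; apply: eq_kernel_op => // x; exact: measurable_expkl. Qed.

Lemma kernel_opD K M f g x : schur M K -> L2r f -> L2r g ->
  kernel_op K (fun y => f y + g y) x = kernel_op K f x + kernel_op K g x.
Proof.
move=> KS Lf Lg; rewrite /kernel_op -RintegralD//.
- by apply: eq_Rintegral => y _; rewrite mulrDr.
- exact: kernel_mul_integrable KS Lf.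
- exact: kernel_mul_integrable KS Lg.
Qed.

Lemma kernel_opZ K M k f x : schur M K -> L2r f ->
  kernel_op K (fun y => k * f y) x = k * kernel_op K f x.
Proof.
move=> KS Lf; rewrite /kernel_op -RintegralZl//.
- by apply: eq_Rintegral => y _; rewrite mulrCA.
- exact: kernel_mul_integrable KS Lf.
Qed.

Lemma RpD L f g : 0 < L -> L2r f -> L2r g ->
  Rp L (fun y => f y + g y) = (fun x => Rp L f x + Rp L g x).
Proof.
by move=> L0 Lf Lg; apply/funext => x; exact: (kernel_opD x (schur_expk L0) Lf Lg).
Qed.

Lemma RmD L f g : 0 < L -> L2r f -> L2r g ->
  Rm L (fun y => f y + g y) = (fun x => Rm L f x + Rm L g x).
Proof.
by move=> L0 Lf Lg; apply/funext => x; exact: (kernel_opD x (schur_sym (schur_expk L0)) Lf Lg).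
Qed.

Lemma RpZ L k f : 0 < L -> L2r f -> Rp L (fun y => k * f y) = (fun x => k * Rp L f x).
Proof.
by move=> L0 Lf; apply/funext => x; exact: (kernel_opZ k x (schur_expk L0) Lf).
Qed.

Lemma RmZ L k f : 0 < L -> L2r f -> Rm L (fun y => k * f y) = (fun x => k * Rm L f x).
Proof.
by move=> L0 Lf; apply/funext => x; exact: (kernel_opZ k x (schur_sym (schur_expk L0)) Lf).
Qed.

Lemma ip_oppr f g : measurable_fun setT f -> measurable_fun setT g ->
  ip (fun x => f (- x)) g = ip f (fun x => g (- x)).
Proof.
move=> mf mg; rewrite /ip -[RHS]Rintegral_oppr; last first.
  by apply: measurable_funM => //; exact: measurable_oppr.
by apply: eq_Rintegral => x _; rewrite opprK.
Qed.

Lemma nsq_oppr f : measurable_fun setT f -> nsq (fun x => f (- x)) = nsq f.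
Proof.
move=> mf; rewrite /nsq (ip_oppr mf (measurable_oppr mf)).
by apply: eq_ip => // x; rewrite opprK.
Qed.

(* Unification would otherwise unfold these down to Lebesgue integrals. *)
#[global] Opaque ip kernel_op Rp Rm.

(** Obtained by duality from [Rm_test], as [h] is merely in L^2 and [Rp_der] asks for continuity. *)
Lemma wd_Rp L h : 0 < L -> L2r h -> wd (Rp L h) (fun x => h x - L * Rp L h x).
Proof.
move=> L0 Lh psi tpsi.
have Lp := test_L2r tpsi; have Lp' := test_L2r (test_derive1 tpsi).
have LR := Rm_L2r L0 Lp; have LRp := Rp_L2r L0 Lh.
rewrite Rp_adj//.
have -> : Rm L (derive1 psi) = (fun x => L * Rm L psi x - psi x).
  by apply/funext => x; exact: Rm_test.
rewrite ipBr// ?ipZr//; last exact: L2rZ.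
rewrite ipBl ?ipZl//; last exact: L2rZ.
by rewrite Rp_adj//; ring.
Qed.

Lemma wd_oppr f g : L2r f -> L2r g -> wd f g ->
  wd (fun x => f (- x)) (fun x => - g (- x)).
Proof.
move=> Lf Lg fg psi tpsi.
have Lp := test_L2r tpsi; have Lp' := test_L2r (test_derive1 tpsi).
have tp := test_oppr tpsi; have Ltp := test_L2r tp.
have mf := L2r_meas Lf; have mg := L2r_meas Lg.
have := fg _ tp.
have -> : derive1 (fun x => psi (- x)) = (fun x => - derive1 psi (- x)).
  apply/funext => x; have := @der_comp _ psi -%R x _ _ (test_der (- x) tpsi) (derN (der_id x)).
  by move=> /der_val ->; rewrite mulrN1.
rewrite ipNr//; last exact: L2r_oppr.
rewrite -(ip_oppr mf (L2r_meas Lp')) -(ip_oppr mg (L2r_meas Lp)).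
rewrite ipNl//; last exact: L2r_oppr.
by move=> /eqP; rewrite eqr_oppLR opprK => /eqP ->.
Qed.

Lemma wd_Rm L h : 0 < L -> L2r h -> wd (Rm L h) (fun x => L * Rm L h x - h x).
Proof.
move=> L0 Lh; have Lh' := L2r_oppr Lh.
have := wd_oppr (Rp_L2r L0 Lh') _ (wd_Rp L0 Lh') => /(_ (L2rB Lh' (L2rZ L (Rp_L2r L0 Lh')))).
have <- : Rm L h = fun x => Rp L (fun y => h (- y)) (- x).
  by apply/funext => x; apply: Rm_reflect; exact: L2r_meas.
congr wd; apply/funext => x; rewrite -Rm_reflect; last exact: L2r_meas.
by rewrite opprK opprB.
Qed.

Lemma wd_ae f f' g g' : measurable_fun setT f -> measurable_fun setT f' ->
  measurable_fun setT g -> measurable_fun setT g' ->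
  f = f' %[ae mu] -> g = g' %[ae mu] -> wd f g -> wd f' g'.
Proof.
move=> mf mf' mg mg' ff' gg' fg psi tpsi.
have mp := L2r_meas (test_L2r tpsi).
have mp' := L2r_meas (test_L2r (test_derive1 tpsi)).
rewrite -(ae_ip mf mf' mp' mp' ff' (eq_ae (frefl _))).
by rewrite -(ae_ip mg mg' mp mp gg' (eq_ae (frefl _))) fg.
Qed.

Lemma wdD f1 f2 g1 g2 : L2r f1 -> L2r f2 -> L2r g1 -> L2r g2 ->
  wd f1 g1 -> wd f2 g2 -> wd (fun x => f1 x + f2 x) (fun x => g1 x + g2 x).
Proof.
move=> ? ? ? ? h1 h2 psi tpsi.
have Lp := test_L2r tpsi; have Lp' := test_L2r (test_derive1 tpsi).
by rewrite !ipDl// h1// h2// opprD.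
Qed.

Lemma wdZ k f g : L2r f -> L2r g -> wd f g -> wd (fun x => k * f x) (fun x => k * g x).
Proof.
move=> ? ? h psi tpsi.
have Lp := test_L2r tpsi; have Lp' := test_L2r (test_derive1 tpsi).
by rewrite !ipZl// h// mulrN.
Qed.

Lemma wdB f1 f2 g1 g2 : L2r f1 -> L2r f2 -> L2r g1 -> L2r g2 ->
  wd f1 g1 -> wd f2 g2 -> wd (fun x => f1 x - f2 x) (fun x => g1 x - g2 x).
Proof.
move=> ? ? ? ? h1 h2 psi tpsi.
have Lp := test_L2r tpsi; have Lp' := test_L2r (test_derive1 tpsi).
by rewrite !ipBl// h1// h2//; ring.
Qed.

(** A function orthogonal to all test functions satisfies the hypothesis of [weak_exp_eq0], both
    sides being [0]. *)
Lemma wd_unique f g1 g2 : L2r g1 -> L2r g2 -> wd f g1 -> wd f g2 -> g1 = g2 %[ae mu].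
Proof.
move=> L1 L2 h1 h2.
have H psi : test_function psi -> ip (fun x => g1 x - g2 x) psi = 0.
  move=> tpsi; have Lp := test_L2r tpsi.
  by rewrite ipBl// -[ip g1 _]opprK -h1// -[ip g2 _]opprK -h2// subrr.
have := weak_exp_eq0 ltr01 (L2rB L1 L2) => K.
apply: ae1 (K _) => [x /eqP|psi tpsi]; first by rewrite subr_eq0 => /eqP.
by rewrite mul1r !H//; exact: test_derive1.
Qed.

(** The difference of the two sides has weak derivative [- L] times itself. Weakly differentiable
    functions thus get an integral formula, which plays the part of mollification in what
    follows. *)
Lemma wd_eq_Rp L f g : 0 < L -> L2r f -> L2r g -> wd f g ->
  f = Rp L (fun x => g x + L * f x) %[ae mu].
Proof.
move=> L0 Lf Lg fg.
have Lh : L2r (fun x => g x + L * f x) by apply: L2rD => //; exact: L2rZ.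
have LR := Rp_L2r L0 Lh.
have LD := L2rB Lf LR.
apply: ae1 (weak_exp_eq0 L0 LD _) => [x /eqP|psi tpsi]; first by rewrite subr_eq0 => /eqP.
have Lp := test_L2r tpsi; have Lp' := test_L2r (test_derive1 tpsi).
have LLR := L2rZ L LR.
rewrite !ipBl// fg// (wd_Rp L0 Lh)// ipBl// ipDl ?ipZl//; last exact: L2rZ.
by ring.
Qed.

(** The difference satisfies [D' = L D], which reflection turns into the equation of
    [weak_exp_eq0]. *)
Lemma wd_eq_Rm L f g : 0 < L -> L2r f -> L2r g -> wd f g ->
  f = Rm L (fun x => L * f x - g x) %[ae mu].
Proof.
move=> L0 Lf Lg fg.
have Lh : L2r (fun x => L * f x - g x) by apply: L2rB => //; exact: L2rZ.
have LR := Rm_L2r L0 Lh; have LLR := L2rZ L LR.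
pose D x := f x - Rm L (fun x => L * f x - g x) x.
have LD : L2r D by exact: L2rB.
have wD : wd D (fun x => L * D x).
  have := wdB Lf LR Lg (L2rB LLR Lh) fg (wd_Rm L0 Lh).
  by congr wd; apply/funext => x; rewrite /D; ring.
have LD' := L2r_oppr LD.
have D0 : (fun x => D (- x)) = (fun=> 0) %[ae mu].
  apply: (weak_exp_eq0 L0 LD') => psi tpsi.
  have Lp := test_L2r tpsi.
  rewrite (wd_oppr LD (L2rZ L LD) wD tpsi) ipNl ?opprK ?ipZl//; exact: L2rZ.
have nD : nsq D = 0.
  rewrite -(nsq_oppr (L2r_meas LD)).
  rewrite (ae_nsq _ _ D0); [by rewrite /nsq ip0l|exact: L2r_meas LD'|exact: measurable_cst].
by apply: ae1 (nsq_eq0 LD nD) => x /eqP; rewrite subr_eq0 => /eqP.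
Qed.

(** With [f1 = Rp 1 (g1 + f1)] and [f2 = Rm 1 (f2 - g2)], integration by parts becomes the
    adjunction [Rp_adj]. *)
Lemma wd_ibp f1 f2 g1 g2 : L2r f1 -> L2r f2 -> L2r g1 -> L2r g2 ->
  wd f1 g1 -> wd f2 g2 -> ip f1 g2 = - ip g1 f2.
Proof.
move=> Lf1 Lf2 Lg1 Lg2 w1 w2.
have Z f : L2r f -> L2r (fun x => 1 * f x) by move=> ?; exact: L2rZ.
have LF : L2r (fun x => g1 x + 1 * f1 x) by apply: L2rD => //; exact: Z.
have LG : L2r (fun x => 1 * f2 x - g2 x) by apply: L2rB => //; exact: Z.
have e1 := wd_eq_Rp ltr01 Lf1 Lg1 w1; have e2 := wd_eq_Rm ltr01 Lf2 Lg2 w2.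
have := Rp_adj ltr01 LF LG.
have mR1 := L2r_meas (Rp_L2r ltr01 LF); have mR2 := L2r_meas (Rm_L2r ltr01 LG).
have m1 := L2r_meas Lf1; have m2 := L2r_meas Lf2.
rewrite -(ae_ip m1 mR1 (L2r_meas LG) (L2r_meas LG) e1 (eq_ae (frefl _))).
rewrite -(ae_ip (L2r_meas LF) (L2r_meas LF) m2 mR2 (eq_ae (frefl _)) e2).
rewrite ipBr ?ipZr ?ipDl ?ipZl//; [lra|exact: Z|exact: Z].
Qed.

(* [G a] is the resolvent [(a^2 - d^2/dx^2)^-1], and [Gd a f] is the derivative of [G a f]. *)
Definition G a f := Rp a (Rm a f).
Definition Gd a f x := Rm a f x - a * G a f x.

Section G.
Variables (a : R) (a0 : 0 < a).

Lemma G_L2r f : L2r f -> L2r (G a f).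
Proof. by move=> Lf; apply: Rp_L2r => //; exact: Rm_L2r. Qed.

Lemma Gd_L2r f : L2r f -> L2r (Gd a f).
Proof.
by move=> Lf; apply: L2rB; [exact: Rm_L2r|apply: L2rZ; exact: G_L2r].
Qed.

Lemma G_continuous f : L2r f -> continuous (G a f).
Proof. by move=> Lf; apply: Rp_continuous => //; exact: Rm_L2r. Qed.

Lemma Gd_continuous f : L2r f -> continuous (Gd a f).
Proof.
move=> Lf x; apply: cvgB; first exact: Rm_continuous.
by apply: cvgMr; exact: G_continuous.
Qed.

Lemma der_G f x : L2r f -> der (G a f) x (Gd a f x).
Proof.
by move=> Lf; apply: Rp_der => //; [exact: Rm_L2r|exact: Rm_continuous].
Qed.

Lemma wd_G f : L2r f -> wd (G a f) (Gd a f).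
Proof. by move=> Lf; apply: wd_Rp => //; exact: Rm_L2r. Qed.

Lemma wd_Gd f : L2r f -> wd (Gd a f) (fun x => a ^+ 2 * G a f x - f x).
Proof.
move=> Lf; have LR := Rm_L2r a0 Lf; have LG := G_L2r Lf; have LGd := Gd_L2r Lf.
have := wdB LR (L2rZ a LG) (L2rB (L2rZ a LR) Lf) (L2rZ a LGd) (wd_Rm a0 Lf) (wdZ a LG LGd (wd_G Lf)).
by congr wd; apply/funext => x; rewrite /Gd; ring.
Qed.

(** The factorization [a^2 - d^2/dx^2 = (a - d/dx) (a + d/dx)]: the function [q = w' + a w]
    satisfies [q' = a q - v], so [q = Rm a v], and then [w = Rp a q]. *)
Lemma G_unique w w1 v : L2r w -> L2r w1 -> L2r v ->
  wd w w1 -> wd w1 (fun x => a ^+ 2 * w x - v x) -> w = G a v %[ae mu].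
Proof.
move=> Lw Lw1 Lv h1 h2.
pose q x := w1 x + a * w x.
have Lq : L2r q by apply: L2rD => //; exact: L2rZ.
have Laq : L2r (fun x => a * q x - v x) by apply: L2rB => //; exact: L2rZ.
have La2 : L2r (fun x => a ^+ 2 * w x - v x) by apply: L2rB => //; exact: L2rZ.
have wq : wd q (fun x => a * q x - v x).
  have := wdD Lw1 (L2rZ a Lw) La2 (L2rZ a Lw1) h2 (wdZ a Lw Lw1 h1).
  by congr wd; apply/funext => x; rewrite /q; ring.
have eq := wd_eq_Rm a0 Lq Laq wq.
rewrite (_ : (fun x => a * q x - _) = v) in eq; last by apply/funext => x; ring.
have ew := wd_eq_Rp a0 Lw Lw1 h1.
apply: (ae_trans ew); apply: eq_ae.
by apply: eq_Rp => //; [exact: L2r_meas Lq|apply: L2r_meas; exact: Rm_L2r].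
Qed.

Lemma eq_G f g : measurable_fun setT f -> measurable_fun setT g ->
  f = g %[ae mu] -> G a f = G a g.
Proof.
by move=> mf mg fg; rewrite /G; congr Rp; apply/funext; exact: eq_Rm.
Qed.

Lemma GD f g : L2r f -> L2r g -> G a (fun y => f y + g y) = (fun x => G a f x + G a g x).
Proof.
by move=> Lf Lg; rewrite /G RmD// RpD//; exact: Rm_L2r.
Qed.

Lemma GZ k f : L2r f -> G a (fun y => k * f y) = (fun x => k * G a f x).
Proof.
by move=> Lf; rewrite /G RmZ// RpZ//; exact: Rm_L2r.
Qed.

Lemma GB f g : L2r f -> L2r g -> G a (fun y => f y - g y) = (fun x => G a f x - G a g x).
Proof.
move=> Lf Lg.
rewrite (_ : (fun y => _) = fun y => f y + -1 * g y); last by apply/funext => y; rewrite mulN1r.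
rewrite GD ?GZ//; last exact: L2rZ.
by apply/funext => y; rewrite mulN1r.
Qed.

Lemma G_sym f g : L2r f -> L2r g -> ip (G a f) g = ip f (G a g).
Proof.
move=> Lf Lg; have L1 := Rm_L2r a0 Lf; have L2 := Rm_L2r a0 Lg.
by rewrite /G (Rp_adj a0 L1 Lg) (ipC f) (Rp_adj a0 L2 Lf) ipC.
Qed.

Lemma nrm_G f : L2r f -> nrm (G a f) <= a^-1 ^+ 2 * nrm f.
Proof.
move=> Lf; apply: (le_trans (Rp_nrm a0 (Rm_L2r a0 Lf))).
rewrite expr2 -mulrA; apply: ler_wpM2l; first by rewrite invr_ge0 ltW.
exact: Rm_nrm.
Qed.

Lemma nrm_Gd f : L2r f -> nrm (Gd a f) <= 2 * a^-1 * nrm f.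
Proof.
move=> Lf; have LG := G_L2r Lf.
apply: (le_trans (nrmB (Rm_L2r a0 Lf) (L2rZ a LG))).
have h1 := Rm_nrm a0 Lf; have h2 := nrm_G Lf.
rewrite nrmZ// gtr0_norm//.
have h3 : a * nrm (G a f) <= a^-1 * nrm f.
  have := ler_wpM2l (ltW a0) h2.
  by rewrite (_ : a * (a^-1 ^+ 2 * nrm f) = a^-1 * nrm f)//; field; rewrite gt_eqF.
by apply: (le_trans (lerD h1 h3)); rewrite -mulrA mulr_natl mulr2n.
Qed.

(** The energy identity of [a^2 w - w'' = f], tested against its solution [w = G a f]. *)
Lemma ip_G f : L2r f -> ip f (G a f) = a ^+ 2 * nsq (G a f) + nsq (Gd a f).
Proof.
move=> Lf; have LG := G_L2r Lf; have LGd := Gd_L2r Lf.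
have LZ := L2rZ (a ^+ 2) LG.
have := wd_ibp LG LGd LGd (L2rB LZ Lf) (wd_G Lf) (wd_Gd Lf).
rewrite ipBr ?ipZr// -/(nsq (G a f)) -/(nsq (Gd a f)) (ipC (G a f)).
move: (ip _ _) (nsq _) (nsq _) => u v w h; lra.
Qed.

End G.

End wd.

(** * The profile *)

Section profile.
Context {R : realType}.
Implicit Types (x y a b : R).

(** The properties of the wave on which the later sections rest. [prof_ode] is the travelling wave
    equation integrated once, [prof_energy] its next integral; both constants of integration are
    [0]. *)
Record dp_profile (c k : R) (phi phi1 phi2 : R -> R) : Prop := DpProfile {
  prof_gt0 : forall x, 0 < phi x;
  prof_max : forall x, phi x <= phi 0;
  prof_ltc : phi 0 < c;
  prof_even : forall x, phi (- x) = phi x;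
  prof_der : forall x, der phi x (phi1 x);
  prof_der1 : forall x, der phi1 x (phi2 x);
  prof_cont2 : continuous phi2;
  prof_ode : forall x, (c - phi x) * phi2 x
    = phi1 x ^+ 2 + (c - 2 * k) * phi x - 2 * phi x ^+ 2;
  prof_energy : forall x, ((c - phi x) * phi1 x) ^+ 2
    = phi x ^+ 2 * (phi x ^+ 2 - 2 * (c - 2 / 3 * k) * phi x + c * (c - 2 * k));
  prof_decr : forall x, 0 < x -> phi1 x < 0;
  prof_decay : exists A K : R, 0 < K /\ forall x, phi x <= A * expR (- (K * `|x|))
}.

(** Serves, with its linear analogue, to show that constants of integration vanish: a solitary wave
    comes with the limits of [phi] at infinity, but with no limit of its derivatives. *)
Lemma no_quadratic_growth (g g1 g2 : R -> R) (X B e : R) : 0 < e ->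
  (forall x, der g x (g1 x)) -> (forall x, der g1 x (g2 x)) ->
  (forall x, X <= x -> e <= g2 x) -> (forall x, X <= x -> `|g x| <= B) -> False.
Proof.
move=> e0 dg dg1 g2e gB.
have h1 x : X <= x -> g1 X + e * (x - X) <= g1 x.
  move=> Xx.
  have := @nondecreasing_der _ (fun x => g1 x - e * x) (fun x => g2 x - e) X x Xx.
  move=> H; suff : g1 X - e * X <= g1 x - e * x by lra.
  apply: H => y /andP[Xy _]; last by have := g2e y Xy; lra.
  by apply: (derE (derB (dg1 y) (derZ e (der_id y)))); rewrite mulr1.
have h2 x : X <= x -> g X + g1 X * (x - X) + e / 2 * (x - X) ^+ 2 <= g x.
  move=> Xx.
  pose H0 x := g x - (g1 X * (x - X) + e / 2 * (x - X) ^+ 2).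
  have := @nondecreasing_der _ H0 (fun x => g1 x - (g1 X + e * (x - X))) X x Xx.
  move=> H; suff : H0 X <= H0 x by rewrite /H0 /= subrr; lra.
  apply: H => y /andP[Xy _]; last by have := h1 y Xy; lra.
  have dX := derB (der_id y) (der_cst X y).
  apply: (derE (derB (dg y) (derD (derZ (g1 X) dX) (derZ (e / 2) (der_sqr dX))))).
  by field.
(* [t] solves [e / 2 * t = e / 2 + |g1 X| + 2 |B|], so at [X + t] the quadratic term exceeds the
   linear one and the admissible oscillation together. *)
pose t := 1 + 2 / e * (`|g1 X| + 2 * `|B|).
have t1 : 1 <= t by rewrite lerDl mulr_ge0 ?divr_ge0 ?addr_ge0 ?mulr_ge0// ltW.
have Xt : X <= X + t by lra.
have := h2 _ Xt; rewrite (_ : X + t - X = t); last by ring.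
have := gB _ Xt; have := gB X (lexx X); rewrite !ler_norml => /andP[b1 b2] /andP[b3 b4].
have et : e / 2 * t = e / 2 + `|g1 X| + 2 * `|B|.
  by rewrite /t; field; rewrite gt_eqF.
have q : e / 2 * t ^+ 2 = (e / 2 + `|g1 X| + 2 * `|B|) * t by rewrite -et; ring.
have n1 := ler_norm (- g1 X); rewrite normrN in n1.
have n2 := ler_norm B; have n3 := normr_ge0 B.
rewrite q; nra.
Qed.

Lemma no_linear_growth (g g1 : R -> R) (X B e : R) : 0 < e ->
  (forall x, der g x (g1 x)) ->
  (forall x, X <= x -> e <= g1 x) -> (forall x, X <= x -> `|g x| <= B) -> False.
Proof.
move=> e0 dg g1e gB.
have h1 x : X <= x -> g X + e * (x - X) <= g x.
  move=> Xx.
  have := @nondecreasing_der _ (fun x => g x - e * x) (fun x => g1 x - e) X x Xx.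
  move=> H; suff : g X - e * X <= g x - e * x by lra.
  apply: H => y /andP[Xy _]; last by have := g1e y Xy; lra.
  by apply: (derE (derB (dg y) (derZ e (der_id y)))); rewrite mulr1.
pose t := (2 * `|B| + 1) / e.
have t0 : 0 <= t by rewrite divr_ge0 ?addr_ge0 ?mulr_ge0// ltW.
have Xt : X <= X + t by lra.
have := h1 _ Xt; rewrite (_ : X + t - X = t); last by ring.
have -> : e * t = 2 * `|B| + 1 by rewrite /t; field; rewrite gt_eqF.
have := gB _ Xt; have := gB X (lexx X); rewrite !ler_norml => /andP[b1 b2] /andP[b3 b4].
have n2 := ler_norm B; have n3 := normr_ge0 B; lra.
Qed.

Section wave.
Variables (c k : R) (phi : R -> R).
Hypotheses (k0 : 0 < 2 * k) (ck : 2 * k < c).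
Hypotheses (wave : smooth_solitary_wave c k phi) (even : forall x, phi (- x) = phi x).

Let c0 : 0 < c. Proof. exact: lt_trans ck. Qed.

Let phi1 := derive1 phi.
Let phi2 := derive1 phi1.
Let phi3 := derive1 phi2.

Let sphi : smooth phi. Proof. by case: wave. Qed.

Let d0 x : der phi x (phi1 x).
Proof. by apply: derive1_der; exact: smooth_derivable. Qed.
Let d1 x : der phi1 x (phi2 x).
Proof. by apply: derive1_der; apply: smooth_derivable; exact: smooth_derive1. Qed.
Let d2 x : der phi2 x (phi3 x).
Proof. by apply: derive1_der; apply: smooth_derivable; do 2 apply: smooth_derive1. Qed.

Lemma wave_ode3 x : - c * (phi1 x - phi3 x) + 2 * k * phi1 x + 3 * (phi x - phi2 x) * phi1 x
  + phi x * (phi1 x - phi3 x) = 0.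
Proof.
have sh (f g : R -> R) t y : (forall z, der f z (g z)) -> der (fun z => f (z - c * t)) y (g (y - c * t)).
  move=> dfg; have := @der_comp _ f (fun z => z - c * t) y _ _ (dfg _) (derB (der_id y) (der_cst (c * t) y)).
  by move/derE; apply; rewrite subr0 mulr1.
have st (f g : R -> R) t y : (forall z, der f z (g z)) -> der (fun s => f (y - c * s)) t (- c * g (y - c * t)).
  move=> dfg; have := @der_comp _ f (fun s => y - c * s) t _ _ (dfg _) (derB (der_cst y t) (derZ c (der_id t))).
  by move/derE; apply; ring.
pose u t y := phi (y - c * t).
have ux t y : d_x u t y = phi1 (y - c * t) by exact: der_val (sh _ _ t y d0).
have uxx t y : d_x (d_x u) t y = phi2 (y - c * t).
  rewrite /d_x (_ : derive1 (u t) = fun z => phi1 (z - c * t)); last by apply/funext => z; exact: ux.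
  exact: der_val (sh _ _ t y d1).
have dm z : der (fun z => phi z - phi2 z) z (phi1 z - phi3 z) by exact: derB.
(* At time [1] and position [x + c] the travelling variable equals [x]. *)
have [_ _ /(_ 1 (x + c) ltr01)] := wave.
set m := fun t y => _ - _.
have mE t y : m t y = (fun z => phi z - phi2 z) (y - c * t) by rewrite /m uxx.
have -> : d_t m 1 (x + c) = - c * (phi1 x - phi3 x).
  rewrite /d_t (_ : (fun s => m s (x + c)) = fun s => (fun z => phi z - phi2 z) (x + c - c * s)); last first.
    by apply/funext => s; exact: mE.
  by rewrite (der_val (st _ _ 1 (x + c) dm)) mulr1 addrK.
have -> : d_x m 1 (x + c) = phi1 x - phi3 x.
  rewrite /d_x (_ : m 1 = fun y => (fun z => phi z - phi2 z) (y - c * 1)); last first.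
    by apply/funext => y; exact: mE.
  by rewrite (der_val (sh _ _ 1 (x + c) dm)) mulr1 addrK.
by rewrite -/u ux uxx mulr1 addrK.
Qed.

Let I x := - (c - phi x) * (phi x - phi2 x) + 2 * k * phi x + phi x ^+ 2 - phi1 x ^+ 2.

Lemma wave_first_integral x : I x = I 0.
Proof.
apply: der0_cst => {}x.
have dr := derN (derB (der_cst c x) (d0 x)).
apply: (derE (derB (derD (derD (derM dr (derB (d0 x) (d2 x))) (derZ (2 * k) (d0 x))) (der_sqr (d0 x))) (der_sqr (d1 x)))).
by rewrite -[RHS](wave_ode3 x); ring.
Qed.

Let p x := (c - phi x) * phi1 x.
Let F x := (c - 2 * k) * phi x - 2 * phi x ^+ 2.

Let dp x : der p x (F x + I 0).
Proof.
apply: (derE (derM (derB (der_cst c x) (d0 x)) (d1 x))).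
by rewrite -(wave_first_integral x) /F /I; ring.
Qed.

(** As [q' = - p] and [p' = F + I 0] with [F] tending to [0] at infinity, a nonzero [I 0] would make
    the bounded function [q] grow quadratically. *)
Let q x := (c - phi x) ^+ 2 / 2.

Let dq x : der q x (- p x).
Proof.
apply: (@eq_der _ (fun x => 2^-1 * (c - phi x) ^+ 2)) => [y|]; first by rewrite /q mulrC.
apply: (derE (derZ 2^-1 (der_sqr (derB (der_cst c x) (d0 x))))).
by rewrite /p; field.
Qed.

Let phi_cvg0 (e : R) : 0 < e -> exists X, forall x, X <= x -> `|phi x| <= e.
Proof.
move=> e0; have [_ [xi [_ cv _ _ _]] _] := wave.
move/cvgr0Pnorm_le: cv => /(_ _ e0) [X [_ HX]].
exists (X + 1) => x Xx; apply: HX; by rewrite (lt_le_trans _ Xx)// ltrDl.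
Qed.

Let q_bounded : exists X, forall x, X <= x -> `|q x| <= 2 * c ^+ 2.
Proof.
have [X HX] := phi_cvg0 c0; exists X => x /HX.
rewrite ler_norml => /andP[h1 h2].
rewrite /q ger0_norm ?divr_ge0 ?sqr_ge0//; nra.
Qed.

Let F_small (e : R) : 0 < e -> exists X, forall x, X <= x -> `|F x| <= e.
Proof.
move=> e0.
have m0 : 0 < Num.min 1 (e / (c + 2)).
  by rewrite lt_min ltr01 divr_gt0// addr_gt0.
have [X HX] := phi_cvg0 m0; exists X => x /HX; rewrite le_min => /andP[h1 h2].
have h3 : `|phi x| * (c + 2) <= e by rewrite -ler_pdivlMr// addr_gt0.
rewrite /F (le_trans (ler_normB _ _))// !normrM.
rewrite [`|c - _|]ger0_norm; last by rewrite subr_ge0 ltW.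
rewrite [`|2|]ger0_norm//.
have ck' := ck; have k0' := k0; have := normr_ge0 (phi x).
move: h1 h3; set z := `|phi x| => h1 h3 z0.
have : z * z <= z by nra.
nra.
Qed.

Let I0_eq0 : I 0 = 0.
Proof.
have [X1 H1] := q_bounded.
have dNp x : der (fun x => - p x) x (- (F x + I 0)) by exact: derN.
have [I0|I0|//] := ltgtP (I 0) 0; exfalso.
- have e0 : 0 < - I 0 / 2 by lra.
  have [X2 H2] := F_small e0.
  apply: (@no_quadratic_growth q (fun x => - p x) (fun x => - (F x + I 0)) (Num.max X1 X2) (2 * c ^+ 2) _ e0 dq dNp).
  + by move=> x; rewrite ge_max => /andP[_ /H2]; rewrite ler_norml => /andP[? ?]; lra.
  + by move=> x; rewrite ge_max => /andP[/H1 ->].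
- have e0 : 0 < I 0 / 2 by lra.
  have [X2 H2] := F_small e0.
  apply: (@no_quadratic_growth (fun x => - q x) p (fun x => F x + I 0) (Num.max X1 X2) (2 * c ^+ 2) _ e0 _ dp).
  + by move=> x; apply: (derE (derN (dq x))); rewrite opprK.
  + by move=> x; rewrite ge_max => /andP[_ /H2]; rewrite ler_norml => /andP[? ?]; lra.
  + by move=> x; rewrite ge_max normrN => /andP[/H1 ->].
Qed.

Let Q z := z ^+ 2 - 2 * (c - 2 / 3 * k) * z + c * (c - 2 * k).

Let dP x : der (fun x => phi x ^+ 2 * Q (phi x)) x (2 * p x * F x).
Proof.
have dQ := derD (derB (der_sqr (d0 x)) (derZ (2 * (c - 2 / 3 * k)) (d0 x))) (der_cst (c * (c - 2 * k)) x).
apply: (derE (derM (der_sqr (d0 x)) dQ)).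
by rewrite /p /F /Q; field.
Qed.

Lemma wave_sym_top : forall x y, 0 < x -> x < y -> phi y < phi x.
Proof.
have [_ [xi [mx _ _ inc dec]] _] := wave.
(* A crest [xi] other than [0] would make [- xi] a second maximum point by evenness, against strict
   monotonicity between [- xi] and [0]. *)
suff -> : 0 = xi by [].
have [xi0|xi0|//] := ltgtP 0 xi; exfalso.
- have h : phi (- xi) < phi 0 by apply: inc => //; rewrite oppr_lt0.
  by have := mx 0; rewrite leNgt -(even xi) h.
- have h : phi (- xi) < phi 0 by apply: dec => //; rewrite oppr_gt0.
  by have := mx 0; rewrite leNgt -(even xi) h.
Qed.

Lemma wave_max x : phi x <= phi 0.
Proof.
have [_ [xi [mx _ _ inc dec]] _] := wave.
suff -> : 0 = xi by [].
have [xi0|xi0|//] := ltgtP 0 xi; exfalso.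
- have h : phi (- xi) < phi 0 by apply: inc => //; rewrite oppr_lt0.
  by have := mx 0; rewrite leNgt -(even xi) h.
- have h : phi (- xi) < phi 0 by apply: dec => //; rewrite oppr_gt0.
  by have := mx 0; rewrite leNgt -(even xi) h.
Qed.

Let phi_gt0' x : 0 < x -> 0 < phi x.
Proof.
move=> x0; rewrite ltNge; apply/negP => px.
have h1 : phi (x + 1) < phi x by apply: wave_sym_top => //; lra.
have e0 : 0 < - phi (x + 1) / 2 by lra.
have [X HX] := phi_cvg0 e0.
pose y := Num.max X (x + 2).
have := HX y; rewrite le_max lexx => /(_ isT).
have : phi y < phi (x + 1).
  by apply: wave_sym_top; rewrite ?lt_max; [lra|apply/orP; right; lra].
rewrite ler_norml => h2 /andP[h3 h4]; lra.
Qed.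

Lemma wave_gt0 x : 0 < phi x.
Proof.
have [x0|x0|->] := ltgtP x 0; last 1 first.
- by apply: lt_le_trans (wave_max 1); exact: phi_gt0'.
- by rewrite -even; apply: phi_gt0'; rewrite oppr_gt0.
- exact: phi_gt0'.
Qed.

Let phi1_le0 x : 0 < x -> phi1 x <= 0.
Proof.
move=> x0; have x2 : 0 < x / 2 by lra.
rewrite leNgt; apply/negP => p0.
have cp1 : {for x, continuous phi1} by exact: der_continuous (d1 x).
move/cvgrPdist_lt: cp1 => /(_ (phi1 x) p0) [e /= e0 He].
pose y := x + e / 2.
have xy : x <= y by rewrite /y; lra.
have : phi x <= phi y.
  apply: (nondecreasing_der xy (g := phi1)) => // z /andP[xz zy].
  have zx : `|x - z| < e by rewrite ltr_norml; move: zy; rewrite /y => zy; apply/andP; split; lra.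
  by have /= := He z zx; rewrite ltr_norml => /andP[h1 h2]; lra.
have := wave_sym_top x0 (y := y); rewrite leNgt => ->//.
by rewrite /y; lra.
Qed.

(** [E] is constant because [p' = F]. A negative value contradicts [p^2 >= 0] far away; a positive
    one keeps [p] below a negative constant there, and the bounded function [q] would grow
    linearly. *)
Let energy x : p x ^+ 2 = phi x ^+ 2 * Q (phi x).
Proof.
pose E x := p x ^+ 2 - phi x ^+ 2 * Q (phi x).
have dE y : der E y 0.
  apply: (derE (derB (der_sqr (dp y)) (dP y))).
  by rewrite I0_eq0; ring.
suff E0 : E 0 = 0.
  by apply/eqP; rewrite -subr_eq0 -/(E x) (der0_cst dE x 0) E0.
have EE y : p y ^+ 2 = phi y ^+ 2 * Q (phi y) + E 0.
  by rewrite -(der0_cst dE y 0) /E; ring.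
have c2 : 0 < c ^+ 2 by rewrite exprn_gt0.
have Psmall (e : R) : 0 < e -> exists X, forall x, X <= x -> `|phi x ^+ 2 * Q (phi x)| <= e.
  move=> e0; pose B := 1 + 2 * `|c - 2 / 3 * k| + `|c * (c - 2 * k)|.
  have B0 : 0 < B by rewrite /B -addrA ltr_pwDl// addr_ge0// mulr_ge0.
  have m0 : 0 < Num.min 1 (e / B) by rewrite lt_min ltr01 divr_gt0.
  have [X HX] := phi_cvg0 m0; exists X => y /HX; rewrite le_min => /andP[h1 h2].
  have h3 : `|phi y| * B <= e by rewrite -ler_pdivlMr.
  have h4 : `|Q (phi y)| <= B.
    rewrite /Q /B (le_trans (ler_normD _ _))// lerD2r (le_trans (ler_normB _ _))//.
    apply: lerD; first by rewrite normrX expr_le1.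
    by rewrite !normrM [`|2|]ger0_norm// ler_piMr// mulr_ge0.
  rewrite normrM normrX expr2 -mulrA; apply: le_trans h3.
  rewrite ler_wpM2l// (le_trans (ler_wpM2l (normr_ge0 _) h4))//.
  by rewrite ler_piMl// ltW.
have [E0|E0|//] := ltgtP (E 0) 0; exfalso.
- have e0 : 0 < - E 0 / 2 by lra.
  have [X HX] := Psmall _ e0.
  have := HX X (lexx X); rewrite ler_norml => /andP[_ h].
  by have := sqr_ge0 (p X); rewrite EE; lra.
- have e0 : 0 < E 0 / 2 by lra.
  have [X1 H1] := Psmall _ e0.
  have [X2 H2] := q_bounded.
  have [X3 H3] := phi_cvg0 c0.
  pose d := Num.sqrt (E 0 / 2).
  have d0' : 0 < d by rewrite sqrtr_gt0.
  apply: (@no_linear_growth q (fun x => - p x) (Num.max (Num.max X1 X2) (Num.max X3 1)) (2 * c ^+ 2) d d0' dq).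
  + move=> y; rewrite !ge_max => /andP[/andP[/H1 h1 _] /andP[/H3 h3 h4]].
    have p0 : p y <= 0.
      rewrite /p mulr_ge0_le0 ?phi1_le0//; last lra.
      by move: h3; rewrite ler_norml => /andP[? ?]; lra.
    rewrite -(ger0_norm (_ : 0 <= - p y)) ?oppr_ge0// normrN -sqrtr_sqr ler_sqrt ?sqr_ge0//.
    by rewrite EE; move: h1; rewrite ler_norml => /andP[? ?]; lra.
  + by move=> y; rewrite !ge_max => /andP[/andP[_ /H2 ->]].
Qed.

Let Q_ge0 x : 0 <= Q (phi x).
Proof.
have := sqr_ge0 (p x); rewrite energy pmulr_rge0//.
by rewrite exprn_gt0// wave_gt0.
Qed.

Let Qc : Q c < 0.
Proof.
have k0' := k0; have c0' := c0.
rewrite /Q (_ : _ + _ = - (1 / 3 * (2 * k) * c)); last by field.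
have t3 : 0 < 1 / 3 :> R by rewrite divr_gt0.
by rewrite oppr_lt0; exact: mulr_gt0 (mulr_gt0 t3 k0) c0.
Qed.

(** By the energy identity [Q (phi x) >= 0] for every [x], whereas [Q c = - 2/3 k c < 0]; so [phi],
    which tends to [0], cannot cross the value [c]. *)
Lemma wave_ltc : phi 0 < c.
Proof.
rewrite ltNge; apply/negP => cM.
have c20 : 0 < c / 2 by rewrite divr_gt0// c0.
have [X HX] := phi_cvg0 c20.
have := HX (Num.max X 0); rewrite le_max lexx => /(_ isT).
rewrite ler_norml => /andP[_ h].
have X0 : 0 <= Num.max X 0 by rewrite le_max lexx orbT.
have cphi : {within `[0, Num.max X 0], continuous phi}.
  by apply: continuous_subspaceT; exact: der_continuousT d0.
have cin : Num.min (phi 0) (phi (Num.max X 0)) <= c <= Num.max (phi 0) (phi (Num.max X 0)).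
  have c0' := c0; rewrite ge_min le_max cM /= andbT; apply/orP; right; lra.
have [x _ xc] := @IVT _ phi 0 (Num.max X 0) c X0 cphi cin.
by have := Q_ge0 x; rewrite xc leNgt Qc.
Qed.

Let phi1_0 : phi1 0 = 0.
Proof.
have := @der_comp _ phi -%R 0 _ _ (d0 _) (derN (der_id 0)).
rewrite oppr0 mulrN1 => h.
have {}h : der phi 0 (- phi1 0) by apply: eq_der h => y; rewrite even.
have := der_unique h (d0 0); lra.
Qed.

Let QM : Q (phi 0) = 0.
Proof.
have := energy 0; rewrite /p phi1_0 mulr0 expr0n /= => /esym/eqP.
by rewrite mulf_eq0 sqrf_eq0 gt_eqF ?wave_gt0//= => /eqP.
Qed.

(** [phi 0] is a root of [Q] below [c] and [Q c < 0], so the other root exceeds [c]; the two roots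
    add up to [2 (c - 2/3 k)]. *)
Let cM2 : c + phi 0 < 2 * (c - 2 / 3 * k).
Proof.
have h1 := Qc; have h2 := QM; have h3 := wave_ltc; move: h1 h2 h3; rewrite /Q; nra.
Qed.

Let Q_ge z : z <= phi 0 -> (phi 0 - z) * (c - z) <= Q z.
Proof.
move=> zM; rewrite -subr_ge0.
rewrite (_ : Q z - _ = (phi 0 - z) * (2 * (c - 2 / 3 * k) - phi 0 - c)); last first.
  by rewrite -[Q z]subr0 -[X in Q z - X]QM /Q; ring.
by rewrite mulr_ge0 ?subr_ge0//; have := cM2; lra.
Qed.

Let phi_ltM x : 0 < x -> phi x < phi 0.
Proof.
move=> x0; apply: (@lt_le_trans _ _ (phi (x / 2))); last exact: wave_max.
by apply: wave_sym_top; lra.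
Qed.

Lemma wave_decr x : 0 < x -> phi1 x < 0.
Proof.
move=> x0; rewrite lt_neqAle phi1_le0// andbT; apply/eqP => p0.
have := energy x; rewrite /p p0 mulr0 expr0n /= => /esym/eqP.
rewrite mulf_eq0 sqrf_eq0 gt_eqF ?wave_gt0//= => /eqP Q0.
have := Q_ge (ltW (phi_ltM x0)); rewrite Q0 leNgt => /negP; apply.
by rewrite mulr_gt0 ?subr_gt0 ?phi_ltM// (lt_trans (phi_ltM x0) wave_ltc).
Qed.

(** Dividing the energy identity by [c - phi] and using [Q_ge] yields [phi' <= - K phi] for
    [x >= 1], with [K^2 = (phi 0 - phi 1) / c]. Gronwall's argument and evenness do the rest. *)
Lemma wave_decay : exists A K : R, 0 < K /\ forall x, phi x <= A * expR (- (K * `|x|)).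
Proof.
have M1 : phi 1 < phi 0 by exact: phi_ltM.
pose K := Num.sqrt ((phi 0 - phi 1) / c).
have K2 : K ^+ 2 = (phi 0 - phi 1) / c by rewrite sqr_sqrtr// divr_ge0 ?subr_ge0 ?ltW// c0.
have K0 : 0 < K by rewrite sqrtr_gt0 divr_gt0 ?subr_gt0// c0.
have c0' := c0.
have dle x : 1 <= x -> phi1 x <= - K * phi x.
  move=> x1; have x0 : 0 < x by lra.
  have px := wave_gt0 x; have rx : 0 < c - phi x by rewrite subr_gt0 (le_lt_trans (wave_max x) wave_ltc).
  have p1 : phi x <= phi 1.
    by move: x1; rewrite le_eqVlt => /predU1P[->//|x1]; rewrite ltW// wave_sym_top.
  have sq : (K * phi x) ^+ 2 <= phi1 x ^+ 2.
    have h1 : (phi 0 - phi 1) * (c - phi x) <= Q (phi x).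
      apply: le_trans (Q_ge (wave_max x)); apply: ler_wpM2r; first exact: ltW.
      by rewrite lerD2l lerN2.
    have e := energy x; rewrite /p exprMn in e.
    have h2 : phi x ^+ 2 * ((phi 0 - phi 1) * (c - phi x)) <= (c - phi x) ^+ 2 * phi1 x ^+ 2.
      by rewrite e ler_wpM2l// sqr_ge0.
    have h3 : phi x ^+ 2 * (phi 0 - phi 1) <= (c - phi x) * phi1 x ^+ 2.
      rewrite -(ler_pM2l rx); apply: le_trans (le_trans h2 _); rewrite le_eqVlt; apply/orP; left; apply/eqP; ring.
    have h4 : (c - phi x) * phi1 x ^+ 2 <= c * phi1 x ^+ 2.
      by rewrite ler_wpM2r ?sqr_ge0//; lra.
    rewrite exprMn K2 mulrAC ler_pdivrMr// (mulrC _ c) (mulrC (phi 0 - phi 1)).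
    exact: le_trans h3 h4.
  have n1 : 0 <= - phi1 x by rewrite oppr_ge0 phi1_le0.
  move: sq; rewrite -[phi1 x ^+ 2]sqrrN ler_sqr ?nnegrE ?mulr_ge0 ?(ltW K0) ?(ltW px)//.
  by lra.
have ex x : 1 <= x -> phi x * expR (K * x) <= phi 1 * expR (K * 1).
  move=> x1; rewrite -lerN2.
  have dE y := derN (derM (d0 y) (der_exp (derZ K (der_id y)))).
  apply: (nondecreasing_der (f := fun y => - (phi y * expR (K * y))) x1 (fun y _ => dE y)).
  move=> y /andP[y1 _]; have := dle y y1; have := expR_gt0 (K * y).
  by move=> e0 dy; rewrite oppr_ge0 mulr1; nra.
exists (phi 0 * expR K), K; split=> // x.
suff H y : 0 <= y -> phi y <= phi 0 * expR K * expR (- (K * y)).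
  have [x0|x0] := leP 0 x; first by rewrite ger0_norm// H.
  by rewrite ltr0_norm// -even H// oppr_ge0 ltW.
move=> y0; rewrite expRN ler_pdivlMr ?expR_gt0//.
have [y1|y1] := leP 1 y.
  apply: (le_trans (ex y y1)); rewrite mulr1 ler_wpM2r ?expR_ge0//; exact: ltW.
by apply: ler_pM; rewrite ?expR_ge0 ?(ltW (wave_gt0 y)) ?wave_max// ler_expR ler_piMr// ltW.
Qed.

Lemma wave_profile : dp_profile c k phi phi1 phi2.
Proof.
split.
- exact: wave_gt0.
- exact: wave_max.
- exact: wave_ltc.
- exact: even.
- exact: d0.
- exact: d1.
- exact: der_continuousT d2.
- by move=> x; have := wave_first_integral x; rewrite I0_eq0 /I; lra.
- exact: energy.
- exact: wave_decr.
- exact: wave_decay.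
Qed.

End wave.
End profile.

(** * Exponentially decaying functions *)

Section profile_functions.
Context {R : realType}.
Local Notation mu := (@lebesgue_measure R).
Implicit Types (f g : R -> R) (x y a b : R).

(** Continuous functions of this class are in L^1 and L^2, and the class is stable under
    multiplication by [x], as the linearly growing factor [T] in the formula for [Y] demands. *)
Definition expdec f : Prop :=
  exists A K : R, 0 < K /\ forall x, `|f x| <= A * expR (- (K * `|x|)).

Lemma expdec_le f g B : expdec f -> (forall x, `|g x| <= B * `|f x|) -> expdec g.
Proof.
move=> [A [K [K0 fA]]] gf; exists (`|B| * A), K; split=> // x.
apply: (le_trans (gf x)); apply: (@le_trans _ _ (`|B| * `|f x|)).
  by rewrite ler_wpM2r// ler_norm.
by rewrite -mulrA ler_wpM2l.
Qed.

Lemma expdecD f g : expdec f -> expdec g -> expdec (fun x => f x + g x).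
Proof.
move=> [A [K [K0 fA]]] [B [L [L0 gB]]].
exists (`|A| + `|B|), (Num.min K L); split=> [|x]; first by rewrite lt_min K0.
rewrite (le_trans (ler_normD _ _))// mulrDl; apply: lerD.
- apply: (le_trans (fA x)); apply: ler_pM; rewrite ?expR_ge0 ?ler_norm//.
    by have := le_trans (normr_ge0 _) (fA x); rewrite pmulr_lge0 ?expR_gt0.
  by rewrite ler_expR lerN2 ler_wpM2r// ge_min lexx.
- apply: (le_trans (gB x)); apply: ler_pM; rewrite ?expR_ge0 ?ler_norm//.
    by have := le_trans (normr_ge0 _) (gB x); rewrite pmulr_lge0 ?expR_gt0.
  by rewrite ler_expR lerN2 ler_wpM2r// ge_min lexx orbT.
Qed.

Lemma expdec_mulx f : expdec f -> expdec (fun x => x * f x).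
Proof.
move=> [A [K [K0 fA]]]; exists (2 / K * A), (K / 2); split=> [|x]; first by rewrite divr_gt0.
have A0 : 0 <= A by have := le_trans (normr_ge0 _) (fA x); rewrite pmulr_lge0 ?expR_gt0.
rewrite normrM; apply: (le_trans (ler_wpM2l (normr_ge0 _) (fA x))).
have h : `|x| <= 2 / K * expR (K / 2 * `|x|).
  have := expR_ge1Dx (K / 2 * `|x|) => e.
  rewrite -ler_pdivrMl ?divr_gt0// (_ : (2 / K)^-1 = K / 2); first lra.
  by field; rewrite gt_eqF.
apply: (le_trans (ler_wpM2r _ h)); first by rewrite mulr_ge0 ?expR_ge0.
rewrite mulrACA; apply: ler_wpM2l; first by rewrite mulr_ge0// divr_ge0 ?ltW.
by rewrite -expRD ler_expR; lra.
Qed.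

Lemma expdec_L2r f : continuous f -> expdec f -> L2r f.
Proof.
move=> cf [A [K [K0 fA]]]; have mf := continuous_meas cf; split=> //.
have K2 : 0 < 2 * K by rewrite mulr_gt0.
have h1 := kernel_integrable 0 (schur_expk K2).
have h2 := kernel_integrable 0 (schur_sym (schur_expk K2)).
have h := integrableZl measurableT (A ^+ 2) (integrableD measurableT h1 h2).
apply: le_integrable h => //; first exact/measurable_EFinP/measurable_funX.
move=> x _ /=; rewrite lee_fin normrX [leRHS]ger0_norm; last first.
  rewrite mulr_ge0 ?sqr_ge0// addr_ge0//.
    by case/andP: (expk01 0 x K2).
  by case/andP: (expk01 x 0 K2).
apply: (@le_trans _ _ ((A * expR (- (K * `|x|))) ^+ 2)).
  rewrite ler_sqr ?nnegrE ?fA//; exact: le_trans (fA x).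
rewrite exprMn ler_wpM2l ?sqr_ge0// -expRM_natl.
have [x0|x0] := leP 0 x.
- apply: (@le_trans _ _ (expk (2 * K) x 0)); last first.
    by rewrite lerDr; case/andP: (expk01 0 x K2).
  by rewrite /expk x0 ler_expR subr0 ger0_norm//; lra.
- apply: (@le_trans _ _ (expk (2 * K) 0 x)); last first.
    by rewrite lerDl; case/andP: (expk01 x 0 K2).
  by rewrite /expk (ltW x0) ler_expR ltr0_norm//; lra.
Qed.

End profile_functions.

(** * Integrals over the line and the half-line *)

Section profile_facts.
Context {R : realType}.
Local Notation mu := (@lebesgue_measure R).
Implicit Types (f g : R -> R) (x y a b : R).

Lemma expdec_int f : continuous f -> expdec f -> mu.-integrable setT (EFin \o f).
Proof.
move=> cf [A [K [K0 fA]]]; have mf := continuous_meas cf.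
have h1 := kernel_integrable 0 (schur_expk K0).
have h2 := kernel_integrable 0 (schur_sym (schur_expk K0)).
have h := integrableZl measurableT A (integrableD measurableT h1 h2).
apply: le_integrable h => //; first exact/measurable_EFinP.
move=> x _ /=; rewrite lee_fin.
have A0 : 0 <= A by have := le_trans (normr_ge0 _) (fA x); rewrite pmulr_lge0 ?expR_gt0.
have /andP[e1 _] := expk01 0 x K0; have /andP[e2 _] := expk01 x 0 K0.
rewrite [leRHS]ger0_norm; last by rewrite mulr_ge0// addr_ge0.
apply: (le_trans (fA x)); apply: ler_wpM2l => //.
have [x0|x0] := leP 0 x.
- apply: (@le_trans _ _ (expk K x 0)); last by rewrite lerDr.
  by rewrite /expk x0 ler_expR subr0 ger0_norm.
- apply: (@le_trans _ _ (expk K 0 x)); last by rewrite lerDl.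
  by rewrite /expk (ltW x0) ler_expR ltr0_norm//; lra.
Qed.

(** The left ends avoid [0], where the factorization of the quadratic form is singular, and the
    right ends can be any points along which a given function becomes small. *)
Lemma half_cvg f (e X : nat -> R) : mu.-integrable setT (EFin \o f) ->
  (forall n, 0 < e n) -> e n @[n --> \oo] --> (0 : R) -> X n @[n --> \oo] --> +oo ->
  \int[mu]_(x in `[e n, X n]) f x @[n --> \oo] --> \int[mu]_(x in `[0, +oo[) f x.
Proof.
move=> fI e0 ce cX.
have fm : measurable_fun setT f by apply/measurable_EFinP; exact: measurable_int fI.
rewrite -Rintegral_itv_obnd_cbnd; last by apply: integrableS fI.
rewrite Rintegral_mkcond.
under eq_fun do rewrite Rintegral_mkcond.
pose F n := EFin \o (f \_ `[e n, X n]).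
have A1 n : measurable_fun setT (F n).
  by apply/measurable_EFinP/measurable_restrict => //; exact: measurable_funTS.
have A2 : measurable_fun setT (EFin \o (f \_ `]0, +oo[)).
  by apply/measurable_EFinP/measurable_restrict => //; exact: measurable_funTS.
have A3 : {ae mu, forall x, setT x -> F ^~ x @ \oo --> (EFin \o (f \_ `]0, +oo[)) x}.
  apply: aeW => x _; apply: cvg_near_cst.
  have [x0|x0] := ltP 0 x; last first.
    near=> n; rewrite /F /= !patchE !mem_setE !in_itv /= andbT ltNge x0 /=.
    by rewrite leNgt (le_lt_trans x0 (e0 n)).
  near=> n; rewrite /F /= !patchE !mem_setE !in_itv /= andbT x0.
  rewrite ifT//; apply/andP; split.
    near: n; move/cvgr_lt: ce => /(_ x x0); apply: filterS => n; exact: ltW.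
  by near: n; move/cvgryPge: cX; apply.
have fI' : mu.-integrable setT (fun x => `|(EFin \o f) x|%E) by exact: integrable_abse.
have A5 : {ae mu, forall x n, setT x -> (`|F n x| <= `|(EFin \o f) x|)%E}.
  apply: aeW => x n _; rewrite /F /= patchE; case: ifPn => // _.
  by rewrite normr0 lee_fin.
have [gI _ cvI] := @dominated_convergence _ _ _ mu setT measurableT F (EFin \o (f \_ `]0, +oo[)) _ A1 A2 A3 fI' A5.
move: cvI; rewrite -[X in _ --> X]fineK; last exact: integrable_fin_num gI.
by move=> /fine_cvg.
Unshelve. all: by end_near. Qed.

Lemma expdec_cvg0 f : expdec f -> (fun n : nat => f n%:R) @ \oo --> (0 : R).
Proof.
move=> [A [K [K0 fA]]]; apply/cvgr0Pnorm_le => e e0.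
have A0 : 0 <= A by have := le_trans (normr_ge0 _) (fA 0); rewrite pmulr_lge0 ?expR_gt0.
near=> n; apply: (le_trans (fA _)); rewrite ger0_norm// expRN.
rewrite ler_pdivrMr ?expR_gt0//.
have h := expR_ge1Dx (K * n%:R).
apply: (@le_trans _ _ (e * (1 + K * n%:R))); last by apply: ler_wpM2l => //; exact: ltW.
have : (A / e) / K <= n%:R by near: n; exact: nbhs_infty_ger.
rewrite ler_pdivrMr// ler_pdivrMr// => h2; nra.
Unshelve. all: by end_near. Qed.

Lemma cvg_inv_nat : (fun n : nat => n.+1%:R^-1) @ \oo --> (0 : R).
Proof. exact: cvg_harmonic. Qed.

Lemma cvg_natr : (fun n : nat => n%:R : R) @ \oo --> +oo.
Proof. by apply/cvgryPge => A; exact: nbhs_infty_ger. Qed.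

Lemma half_der u u' : (forall x, der u x (u' x)) -> continuous u' ->
  mu.-integrable setT (EFin \o u') -> (fun n : nat => u n%:R) @ \oo --> (0 : R) ->
  \int[mu]_(x in `[0, +oo[) u' x = - u 0.
Proof.
move=> du cu' iu' cu.
have e0 (n : nat) : 0 < n.+1%:R^-1 :> R by rewrite invr_gt0 ltr0n.
have h := half_cvg iu' e0 cvg_inv_nat cvg_natr.
rewrite -(cvg_lim _ h)//; apply: cvg_lim => //.
have c2 : (fun n : nat => u n%:R - u n.+1%:R^-1) @ \oo --> 0 - u 0.
  apply: cvgB => //; apply: continuous_cvg; last exact: cvg_inv_nat.
  exact: (der_continuous (du 0)).
rewrite sub0r in c2; apply: cvg_trans c2; apply: near_eq_cvg; near=> n.
rewrite (FTC2 _ _ (fun x _ => du x)) => [//||x _]; last exact: cu'.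
have n1 : (1 <= n)%N by near: n; exists 1%N.
apply: (@le_trans _ _ 1); last by rewrite ler1n.
by rewrite invf_le1 ?ltr0n// ler1n.
Unshelve. all: by end_near. Qed.

Lemma half_split f : mu.-integrable setT (EFin \o f) ->
  \int[mu]_x f x = \int[mu]_(x in `[0, +oo[) f x + \int[mu]_(x in `[0, +oo[) f (- x).
Proof.
move=> fI; have mf : measurable_fun setT f by apply/measurable_EFinP; exact: measurable_int fI.
have hp : mu.-integrable setT (EFin \o (f \_ `[0, +oo[)).
  rewrite -restrict_EFin; apply/(integrable_mkcond _ _).1 => //.
  exact: integrableS fI.
have hm : mu.-integrable setT (EFin \o (f \_ `]-oo, 0[)).
  rewrite -restrict_EFin; apply/(integrable_mkcond _ _).1 => //.
  exact: integrableS fI.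
transitivity (\int[mu]_x ((f \_ `[0, +oo[) x + (f \_ `]-oo, 0[) x)).
  apply: eq_Rintegral => x _; rewrite !patchE !mem_setE !in_itv /= andbT.
  by case: leP => _; rewrite ?addr0 ?add0r.
rewrite RintegralD// -Rintegral_mkcond; congr (_ + _).
rewrite -Rintegral_oppr; last first.
  by apply/measurable_restrict => //; exact: measurable_funTS.
rewrite -Rintegral_itv_obnd_cbnd; last first.
  apply: (@integrableS _ _ _ _ setT) => //.
  have /integrableP[_ ifin] := fI; apply/integrableP; split.
    by apply/measurable_EFinP; exact: measurable_oppr.
  rewrite (ge0_integral_oppr (f := fun x => `|(EFin \o f) x|%E))//.
  by apply: measurableT_comp => //; exact/measurable_EFinP.
rewrite [RHS]Rintegral_mkcond; apply: eq_Rintegral => x _.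
by rewrite !patchE !mem_setE !in_itv /= andbT oppr_lt0.
Qed.

Lemma integral_der_eq0 u u' : (forall x, der u x (u' x)) -> continuous u' ->
  expdec u -> expdec u' -> \int[mu]_x u' x = 0.
Proof.
move=> du cu' eu eu'; have iu := expdec_int cu' eu'.
have euN : expdec (fun x => u (- x)).
  by case: eu => A [K [K0 H]]; exists A, K; split=> // x; have := H (- x); rewrite normrN.
have euN' : expdec (fun x => - u' (- x)).
  by case: eu' => A [K [K0 H]]; exists A, K; split=> // x; have := H (- x); rewrite !normrN.
rewrite half_split// (half_der du cu' iu (expdec_cvg0 eu)).
have duN x : der (fun x => u (- x)) x (- u' (- x)).
  by have := @der_comp _ u -%R x _ _ (du _) (derN (der_id x)); rewrite mulrN1.
have cuN : continuous (fun x => - u' (- x)).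
  by move=> x; apply: cvgN; apply: (@continuous_comp _ _ _ -%R u'); [exact: opp_continuous|exact: cu'].
have iuN := expdec_int cuN euN'.
have := half_der duN cuN iuN (expdec_cvg0 euN).
rewrite oppr0 => h.
have -> : \int[mu]_(x in `[0, +oo[) u' (- x) = - \int[mu]_(x in `[0, +oo[) (- u' (- x)).
  rewrite -[RHS]mulN1r -RintegralZl//; last by apply: integrableS iuN.
  by apply: eq_Rintegral => x _; rewrite mulN1r opprK.
by rewrite h opprK addNr.
Qed.

End profile_facts.

(** * Functions of the profile *)

Section dp.
Context {R : realType}.
Local Notation mu := (@lebesgue_measure R).
Implicit Types (f g : R -> R) (x y a b : R).
Variables (c k : R) (phi phi1 phi2 : R -> R).
Hypotheses (k0 : 0 < 2 * k) (ck : 2 * k < c) (P : dp_profile c k phi phi1 phi2).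

(* With [r = c - phi], [dp_p] is [r phi'], [dp_F] is its derivative, and [dp_s] is
   [(1 - d^2/dx^2) (4 - d^2/dx^2)^-1 phi], the first variation of [S] at [phi]. *)
Definition gam : R := 3 * c + 2 * k.
Definition dp_p x := (c - phi x) * phi1 x.
Definition dp_F x := (c - 2 * k) * phi x - 2 * phi x ^+ 2.
Definition dp_s x := phi x * (3 * phi x + 4 * k) / (2 * gam).

Lemma c_gt0 : 0 < c. Proof. exact: lt_trans ck. Qed.
Lemma gam_gt0 : 0 < gam. Proof. by have := c_gt0; have := k0; rewrite /gam; lra. Qed.
Lemma r0_gt0 : 0 < c - phi 0. Proof. by rewrite subr_gt0 (prof_ltc P). Qed.

Lemma r_ge x : c - phi 0 <= c - phi x.
Proof. by rewrite lerD2l lerN2 (prof_max P). Qed.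

Lemma r_gt0 x : 0 < c - phi x. Proof. exact: lt_le_trans r0_gt0 (r_ge x). Qed.

Lemma r_neq0 x : c - phi x != 0. Proof. by rewrite gt_eqF// r_gt0. Qed.

Lemma r_le x : c - phi x <= c.
Proof. by rewrite gerBl ltW// (prof_gt0 P). Qed.

Lemma phi_ltc x : phi x < c. Proof. by rewrite -subr_gt0 r_gt0. Qed.

Lemma inv_r_le x : `|(c - phi x)^-1| <= (c - phi 0)^-1.
Proof.
rewrite ger0_norm; last by rewrite invr_ge0 ltW// r_gt0.
by rewrite lef_pV2 ?posrE ?r_gt0// r_ge.
Qed.

Lemma norm_r_le x : `|c - phi x| <= c.
Proof. by rewrite ger0_norm ?r_le// ltW// r_gt0. Qed.

Lemma phi_continuous : continuous phi. Proof. exact: der_continuousT (prof_der P). Qed.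
Lemma phi1_continuous : continuous phi1. Proof. exact: der_continuousT (prof_der1 P). Qed.

Lemma r_continuous : continuous (fun x => c - phi x).
Proof. by move=> x; apply: cvgB; [exact: cvg_cst|exact: phi_continuous]. Qed.

Lemma inv_r_continuous : continuous (fun x => (c - phi x)^-1).
Proof. by move=> x; apply: cvgV; [exact: r_neq0|exact: r_continuous]. Qed.

Lemma der_r x : der (fun x => c - phi x) x (- phi1 x).
Proof. by apply: (derE (derB (der_cst c x) (prof_der P x))); rewrite sub0r. Qed.

Lemma expdec_phi : expdec phi.
Proof.
have [A [K [K0 H]]] := prof_decay P; exists A, K; split=> // x.
by rewrite ger0_norm// ltW// (prof_gt0 P).
Qed.

Lemma phi_norm x : `|phi x| = phi x. Proof. by rewrite ger0_norm// ltW// (prof_gt0 P). Qed.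

(** In the energy identity the second factor is at most [(2 c)^2], and [c - phi] is at least
    [c - phi 0]. *)
Lemma phi1_le x : `|phi1 x| <= 2 * c / (c - phi 0) * `|phi x|.
Proof.
have c0 := c_gt0; have r00 := r0_gt0; have px := prof_gt0 P x; have pc := phi_ltc x.
have rr := r_ge x; have k0' := k0; have ck' := ck.
rewrite phi_norm mulrAC ler_pdivlMr// -ler_sqr ?nnegrE ?mulr_ge0 ?(ltW r00) ?(ltW px) ?(ltW c0)//.
rewrite exprMn real_normK ?num_real// exprMn.
apply: (@le_trans _ _ (((c - phi x) * phi1 x) ^+ 2)).
  rewrite exprMn [leRHS]mulrC; apply: ler_wpM2l; first exact: sqr_ge0.
  by rewrite ler_sqr// nnegrE; [exact: ltW|exact: ltW (r_gt0 x)].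
rewrite (prof_energy P) mulrC; apply: ler_wpM2r; first exact: sqr_ge0.
have h1 : phi x ^+ 2 <= c ^+ 2 by rewrite ler_sqr ?nnegrE ?ltW.
have h2 : 0 <= (c - 2 / 3 * k) * phi x by rewrite mulr_ge0 ?(ltW px)//; lra.
have h3 : 0 <= c * (2 * k) by rewrite mulr_ge0 ?ltW.
nra.
Qed.

Lemma expdec_phi1 : expdec phi1. Proof. exact: expdec_le expdec_phi phi1_le. Qed.

Lemma expdec_p : expdec dp_p.
Proof. by apply: (expdec_le expdec_phi1 (B := c)) => x; rewrite normrM ler_wpM2r// norm_r_le. Qed.

Lemma expdec_mulphi f B : (forall x, `|f x| <= B) -> expdec (fun x => phi x * f x).
Proof.
by move=> fB; apply: (expdec_le expdec_phi (B := B)) => x; rewrite normrM mulrC ler_wpM2r.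
Qed.

Lemma norm_phi_le x : `|phi x| <= c. Proof. by rewrite phi_norm ltW// phi_ltc. Qed.

Lemma expdec_F : expdec dp_F.
Proof.
have h := @expdec_mulphi (fun x => (c - 2 * k) - 2 * phi x) (`|c - 2 * k| + 2 * c).
have {}h := h _; have -> : dp_F = (fun x => phi x * ((c - 2 * k) - 2 * phi x)).
  by apply/funext => x; rewrite /dp_F; ring.
apply: h => x; rewrite (le_trans (ler_normB _ _))// lerD2l normrM ger0_norm// ler_wpM2l//.
exact: norm_phi_le.
Qed.

Lemma expdec_s : expdec dp_s.
Proof.
have g0 := gam_gt0; have k0' := k0; have px := prof_gt0 P; have pc := phi_ltc.
have -> : dp_s = (fun x => phi x * ((3 * phi x + 4 * k) / (2 * gam))).
  by apply/funext => x; rewrite /dp_s mulrA.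
apply: (@expdec_mulphi _ ((3 * c + 4 * k) / (2 * gam))) => x.
have g2 : 0 < 2 * gam by rewrite mulr_gt0.
have := px x; have := pc x => h1 h2.
rewrite ger0_norm; last by rewrite divr_ge0 ?(ltW g2)//; lra.
by rewrite ler_pM2r ?invr_gt0//; lra.
Qed.

Lemma p_continuous : continuous dp_p.
Proof. by move=> x; apply: cvgM; [exact: r_continuous|exact: phi1_continuous]. Qed.

Lemma der_p x : der dp_p x (dp_F x).
Proof.
apply: (derE (derM (der_r x) (prof_der1 P x))).
by rewrite (prof_ode P) /dp_F; ring.
Qed.

Lemma der_F x : der dp_F x ((c - 2 * k - 4 * phi x) * phi1 x).
Proof.
apply: (derE (derB (derZ (c - 2 * k) (prof_der P x)) (derZ 2 (der_sqr (prof_der P x))))).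
by ring.
Qed.

Lemma der_s x : der dp_s x ((3 * phi x + 2 * k) * phi1 x / gam).
Proof.
have g0 := gam_gt0.
apply: (@eq_der _ (fun x => (2 * gam)^-1 * (phi x * (3 * phi x + 4 * k)))) => [y|].
  by rewrite /dp_s mulrC.
apply: (derE (derZ _ (derM (prof_der P x) (derD (derZ 3 (prof_der P x)) (der_cst (4 * k) x))))).
by field; rewrite gt_eqF.
Qed.

Lemma F_continuous : continuous dp_F. Proof. exact: der_continuousT der_F. Qed.
Lemma s_continuous : continuous dp_s. Proof. exact: der_continuousT der_s. Qed.

Lemma L2r_phi : L2r phi. Proof. exact: expdec_L2r phi_continuous expdec_phi. Qed.
Lemma L2r_phi1 : L2r phi1. Proof. exact: expdec_L2r phi1_continuous expdec_phi1. Qed.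
Lemma L2r_p : L2r dp_p. Proof. exact: expdec_L2r p_continuous expdec_p. Qed.
Lemma L2r_F : L2r dp_F. Proof. exact: expdec_L2r F_continuous expdec_F. Qed.
Lemma L2r_s : L2r dp_s. Proof. exact: expdec_L2r s_continuous expdec_s. Qed.

Lemma wd_p : wd dp_p dp_F.
Proof. exact: classical_wd der_p F_continuous L2r_p L2r_F. Qed.

Lemma wd_F : wd dp_F (fun x => 4 * dp_p x - gam * phi1 x).
Proof.
have E x : (c - 2 * k - 4 * phi x) * phi1 x = 4 * dp_p x - gam * phi1 x.
  by rewrite /dp_p /gam; ring.
apply: classical_wd.
- by move=> x; rewrite -E; exact: der_F.
- by move=> x; apply: cvgB; apply: cvgMr; [exact: p_continuous|exact: phi1_continuous].
- exact: L2r_F.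
- by apply: L2rB; apply: L2rZ; [exact: L2r_p|exact: L2r_phi1].
Qed.

(** The equation of [wd_F] read as [(4 - d^2/dx^2) p = gam phi']; it amounts to [L phi' = 0]. *)
Lemma G2_phi1 : G 2 phi1 = (fun x => gam^-1 * dp_p x) %[ae mu].
Proof.
have g0 := gam_gt0; apply: ae_sym.
apply: (@G_unique _ 2 _ _ (fun x => gam^-1 * dp_F x)).
- by [].
- by apply: L2rZ; exact: L2r_p.
- by apply: L2rZ; exact: L2r_F.
- exact: L2r_phi1.
- by apply: wdZ wd_p; [exact: L2r_p|exact: L2r_F].
- have L : L2r (fun x => 4 * dp_p x - gam * phi1 x).
    by apply: L2rB; apply: L2rZ; [exact: L2r_p|exact: L2r_phi1].
  have := wdZ gam^-1 L2r_F L wd_F.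
  by congr wd; apply/funext => x; field; rewrite gt_eqF.
Qed.

(** The argument is [s'] by [wd_s], so [s' + 3 G 1 s' = phi']: this is the identity [J s = phi']. *)
Lemma G1_s1 : G 1 (fun x => phi1 x - 3 * (gam^-1 * dp_p x)) = (fun x => gam^-1 * dp_p x) %[ae mu].
Proof.
have g0 := gam_gt0; apply: ae_sym.
have Lp := L2rZ gam^-1 L2r_p.
apply: (@G_unique _ 1 _ _ (fun x => gam^-1 * dp_F x)) => //.
- by apply: L2rZ; exact: L2r_F.
- by apply: L2rB; [exact: L2r_phi1|exact: L2rZ].
- by apply: wdZ wd_p; [exact: L2r_p|exact: L2r_F].
- have L : L2r (fun x => 4 * dp_p x - gam * phi1 x).
    by apply: L2rB; apply: L2rZ; [exact: L2r_p|exact: L2r_phi1].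
  have := wdZ gam^-1 L2r_F L wd_F.
  by congr wd; apply/funext => x; field; rewrite gt_eqF.
Qed.

Lemma wd_s : wd dp_s (fun x => phi1 x - 3 * (gam^-1 * dp_p x)).
Proof.
have g0 := gam_gt0.
have E x : (3 * phi x + 2 * k) * phi1 x / gam = phi1 x - 3 * (gam^-1 * dp_p x).
  by rewrite /dp_p; apply/eqP; rewrite -subr_eq0; apply/eqP; rewrite /gam; field; rewrite gt_eqF.
apply: classical_wd.
- by move=> x; rewrite -E; exact: der_s.
- by move=> x; apply: cvgB; [exact: phi1_continuous|apply: cvgMr; apply: cvgMr; exact: p_continuous].
- exact: L2r_s.
- by apply: L2rB; [exact: L2r_phi1|apply: L2rZ; apply: L2rZ; exact: L2r_p].
Qed.

(** The profile equation controls [(c - phi) phi''], and the factor [c - phi] is bounded below. *)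
Lemma L2r_phi2 : L2r phi2.
Proof.
apply: expdec_L2r; first exact: prof_cont2 P.
pose B := (c - phi 0)^-1 * ((2 * c / (c - phi 0)) ^+ 2 * c + `|c - 2 * k| + 2 * c).
apply: (expdec_le expdec_phi (B := B)) => x.
have -> : phi2 x = (c - phi x)^-1 * (phi1 x ^+ 2 + dp_F x).
  by rewrite /dp_F addrA -(prof_ode P) mulrA mulVf ?mul1r// r_neq0.
rewrite normrM /B -(mulrA (c - phi 0)^-1); apply: ler_pM => //; first exact: inv_r_le.
rewrite (le_trans (ler_normD _ _))// -(addrA (_ * c)) mulrDl; apply: lerD.
  rewrite normrX; apply: (@le_trans _ _ ((2 * c / (c - phi 0) * `|phi x|) ^+ 2)).
    by rewrite ler_sqr ?nnegrE// ?phi1_le// (le_trans _ (phi1_le x)).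
  rewrite exprMn -(mulrA (_ ^+ 2)); apply: ler_wpM2l; first exact: sqr_ge0.
  by rewrite expr2; apply: ler_wpM2r => //; exact: norm_phi_le.
have -> : dp_F x = ((c - 2 * k) - 2 * phi x) * phi x by rewrite /dp_F; ring.
rewrite normrM ler_wpM2r// (le_trans (ler_normB _ _))// lerD2l normrM ger0_norm// ler_wpM2l//.
exact: norm_phi_le.
Qed.

Lemma wd_phi1 : wd phi1 phi2.
Proof. exact: classical_wd (prof_der1 P) (prof_cont2 P) L2r_phi1 L2r_phi2. Qed.

(** [1 / (c - phi) = 1 / c + phi / (c (c - phi))], where the last term is integrable. This primitive
    enters [Y] through the product [p T]. *)
Lemma inv_r_primitive : exists T : R -> R, [/\ T 0 = 0,
  (forall x, der T x (c - phi x)^-1)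
  & exists B, forall x, `|T x| <= c^-1 * `|x| + B].
Proof.
have c0 := c_gt0.
pose u x := phi x * (c^-1 * (c - phi x)^-1).
have cu : continuous u.
  by move=> x; apply: cvgM; [exact: phi_continuous|apply: cvgMr; exact: inv_r_continuous].
have eu : expdec u.
  apply: (@expdec_mulphi _ (c^-1 * (c - phi 0)^-1)) => x.
  rewrite normrM gtr0_norm ?invr_gt0//; apply: ler_wpM2l; last exact: inv_r_le.
  by rewrite invr_ge0 ltW.
have u0 x : 0 <= u x.
  by rewrite !mulr_ge0 ?invr_ge0 ?(ltW c0) ?(ltW (r_gt0 x)) ?(ltW (prof_gt0 P x)).
have iu := expdec_int cu eu.
have iu' x : mu.-integrable `]-oo, x] (EFin \o u) by apply: integrableS iu.
pose U x := \int[mu]_(t in `]-oo, x]) u t.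
have dU x : der U x (u x).
  have x1 : x < x + 1 by rewrite ltrDl.
  have [dF F'] := @continuous_FTC1 _ u -oo%O x (x + 1) x1 (iu' _) (ltNyr _) (cu x).
  exact: derP dF F'.
have U0 x : 0 <= U x <= \int[mu]_t u t.
  apply/andP; split; first by apply: Rintegral_ge0 => t _; exact: u0.
  rewrite /U Rintegral_mkcond; apply: le_Rintegral => //.
    by rewrite -restrict_EFin; apply/(integrable_mkcond _ _).1.
  by move=> t _; rewrite patchE; case: ifPn.
exists (fun x => c^-1 * x + (U x - U 0)); split.
- by rewrite mulr0 subrr addr0.
- move=> x; apply: (derE (derD (derZ c^-1 (der_id x)) (derB (dU x) (der_cst (U 0) x)))).
  by rewrite /u; field; rewrite r_neq0 gt_eqF.
- exists (\int[mu]_t u t) => x.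
  rewrite (le_trans (ler_normD _ _))//; apply: lerD.
    by rewrite normrM gtr0_norm ?invr_gt0.
  by have /andP[h1 h2] := U0 x; have /andP[h3 h4] := U0 0; rewrite ler_norml; apply/andP; split; lra.
Qed.

End dp.

(** * The solution Y of L Y = s *)

Section dp_L_inverse_s.
Context {R : realType}.
Local Notation mu := (@lebesgue_measure R).
Implicit Types (f g : R -> R) (x y a b : R).

Lemma nsq_gt0 f : L2r f -> (forall x, 0 < f x) -> 0 < nsq f.
Proof.
move=> Lf f0; rewrite lt_neqAle nsq_ge0 andbT eq_sym; apply/eqP => /(nsq_eq0 Lf) [A [mA A0 sA]].
have AT : A = setT.
  by apply/seteqP; split=> // x _; apply: sA => /= H; have := f0 x; rewrite H// ltxx.
have : (mu `[0%R, 1%R] <= mu A)%E by apply: le_measure; rewrite ?inE// AT.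
by rewrite A0 lebesgue_measure_itv/= lte_fin ltr01 oppr0 adde0 lee_fin lt_geF.
Qed.

Variables (c k : R) (phi phi1 phi2 : R -> R).
Hypotheses (k0 : 0 < 2 * k) (ck : 2 * k < c) (P : dp_profile c k phi phi1 phi2).
Local Notation ga := (gam c k).
Local Notation p := (dp_p c phi phi1).
Local Notation F := (dp_F c k phi).
Local Notation s := (dp_s c k phi).

Lemma expdec_scale f b : expdec f -> expdec (fun x => b * f x).
Proof. by move=> ef; apply: (expdec_le ef (B := `|b|)) => x; rewrite normrM. Qed.

Lemma expdec_mulT f (T : R -> R) a B : 0 <= a -> expdec f ->
  (forall x, `|T x| <= a * `|x| + B) -> expdec (fun x => f x * T x).
Proof.
move=> a0 ef TB.
have e2 := expdecD (expdec_le (expdec_mulx ef) (g := fun x => a * `|x * f x|) (B := a) _)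
  (expdec_le ef (g := fun x => `|B| * `|f x|) (B := `|B|) _).
apply: (expdec_le (e2 _ _) (B := 1)) => [x|x|x].
- by rewrite normrM ger0_norm// normr_id.
- by rewrite normrM !normr_id.
- rewrite mul1r [leRHS]ger0_norm ?addr_ge0 ?mulr_ge0// !normrM mulrA -mulrDl mulrC.
  apply: ler_wpM2r => //; apply: (le_trans (TB x)); rewrite lerD2l; exact: ler_norm.
Qed.

(* [Y] is minus the derivative of the profile with respect to [c]: it solves [L Y = dp_s]. *)
Lemma exists_Y : exists yt Y : R -> R, [/\ L2r Y, 
  (forall x, Y x = (yt x + s x) / (c - phi x)), continuous yt,
  G 2 Y = (fun x => ga^-1 * yt x) %[ae mu]
  & yt 0 < 0 /\ ip Y s < 0].
Proof.
have c0 := c_gt0 k0 ck; have g0 := gam_gt0 k0 ck; have k0' := k0; have ck' := ck.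
have [T [T0 dT [BT TB]]] := inv_r_primitive k0 ck P.
pose d := c - 2 * k.
have d0 : 0 < d by rewrite subr_gt0.
(* [L Y = s] amounts to [yt'' = (4 - gam / (c - phi)) yt - gam s / (c - phi)]. As [p] solves the
   homogeneous equation, the ansatz combines [p T] with a quadratic polynomial in [phi]. The value
   of [b0] reduces [yt'] to [- 2 b1 p - (k / d) F T]; matching the coefficients of [phi^2] in the
   equation then gives [b1]. *)
pose b1 := 3 * (c + 2 * k) / (2 * d * ga).
pose b0 := k / d - 2 * b1 * c.
pose yt x := phi x * (b0 + b1 * phi x) - k / d * (p x * T x).
pose yt1 x := - (2 * b1 * p x) - k / d * (F x * T x).
pose Y x := (yt x + s x) / (c - phi x).
have cT : continuous T by exact: der_continuousT dT.
have dn0 : d != 0 by rewrite gt_eqF.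
have gn0 : ga != 0 by rewrite gt_eqF.
have dyt x : der yt x (yt1 x).
  apply: (derE (derB (derM (prof_der P x) (derD (der_cst b0 x) (derZ b1 (prof_der P x))))
    (derZ (k / d) (derM (der_p P x) (dT x))))).
  rewrite /yt1 /b0 /dp_p.
  by have r0 := r_neq0 P x; field; rewrite ?r0 ?gn0 ?dn0.
have dyt1 x : der yt1 x (4 * yt x - ga * Y x).
  apply: (derE (derB (derN (derZ (2 * b1) (der_p P x))) (derZ (k / d) (derM (der_F P x) (dT x))))).
  have r0 := r_neq0 P x; rewrite /Y /yt /dp_s /b0 /b1 /dp_p /dp_F.
  rewrite /d /gam in dn0 gn0 *.
  by field; rewrite ?r0 ?gn0 ?dn0.
have eT f (ef : expdec f) : expdec (fun x => f x * T x).
  by apply: (@expdec_mulT f T c^-1 BT) => //; rewrite invr_ge0 ltW.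
have eyt : expdec yt.
  apply: expdecD.
    apply: (expdec_mulphi P (B := `|b0| + `|b1| * c)) => x.
    rewrite (le_trans (ler_normD _ _))// lerD2l normrM ler_wpM2l//.
    exact: norm_phi_le P x.
  by under eq_fun do rewrite -mulNr; apply: expdec_scale; apply: eT; exact: expdec_p P.
have eyt1 : expdec yt1.
  apply: expdecD.
    by under eq_fun do rewrite -mulNr; apply: expdec_scale; exact: expdec_p P.
  by under eq_fun do rewrite -mulNr; apply: expdec_scale; apply: eT; exact: expdec_F P.
have cyt := der_continuousT dyt; have cyt1 := der_continuousT dyt1.
have es := expdec_s k0 ck P; have cs := s_continuous k0 ck P.
have cY : continuous Y.
  by move=> x; apply: cvgM; [apply: cvgD; [exact: cyt|exact: cs]|exact: inv_r_continuous P x].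
have eY : expdec Y.
  apply: (expdec_le (expdecD eyt es) (B := (c - phi 0)^-1)) => x.
  by rewrite normrM mulrC ler_wpM2r// (inv_r_le P).
have LY := expdec_L2r cY eY; have Lyt := expdec_L2r cyt eyt; have Lyt1 := expdec_L2r cyt1 eyt1.
have Lyt2 : L2r (fun x => 4 * yt x - ga * Y x) by apply: L2rB; exact: L2rZ.
have cyt2 : continuous (fun x => 4 * yt x - ga * Y x).
  by move=> x; apply: cvgB; apply: cvgMr; [exact: cyt|exact: cY].
exists yt, Y; split => //.
  apply: ae_sym; apply: (@G_unique _ 2 _ _ (fun x => ga^-1 * yt1 x)) => //.
  - exact: L2rZ.
  - exact: L2rZ.
  - by apply: wdZ => //; exact: classical_wd dyt cyt1 Lyt Lyt1.
  - have := wdZ ga^-1 Lyt1 Lyt2 (classical_wd dyt1 cyt2 Lyt1 Lyt2).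
    by congr wd; apply/funext => x; field.
split.
  have px := prof_gt0 P 0; have pc := phi_ltc P 0.
  (* [T 0 = 0] removes the nonlocal term, and [phi 0 < c] leaves the sign of [b0 + b1 * c]. A
     nonzero [yt 0] is what later allows the value of [G 2 v] at [0] to be corrected by a multiple
     of [Y]. *)
  rewrite /yt T0 !mulr0 subr0 pmulr_rlt0//.
  have b10 : 0 < b1 by rewrite /b1 divr_gt0 ?mulr_gt0//; lra.
  apply: (@lt_trans _ _ (b0 + b1 * c)); first by rewrite ltrD2l ltr_pM2l.
  have -> : b0 + b1 * c = (2 * k ^+ 2 - 3 / 2 * c ^+ 2) / (d * ga).
    rewrite /b0 /b1; rewrite /d /gam in dn0 gn0 *; by field; rewrite ?r0 ?gn0 ?dn0.
  rewrite pmulr_llt0 ?invr_gt0 ?mulr_gt0//; nra.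
(* The nonlocal part of [Y s] is [- (k / d) s phi' T]. With [M] a primitive of [s phi'], the
   derivative of [M T] has integral [0], and subtracting a multiple of it leaves a rational function
   of [phi]. *)
pose M x := (phi x ^+ 3 + 2 * k * phi x ^+ 2) / (2 * ga).
have dM x : der M x (s x * phi1 x).
  apply: (@eq_der _ (fun x => (2 * ga)^-1 * (phi x * phi x ^+ 2 + 2 * k * phi x ^+ 2))) => [y|].
    by rewrite /M -exprS mulrC.
  apply: (derE (derZ _ (derD (derM (prof_der P x) (der_sqr (prof_der P x))) (derZ (2 * k) (der_sqr (prof_der P x)))))).
  by rewrite /dp_s; field.
have cM := der_continuousT dM.
pose MT x := M x * T x.
pose MT' x := s x * phi1 x * T x + M x * (c - phi x)^-1.
have dMT x : der MT x (MT' x) by apply: derM; [exact: dM|exact: dT].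
have cMT' : continuous MT'.
  move=> x; apply: cvgD; apply: cvgM; [|exact: cT|exact: cM|exact: inv_r_continuous P x].
  by apply: cvgM; [exact: cs|exact: phi1_continuous P x].
have eM : expdec M.
  have -> : M = (fun x => phi x * (phi x * (phi x + 2 * k) / (2 * ga))).
    by apply/funext => x; rewrite /M; ring.
  apply: (expdec_mulphi P (B := c * (c + 2 * k) / (2 * ga))) => x.
  have px := prof_gt0 P x; have pc := phi_ltc P x.
  rewrite ger0_norm; last first.
    by apply: divr_ge0; apply: mulr_ge0 => //; [exact: ltW|apply: addr_ge0; exact: ltW|exact: ltW].
  apply: ler_wpM2r; first by rewrite invr_ge0 mulr_ge0// ltW.
  apply: ler_pM; [exact: ltW|by apply: addr_ge0; exact: ltW|exact: ltW|].
  by rewrite lerD2r; exact: ltW.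
have esp : expdec (fun x => s x * phi1 x).
  have [B hB] : exists B, forall x, `|s x| <= B.
    have [A [K [K0 h]]] := es; exists A => x.
    have A0 : 0 <= A by have := le_trans (normr_ge0 _) (h 0); rewrite pmulr_lge0 ?expR_gt0.
    apply: (le_trans (h x)); rewrite ler_piMr// -expR0 ler_expR oppr_le0 mulr_ge0//; exact: ltW.
  by apply: (expdec_le (expdec_phi1 k0 ck P) (B := B)) => x; rewrite normrM ler_wpM2r.
have eMT : expdec MT by exact: eT.
have eMr : expdec (fun x => M x * (c - phi x)^-1).
  by apply: (expdec_le eM (B := (c - phi 0)^-1)) => x; rewrite normrM mulrC ler_wpM2r// (inv_r_le P).
have eMT' : expdec MT' by apply: expdecD => //; exact: eT.
have I0 := integral_der_eq0 dMT cMT' eMT eMT'.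
pose q x := ((b0 + b1 * phi x) * (3 * phi x + 4 * k) / (2 * ga) + (3 * phi x + 4 * k) ^+ 2 / (4 * ga ^+ 2)
   + k / d * (phi x + 2 * k) / (2 * ga)) / (c - phi x).
have Yq x : Y x * s x = phi x ^+ 2 * q x - k / d * MT' x.
  have r0 := r_neq0 P x; rewrite /q /MT' /M /Y /yt /dp_s /dp_p.
  by field; rewrite ?r0 ?gn0 ?dn0.
have iMT' := expdec_int cMT' eMT'.
have iYs : mu.-integrable setT (EFin \o (fun x => Y x * s x)) by exact: L2r_mul_int LY (L2r_s k0 ck P).
have -> : ip Y s = \int[mu]_x (phi x ^+ 2 * q x).
  rewrite ipE -[LHS]addr0 -[X in _ + X](mulr0 (k / d)) -I0 -RintegralZl// -RintegralD//; last first.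
    exact: (integrableZl measurableT (k / d) iMT').
  by apply: eq_Rintegral => x _; rewrite Yq subrK.
pose K := 4 * k ^+ 3 / (2 * d * ga ^+ 2 * c).
have kk0 : 0 < k by lra.
have K0 : 0 < K by rewrite /K divr_gt0 ?mulr_gt0 ?exprn_gt0.
have qK x : q x <= - K.
  have r0 := r_neq0 P x; have rp := r_gt0 P x; have rl := r_le P x; have px := prof_gt0 P x.
  (* [N] is a sum of nonnegative terms, one of them the constant [4 k^3], and the denominator is at
     most its value for [c - phi = c]: this is the origin of [K]. *)
  pose N := 9 * c * phi x * (c - phi x) + (12 * c * k - 2 * k ^+ 2) * (c - phi x) + 4 * k ^+ 3 + 2 * k ^+ 2 * phi x.
  have -> : q x = - (N / (2 * d * ga ^+ 2 * (c - phi x))).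
    rewrite /q /N /b0 /b1; rewrite /d /gam in dn0 gn0 *; by field; rewrite ?r0 ?gn0 ?dn0.
  rewrite lerN2 /K; apply: ler_pM.
  - by rewrite mulr_ge0// exprn_ge0// ltW.
  - by rewrite invr_ge0 !mulr_ge0// ?exprn_ge0// ltW.
  - rewrite /N; have h1 : 0 <= 9 * c * phi x * (c - phi x) by rewrite !mulr_ge0// ltW.
    have h2 : 0 <= (12 * c * k - 2 * k ^+ 2) * (c - phi x) by rewrite mulr_ge0 ?(ltW rp)//; nra.
    have h3 : 0 <= 2 * k ^+ 2 * phi x by rewrite !mulr_ge0 ?sqr_ge0// ltW.
    by move: h1 h2 h3; lra.
  - have D0 : 0 < 2 * d * ga ^+ 2 by rewrite !mulr_gt0// exprn_gt0.
    by rewrite lef_pV2 ?posrE ?mulr_gt0 ?exprn_gt0//; apply: ler_wpM2l => //; exact: ltW.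
have Lphi := L2r_phi P.
have hE : (fun x => phi x ^+ 2 * q x) = (fun x => Y x * s x + k / d * MT' x).
  by apply/funext => x; rewrite Yq subrK.
have iE : mu.-integrable setT (EFin \o (fun x => phi x ^+ 2 * q x)).
  by rewrite hE; have := integrableD measurableT iYs (integrableZl measurableT (k / d) iMT').
have iphi : mu.-integrable setT (EFin \o (fun x => phi x * phi x)) by exact: L2r_mul_int.
apply: (@le_lt_trans _ _ (- K * nsq phi)); last first.
  by rewrite mulNr oppr_lt0 mulr_gt0// nsq_gt0//; exact: prof_gt0 P.
rewrite nsqE ipE -RintegralZl//; apply: le_Rintegral => //.
  exact: (integrableZl measurableT (- K) iphi).
move=> x _; rewrite -expr2 mulrC; apply: ler_wpM2r; [exact: sqr_ge0|exact: qK].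
Qed.

End dp_L_inverse_s.

(** * A Poincare inequality on the half-line *)

Section half_line.
Context {R : realType}.
Local Notation mu := (@lebesgue_measure R).
Implicit Types (f g z : R -> R) (x y a b : R).

Lemma Rintegral_subset f (A B : set R) : measurable A -> measurable B ->
  mu.-integrable B (EFin \o f) -> A `<=` B -> (forall x, 0 <= f x) ->
  \int[mu]_(x in A) f x <= \int[mu]_(x in B) f x.
Proof.
move=> mA mB fB AB f0; rewrite [leLHS]Rintegral_mkcond [leRHS]Rintegral_mkcond.
have fA : mu.-integrable A (EFin \o f) by exact: integrableS fB.
apply: le_Rintegral => //.
- by rewrite -restrict_EFin; apply/(integrable_mkcond _ _).1.
- by rewrite -restrict_EFin; apply/(integrable_mkcond _ _).1.
- move=> x _; rewrite !patchE; have [xA|_] := boolP (x \in A).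
    by rewrite ifT// inE; apply: AB; rewrite inE in xA.
  by case: ifPn.
Qed.

Lemma Rintegral_itv_cat f a b c : a <= b -> b <= c -> mu.-integrable `[a, c] (EFin \o f) ->
  \int[mu]_(x in `[a, c]) f x = \int[mu]_(x in `[a, b]) f x + \int[mu]_(x in `[b, c]) f x.
Proof.
move=> ab bc fI; have := @Rintegral_itvB R f (BLeft a) (BRight c) b fI.
rewrite !bnd_simp => /(_ ab bc)/eqP; rewrite subr_eq addrC => /eqP ->; congr (_ + _).
rewrite Rintegral_itv_obnd_cbnd//; apply: integrableS fI => // x /=.
by rewrite !in_itv /= => /andP[bx ->]; rewrite (le_trans ab)// ltW.
Qed.

Lemma Rintegral_itv_cst a b v : a <= b -> \int[mu]_(x in `[a, b]) v = v * (b - a).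
Proof.
move=> ab; rewrite (@FTC2 _ (fun=> v) (fun x => v * x) a b)// => [|x _|x _].
- by rewrite mulrBr.
- exact: cvg_cst.
- by apply: (derE (derZ v (der_id x))); rewrite mulr1.
Qed.

Lemma der_cvg_seq f l : f 0 = 0 -> der f 0 l ->
  (fun n : nat => n.+1%:R * f (n.+1%:R^-1)) @ \oo --> l.
Proof.
move=> f0 [fd fv].
have {}fd : h^-1 *: (f (h *: (1 : R) + 0) - f 0) @[h --> 0^'] --> l.
  rewrite -fv; exact: fd.
have /cvgr_dnbhsP/(_ (fun n : nat => n.+1%:R^-1)) := fd.
have n0 (n : nat) : n.+1%:R^-1 != 0 :> R by rewrite invr_neq0// pnatr_eq0.
move=> /(_ (conj n0 cvg_inv_nat)) /=; apply: cvg_trans; apply: near_eq_cvg.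
by apply: nearW => n; rewrite invrK f0 subr0 addr0 /GRing.scale /= mulr1.
Qed.

(** Square integrability directly yields points far out where [z] is small; a sequence of such
    points is enough to discard the boundary terms. *)
Lemma small_at_infinity z n d : continuous z -> L2r z -> 0 < d ->
  exists x, n <= x /\ z x ^+ 2 <= d.
Proof.
move=> cz Lz d0; apply: contrapT => /forallNP H.
have H' x : n <= x -> d <= z x ^+ 2.
  by move=> nx; rewrite leNgt; apply/negP => zd; apply: (H x); split=> //; exact: ltW.
have iz : mu.-integrable setT (EFin \o (fun x => z x * z x)) by exact: L2r_mul_int.
pose N := (nsq z + 1) / d.
have N0 : 0 <= N by rewrite divr_ge0 ?addr_ge0 ?nsq_ge0// ltW.
have h1 : \int[mu]_(x in `[n, n + N]) d <= \int[mu]_(x in `[n, n + N]) (z x * z x).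
  apply: le_Rintegral => //.
  - by apply: continuous_itv_int => x _; exact: cvg_cst.
  - exact: integrableS iz.
  - by move=> x /=; rewrite in_itv /= => /andP[nx _]; rewrite -expr2 H'.
have h2 : \int[mu]_(x in `[n, n + N]) (z x * z x) <= nsq z.
  by rewrite nsqE ipE; apply: Rintegral_subset => // x; rewrite -expr2 sqr_ge0.
have := le_trans h1 h2; rewrite Rintegral_itv_cst ?lerDl// addrAC subrr add0r /N.
by rewrite mulrCA divff ?gt_eqF// mulr1 gerDl ler10.
Qed.

Variables (p F V : R -> R) (t K x1 B : R).
Hypotheses (dp : forall x, der p x (F x)) (dF : forall x, der F x (V x * p x)).
Hypotheses (cV : continuous V) (VB : forall x, `|V x| <= B).
Hypotheses (p0 : p 0 = 0) (F0 : F 0 != 0) (p_lt0 : forall x, 0 < x -> p x < 0) (Lp : L2r p).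
Hypotheses (K0 : 0 < K) (x10 : 0 < x1) (t0 : 0 <= t).
Hypotheses (tau_le : forall x, 0 < x -> - F x / p x <= t).
Hypotheses (tau_ge : forall x, x1 <= x -> K <= - F x / p x).

Let tau x := - F x / p x.

(** The Riccati equation of [tau = - p'/p], equivalent to [p'' = V p]. *)
Lemma der_tau x : 0 < x -> der tau x (tau x ^+ 2 - V x).
Proof.
move=> x0; have px : p x != 0 by rewrite lt_eqF// p_lt0.
apply: (derE (derM (derN (dF x)) (derV px (dp x)))).
by rewrite /tau; field.
Qed.

Section one_function.
Variables (z z1 : R -> R).
Hypotheses (dz : forall x, der z x (z1 x)) (cz1 : continuous z1) (z0 : z 0 = 0).
Hypotheses (Lz : L2r z) (Lz1 : L2r z1).

Let cz : continuous z := der_continuousT dz.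
Let E x := z1 x ^+ 2 + V x * z x ^+ 2.
Let D := \int[mu]_(x in `[0, +oo[) E x.
(** This is [p] times the derivative of [z / p]; it vanishes on the multiples of [p]. *)
Let g x := z1 x + tau x * z x.

Lemma half_form_continuous : continuous E.
Proof.
move=> x; apply: cvgD; first by apply: cvgM; exact: cz1.
by apply: cvgM; [exact: cV|apply: cvgM; exact: cz].
Qed.

Lemma half_form_integrable : mu.-integrable setT (EFin \o E).
Proof.
have LV : L2r (fun x => V x * z x) by apply: (L2rM _ VB); [exact: continuous_meas|].
have h := integrableD measurableT (L2r_mul_int Lz1 Lz1) (L2r_mul_int LV Lz).
by have -> : E = (fun x => z1 x * z1 x + V x * z x * z x)
  by apply/funext => x; rewrite /E !expr2 mulrA.
Qed.

Lemma g_continuous x : 0 < x -> {for x, continuous g}.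
Proof.
move=> x0; apply: cvgD; first exact: cz1.
by apply: cvgM; [exact: (der_continuous (der_tau x0))|exact: cz].
Qed.

(** By the Riccati equation, [(tau z^2)' = g^2 - E]. *)
Lemma half_form_factor a b : 0 < a -> a <= b ->
  \int[mu]_(x in `[a, b]) g x ^+ 2
  = \int[mu]_(x in `[a, b]) E x + (tau b * z b ^+ 2 - tau a * z a ^+ 2).
Proof.
move=> a0 ab.
have pos x : a <= x <= b -> 0 < x by move=> /andP[ax _]; exact: lt_le_trans ax.
have du x : a <= x <= b -> der (fun x => tau x * z x ^+ 2) x (g x ^+ 2 - E x).
  move=> /pos x0; apply: (derE (derM (der_tau x0) (der_sqr (dz x)))).
  by rewrite /g /E; ring.
have cu x : a <= x <= b -> {for x, continuous (fun x => g x ^+ 2 - E x)}.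
  move=> /pos x0; apply: cvgB; last exact: half_form_continuous.
  by apply: cvgM; exact: g_continuous.
rewrite -(FTC2 ab cu du) -RintegralD//.
- by apply: eq_Rintegral => x _; rewrite addrC subrK.
- by apply: continuous_itv_int => x _; exact: half_form_continuous.
- exact: continuous_itv_int.
Qed.

(* The boundary term at [0] vanishes because [z ^+ 2] vanishes there to second order and [p]
   only to first order. *)
Lemma half_form_ge a b : 0 < a -> a <= b -> \int[mu]_(x in `[a, b]) g x ^+ 2 <= D.
Proof.
move=> a0 ab; have iE := half_form_integrable.
have /choice[X XP] : forall n : nat, exists x, n%:R <= x /\ z x ^+ 2 <= n.+1%:R^-1.
  by move=> n; apply: small_at_infinity.
have cX : X n @[n --> \oo] --> +oo.
  apply/cvgryPge => A; near=> n; have [h _] := XP n; apply: le_trans h.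
  by near: n; exact: nbhs_infty_ger.
pose e (n : nat) : R := n.+1%:R^-1.
have e0 n : 0 < e n by rewrite invr_gt0 ltr0n.
have h := half_cvg iE e0 cvg_inv_nat cX.
(* The term [t * e n] bounds the boundary contribution at [X n], where [tau <= t] and
   [z^2 <= e n]. *)
pose Bn n := tau (e n) * z (e n) ^+ 2 - t * e n.
have cB : Bn n @[n --> \oo] --> (0 : R).
  have -> : (0 : R) = - F 0 * (z1 0 ^+ 2 / F 0) * 0 - t * 0 by rewrite !mulr0 subr0.
  apply: cvgB; last by apply: cvgMr; exact: cvg_inv_nat.
  have -> : (fun n => tau (e n) * z (e n) ^+ 2) = (fun n => - F (e n) *
      ((n.+1%:R * z (e n)) ^+ 2 / (n.+1%:R * p (e n))) * e n).
    apply/funext => n; rewrite /tau; have pe := p_lt0 (e0 n).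
    have en : n.+1%:R != 0 :> R by rewrite pnatr_eq0.
    have -> : n.+1%:R = (e n)^-1 by rewrite /e invrK.
    have enn : e n != 0 by rewrite gt_eqF.
    by field; rewrite (lt_eqF pe) enn.
  apply: cvgM; last exact: cvg_inv_nat.
  have cn f l : f 0 = 0 -> der f 0 l -> (fun n => n.+1%:R * f (e n)) @ \oo --> l.
    exact: der_cvg_seq.
  apply: cvgM.
    apply: cvgN; apply: continuous_cvg; last exact: cvg_inv_nat.
    exact: (der_continuous (dF 0)).
  apply: cvgM; first by rewrite expr2; under eq_fun do rewrite expr2; apply: cvgM; exact: cn.
  by apply: cvgV => //; exact: cn.
have hB : (\int[mu]_(x in `[a, b]) g x ^+ 2 + Bn n) @[n --> \oo] -->
    \int[mu]_(x in `[a, b]) g x ^+ 2 + 0 by apply: cvgD => //; exact: cvg_cst.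
rewrite -[leLHS]addr0; apply: (ler_cvg_to hB h); near=> n.
have ena : e n <= a.
  near: n; have ci := @cvg_inv_nat R; move/cvgr_lt: ci => /(_ a a0); apply: filterS => n; exact: ltW.
have bX : b <= X n by near: n; move/cvgryPge : cX; apply.
have eX : e n <= X n by rewrite (le_trans ena)// (le_trans ab).
have [_ hX] := XP n.
have Xpos : 0 < X n by rewrite (lt_le_trans (e0 n)).
have i1 : mu.-integrable `[e n, X n] (EFin \o (fun x => g x ^+ 2)).
  apply: continuous_itv_int => x /andP[ex _]; have x0 := lt_le_trans (e0 n) ex.
  by apply: cvgM; exact: g_continuous.
have s1 : \int[mu]_(x in `[a, b]) g x ^+ 2 <= \int[mu]_(x in `[e n, X n]) g x ^+ 2.
  apply: Rintegral_subset => // [x|x]; last exact: sqr_ge0.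
  by rewrite /= !in_itv /= => /andP[ax xb]; rewrite (le_trans ena)// (le_trans xb).
have s2 := half_form_factor (e0 n) eX.
have s3 : tau (X n) * z (X n) ^+ 2 <= t * e n.
  apply: (@le_trans _ _ (t * z (X n) ^+ 2)).
    by apply: ler_wpM2r; [exact: sqr_ge0|exact: tau_le].
  by apply: ler_wpM2l.
rewrite /Bn; move: s1 s2 s3; lra.
Unshelve. all: by end_near. Qed.

Lemma half_form_ge0 : 0 <= D.
Proof.
apply: le_trans (half_form_ge x10 (lexx x1)).
by apply: Rintegral_ge0 => x _; exact: sqr_ge0.
Qed.

(** The multiple of [p] is fixed by [zeta x1 = 0], an initial condition for both directions from
    [x1]. As [p' = - tau p], the equation [zeta' = g - tau zeta] has the same [g] as [z]. *)
Let zeta x := z x - z x1 / p x1 * p x.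

Lemma der_zeta x : 0 < x -> der zeta x (g x - tau x * zeta x).
Proof.
move=> x0; apply: (derE (derB (dz x) (derZ (z x1 / p x1) (dp x)))).
have px := p_lt0 x0; have px1 := p_lt0 x10.
by rewrite /g /tau /zeta; field; rewrite !lt_eqF.
Qed.

Lemma zeta_x1 : zeta x1 = 0.
Proof. by rewrite /zeta mulfVK ?subrr// lt_eqF// p_lt0. Qed.

Lemma zeta_continuous : continuous zeta.
Proof. by move=> x; apply: cvgB; [exact: cz|apply: cvgMr; exact: (der_continuous (dp x))]. Qed.

Lemma zeta_int a b : mu.-integrable `[a, b] (EFin \o (fun x => zeta x ^+ 2)).
Proof. by apply: continuous_itv_int => x _; apply: cvgM; exact: zeta_continuous. Qed.

(** Beyond [x1] the bound [tau >= K] is a damping: [(zeta^2)' <= g^2 / K - K zeta^2], which is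
    integrated from [x1]. *)
Lemma zeta_right X : x1 <= X -> \int[mu]_(x in `[x1, X]) zeta x ^+ 2 <= K^-1 ^+ 2 * D.
Proof.
move=> xX.
have pos x : x1 <= x <= X -> 0 < x by move=> /andP[ax _]; exact: lt_le_trans ax.
have du x : x1 <= x <= X -> der (fun x => zeta x ^+ 2) x (2 * zeta x * (g x - tau x * zeta x)).
  by move=> /pos x0; exact: der_sqr (der_zeta x0).
have cu x : x1 <= x <= X -> {for x, continuous (fun x => 2 * zeta x * (g x - tau x * zeta x))}.
  move=> /pos x0; apply: cvgM; first by apply: cvgMr; exact: zeta_continuous.
  apply: cvgB; first exact: g_continuous.
  by apply: cvgM; [exact: (der_continuous (der_tau x0))|exact: zeta_continuous].
have ig : mu.-integrable `[x1, X] (EFin \o (fun x => g x ^+ 2)).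
  by apply: continuous_itv_int => x /pos x0; apply: cvgM; exact: g_continuous.
have h : 0 <= \int[mu]_(x in `[x1, X]) (K^-1 * g x ^+ 2 - K * zeta x ^+ 2).
  apply: (@le_trans _ _ (\int[mu]_(x in `[x1, X]) (2 * zeta x * (g x - tau x * zeta x)))).
    by rewrite (FTC2 xX cu du) zeta_x1 expr0n subr0 sqr_ge0.
  apply: le_Rintegral => //.
  - exact: continuous_itv_int.
  - apply: continuous_itv_int => x /pos x0; apply: cvgB; apply: cvgMr; apply: cvgM;
    by [exact: g_continuous|exact: zeta_continuous].
  - move=> x /=; rewrite in_itv /= => xx; have [x1x _] := andP xx.
    have tx := tau_ge x1x; rewrite -/(tau x) in tx.
    have h1 : 0 <= (tau x - K) * zeta x ^+ 2 by rewrite mulr_ge0 ?sqr_ge0// subr_ge0.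
    have h2 : 0 <= K^-1 * (g x - K * zeta x) ^+ 2 by rewrite mulr_ge0 ?sqr_ge0// invr_ge0 ltW.
    have h3 : K^-1 * (g x - K * zeta x) ^+ 2 = K^-1 * g x ^+ 2 - 2 * g x * zeta x + K * zeta x ^+ 2.
      by field; rewrite gt_eqF.
    by move: h1 h2 h3; lra.
move: h; rewrite RintegralB//; last 2 first.
- exact: (integrableZl _ K^-1 ig).
- exact: (integrableZl _ K (zeta_int x1 X)).
rewrite !RintegralZl//; last exact: zeta_int.
have := half_form_ge x10 xX.
set I1 := \int[mu]_(x in _) g x ^+ 2; set I2 := \int[mu]_(x in _) zeta x ^+ 2 => h1 h2.
rewrite exprVn ler_pdivlMl ?exprn_gt0// expr2 -mulrA -ler_pdivlMl//.
apply: (@le_trans _ _ (K^-1 * I1)); first by rewrite -subr_ge0.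
by rewrite ler_pM2l// invr_gt0.
Qed.

(** Going back from [x1] only needs [tau <= t], which survives at the singular point [0]: with
    [M = 1 + 2 t], [(zeta^2 e^(M x))' >= - g^2 e^(M x)], since [(zeta^2)' + M zeta^2 + g^2 = (g +
    zeta)^2 + 2 (t - tau) zeta^2]. *)
Lemma zeta_left e : 0 < e -> e <= x1 ->
  \int[mu]_(x in `[e, x1]) zeta x ^+ 2 <= x1 * expR ((1 + 2 * t) * x1) * D.
Proof.
move=> e0 ex1; set M := 1 + 2 * t.
have M0 : 0 <= M by rewrite /M addr_ge0// mulr_ge0.
have h x : e <= x <= x1 -> zeta x ^+ 2 <= expR (M * x1) * D.
  move=> /andP[ex xx1]; have x0 := lt_le_trans e0 ex.
  have pos y : x <= y <= x1 -> 0 < y by move=> /andP[xy _]; exact: lt_le_trans xy.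
  pose m y := (2 * zeta y * (g y - tau y * zeta y) + M * zeta y ^+ 2) * expR (M * y).
  have du y : x <= y <= x1 -> der (fun y => zeta y ^+ 2 * expR (M * y)) y (m y).
    move=> /pos y0; apply: (derE (derM (der_sqr (der_zeta y0)) (der_exp (derZ M (der_id y))))).
    by rewrite /m; ring.
  have cexp y : {for y, continuous (fun y => expR (M * y))}.
    exact: (der_continuous (der_exp (derZ M (der_id y)))).
  have cm y : x <= y <= x1 -> {for y, continuous m}.
    move=> /pos y0; apply: cvgM; last exact: cexp.
    apply: cvgD; last by apply: cvgMr; apply: cvgM; exact: zeta_continuous.
    apply: cvgM; first by apply: cvgMr; exact: zeta_continuous.
    apply: cvgB; first exact: g_continuous.
    by apply: cvgM; [exact: (der_continuous (der_tau y0))|exact: zeta_continuous].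
  have ig : mu.-integrable `[x, x1] (EFin \o (fun x => g x ^+ 2)).
    by apply: continuous_itv_int => y /pos y0; apply: cvgM; exact: g_continuous.
  have : \int[mu]_(y in `[x, x1]) (- expR (M * x1) * g y ^+ 2) <= \int[mu]_(y in `[x, x1]) m y.
    apply: le_Rintegral => //.
    - exact: (integrableZl _ (- expR (M * x1)) ig).
    - exact: continuous_itv_int.
    - move=> y /=; rewrite in_itv /= => yx; have y0 := pos _ yx; have [xy yx1] := andP yx.
      have ty := tau_le y0; rewrite -/(tau y) in ty.
      apply: (@le_trans _ _ (- g y ^+ 2 * expR (M * y))).
        rewrite mulNr mulNr lerN2 mulrC; apply: ler_wpM2r; first exact: sqr_ge0.
        by rewrite ler_expR ler_wpM2l.
      rewrite /m; apply: ler_wpM2r; first exact: expR_ge0.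
      have h1 : 0 <= (t - tau y) * zeta y ^+ 2 by rewrite mulr_ge0 ?sqr_ge0// subr_ge0.
      have h2 : 0 <= (g y + zeta y) ^+ 2 by exact: sqr_ge0.
      by rewrite /M; move: h1 h2; nra.
  rewrite (FTC2 xx1 cm du) zeta_x1 expr0n mul0r sub0r RintegralZl// mulNr lerN2.
  move=> h1; apply: (@le_trans _ _ (zeta x ^+ 2 * expR (M * x))).
    rewrite ler_peMr ?sqr_ge0// -expR0 ler_expR mulr_ge0//; exact: ltW.
  apply: (le_trans h1); apply: ler_wpM2l; first exact: expR_ge0.
  exact: half_form_ge.
apply: (@le_trans _ _ (\int[mu]_(x in `[e, x1]) (expR (M * x1) * D))).
  apply: le_Rintegral => //; first exact: zeta_int.
    by apply: continuous_itv_int => x _; exact: cvg_cst.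
rewrite Rintegral_itv_cst// mulrC -mulrA; apply: ler_wpM2r.
  by rewrite mulr_ge0 ?expR_ge0// half_form_ge0.
by rewrite gerBl; exact: ltW.
Qed.

Lemma half_poincare : \int[mu]_(x in `[0, +oo[) zeta x ^+ 2
  <= (x1 * expR ((1 + 2 * t) * x1) + K^-1 ^+ 2) * D.
Proof.
have Lzeta : L2r zeta by apply: L2rB => //; exact: L2rZ.
have iz : mu.-integrable setT (EFin \o (fun x => zeta x ^+ 2)).
  by have := L2r_mul_int Lzeta Lzeta.
have e0 (n : nat) : 0 < n.+1%:R^-1 :> R by rewrite invr_gt0 ltr0n.
apply: (ler_cvg_to (half_cvg iz e0 cvg_inv_nat cvg_natr) (cvg_cst _)); near=> n.
have ena : n.+1%:R^-1 <= x1.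
  near: n; have ci := @cvg_inv_nat R; move/cvgr_lt: ci => /(_ x1 x10); apply: filterS => n; exact: ltW.
have bX : x1 <= n%:R by near: n; exact: nbhs_infty_ger.
rewrite (Rintegral_itv_cat ena bX (zeta_int _ _)) mulrDl; apply: lerD.
- exact: zeta_left.
- exact: zeta_right.
Unshelve. all: by end_near. Qed.

End one_function.

End half_line.

(** * The Poincare inequality on the whole line *)

Section line_poincare.
Context {R : realType}.
Local Notation mu := (@lebesgue_measure R).
Implicit Types (f g z : R -> R) (x y a b : R).

Local Notation chi := (\1_(`[0%R, +oo[%classic : set R) : R -> R).

Lemma half_ip f g : \int[mu]_(x in `[0, +oo[) (f x * g x) = ip (fun x => chi x * f x) g.
Proof.
rewrite ipE Rintegral_mkcond; apply: eq_Rintegral => x _.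
by rewrite patchE indicE; case: ifPn => _; rewrite /= ?mul1r ?mul0r.
Qed.

Lemma half_nsq f : \int[mu]_(x in `[0, +oo[) f x ^+ 2 = nsq (fun x => chi x * f x).
Proof.
rewrite nsqE ipE Rintegral_mkcond; apply: eq_Rintegral => x _.
by rewrite patchE indicE /=; case: ifPn => _; rewrite /= ?mul1r ?expr2 ?mul0r.
Qed.

Lemma L2r_half f : L2r f -> L2r (fun x => chi x * f x).
Proof.
move=> Lf; apply: (L2rM (M := 1)) => // x.
by rewrite indicE; case: (_ \in _); rewrite ?normr1 ?normr0.
Qed.

Lemma half_CS f g : L2r f -> L2r g ->
  (\int[mu]_(x in `[0, +oo[) (f x * g x)) ^+ 2 <= (\int[mu]_(x in `[0, +oo[) f x ^+ 2) * nsq g.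
Proof. by move=> Lf Lg; rewrite half_ip half_nsq; apply: CS => //; exact: L2r_half. Qed.

Lemma half_nsq_le f : L2r f -> \int[mu]_(x in `[0, +oo[) f x ^+ 2 <= nsq f.
Proof.
move=> Lf; rewrite nsqE ipE.
under [leRHS]eq_Rintegral do rewrite -expr2.
by apply: Rintegral_subset => // [|x]; [exact: L2r_mul_int|exact: sqr_ge0].
Qed.

Variables (c k : R) (phi phi1 phi2 : R -> R).
Hypotheses (k0 : 0 < 2 * k) (ck : 2 * k < c) (P : dp_profile c k phi phi1 phi2).
Local Notation ga := (gam c k).
Local Notation p := (dp_p c phi phi1).
Local Notation F := (dp_F c k phi).
Local Notation s := (dp_s c k phi).

(** Eliminating [Z] between [L Z = 0] and [z'' = 4 z - Z], where [z = G 2 Z], leaves [z'' = V z]. *)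
Definition dp_V x := 4 - ga / (c - phi x).
Local Notation V := dp_V.

Lemma der_F_V x : der F x (V x * p x).
Proof.
apply: (derE (der_F P x)); rewrite /V /dp_p /gam.
by field; exact: r_neq0 P x.
Qed.

Lemma V_continuous : continuous V.
Proof. by move=> x; apply: cvgB; [exact: cvg_cst|apply: cvgMr; exact: inv_r_continuous P x]. Qed.

Lemma V_le x : `|V x| <= 4 + ga / (c - phi 0).
Proof.
have g0 := gam_gt0 k0 ck; rewrite (le_trans (ler_normB _ _))// ger0_norm// lerD2l.
by rewrite normrM gtr0_norm// ler_wpM2l ?(ltW g0)// (inv_r_le P).
Qed.

Lemma phi1_odd x : phi1 (- x) = - phi1 x.
Proof.
have h := @der_comp _ phi -%R x _ _ (prof_der P (- x)) (derN (der_id x)).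
have := der_unique (eq_der (prof_even P) h) (prof_der P x).
by move=> <-; rewrite mulrN1 opprK.
Qed.

Lemma p_odd x : p (- x) = - p x.
Proof. by rewrite /dp_p (prof_even P) phi1_odd mulrN. Qed.

Lemma p_eq0 : p 0 = 0.
Proof. by have := p_odd 0; rewrite oppr0 => h; lra. Qed.

Lemma p_lt0 x : 0 < x -> p x < 0.
Proof. by move=> x0; rewrite pmulr_rlt0 ?(r_gt0 P)//; exact: prof_decr P _ x0. Qed.

Lemma energy_p x : p x ^+ 2 =
  phi x ^+ 2 * (phi x ^+ 2 - 2 * (c - 2 / 3 * k) * phi x + c * (c - 2 * k)).
Proof. exact: prof_energy P x. Qed.

(** At the crest [p = 0], so the second factor of the energy identity vanishes, which is
    incompatible with [phi 0 <= (c - 2 k) / 2]; hence [F 0 < 0]. *)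
Lemma F_0_neq0 : F 0 != 0.
Proof.
have := energy_p 0; rewrite p_eq0 expr0n /= => /esym/eqP.
have f0 := prof_gt0 P 0; have fc := prof_ltc P; have k0' := k0; have ck' := ck.
rewrite mulf_eq0 sqrf_eq0 gt_eqF//= => /eqP Q.
have -> : F 0 = phi 0 * ((c - 2 * k) - 2 * phi 0) by rewrite /dp_F; ring.
apply: mulf_neq0; first by rewrite gt_eqF.
by rewrite lt_eqF//; nra.
Qed.

(** Clear where [F <= 0]. Elsewhere [F <= - 2 p] by comparison of squares, [p^2] being given by the
    energy identity. *)
Lemma tau_le2 x : 0 < x -> - F x / p x <= 2.
Proof.
move=> x0; have px := p_lt0 x0; have k0' := k0; have ck' := ck.
rewrite ler_ndivrMr// mulrC.
have f0 := prof_gt0 P x; have fc := phi_ltc P x.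
have [h|h] := leP ((c - 2 * k) / 2) (phi x).
  have F1 : F x <= 0 by rewrite /dp_F; nra.
  lra.
have F1 : 0 <= F x by rewrite /dp_F; nra.
suff : F x <= 2 * - p x by lra.
rewrite -ler_sqr ?nnegrE//; last by rewrite mulr_ge0// oppr_ge0 ltW.
rewrite exprMn sqrrN energy_p.
have -> : F x = phi x * ((c - 2 * k) - 2 * phi x) by rewrite /dp_F; ring.
rewrite [(phi x * _) ^+ 2]exprMn [leRHS]mulrCA; apply: ler_wpM2l; first exact: sqr_ge0.
have h1 : 0 <= ((c - 2 * k) / 2 - phi x) * (c + 2 / 3 * k) by rewrite mulr_ge0; lra.
nra.
Qed.

(** Once [phi <= (c - 2 k) / 4], [F] is at least [(c - 2 k) / 2 * phi], while the energy identity
    gives [|p| <= c phi]. *)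
Lemma tau_ge_far : exists2 x1, 0 < x1 &
  forall x, x1 <= x -> (c - 2 * k) / (2 * c) <= - F x / p x.
Proof.
have k0' := k0; have ck' := ck; have c0 := c_gt0 k0 ck.
have d40 : 0 < (c - 2 * k) / 4 by lra.
have := expdec_cvg0 (expdec_phi P); move/cvgr_lt => /(_ _ d40) [N _ hN].
pose x1 : R := N.+1%:R.
have x10 : 0 < x1 by rewrite ltr0n.
exists x1 => // x xx; have x0 : 0 < x by exact: lt_le_trans xx.
have px := p_lt0 x0; have f0 := prof_gt0 P x; have fc := phi_ltc P x.
have fd : phi x <= (c - 2 * k) / 4.
  apply: (@le_trans _ _ (phi x1)); last by apply/ltW/hN; exact: leqnSn.
  rewrite -lerN2; apply: (@nondecreasing_der _ (fun x => - phi x) (fun x => - phi1 x)) => // y /andP[y1 y2].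
    exact: derN (prof_der P y).
  by rewrite oppr_ge0 ltW// (prof_decr P)//; exact: lt_le_trans y1.
rewrite ler_ndivlMr//.
have F1 : 0 <= F x by rewrite /dp_F; nra.
suff : (c - 2 * k) / (2 * c) * - p x <= F x by lra.
rewrite -ler_sqr ?nnegrE//; last first.
  by rewrite mulr_ge0// ?oppr_ge0 ?(ltW px)// divr_ge0//; lra.
rewrite exprMn sqrrN energy_p.
have -> : F x = phi x * ((c - 2 * k) - 2 * phi x) by rewrite /dp_F; ring.
rewrite [(phi x * _) ^+ 2]exprMn [leLHS]mulrCA; apply: ler_wpM2l; first exact: sqr_ge0.
apply: (@le_trans _ _ (((c - 2 * k) / (2 * c)) ^+ 2 * (c * c))).
  apply: ler_wpM2l; first exact: sqr_ge0.
  nra.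
have -> : ((c - 2 * k) / (2 * c)) ^+ 2 * (c * c) = ((c - 2 * k) / 2) ^+ 2.
  by field; rewrite gt_eqF.
rewrite ler_sqr ?nnegrE; lra.
Qed.

(* This pins down the common part of the two coefficients obtained on the half-lines. *)
Lemma half_s_phi1 : exists2 M0, 0 < M0 & \int[mu]_(x in `[0, +oo[) (s x * phi1 x) = - M0.
Proof.
have g0 := gam_gt0 k0 ck; have gn0 : ga != 0 by rewrite gt_eqF.
pose M x := (phi x ^+ 3 + 2 * k * phi x ^+ 2) / (2 * ga).
have dM x : der M x (s x * phi1 x).
  apply: (@eq_der _ (fun x => (2 * ga)^-1 * (phi x * phi x ^+ 2 + 2 * k * phi x ^+ 2))) => [y|].
    by rewrite /M -exprS mulrC.
  apply: (derE (derZ _ (derD (derM (prof_der P x) (der_sqr (prof_der P x))) (derZ (2 * k) (der_sqr (prof_der P x)))))).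
  by rewrite /dp_s; field.
exists (M 0).
  have p0 := prof_gt0 P 0.
  by rewrite divr_gt0 ?addr_gt0 ?mulr_gt0 ?exprn_gt0//; move: k0; lra.
apply: half_der => //.
- by move=> x; apply: cvgM; [exact: s_continuous k0 ck P x|exact: phi1_continuous P x].
- exact: L2r_mul_int (L2r_s k0 ck P) (L2r_phi1 k0 ck P).
- have -> : (0 : R) = 0 * 0 by rewrite mulr0.
  have -> : (fun n => M n%:R) = (fun n => phi n%:R * (phi n%:R * (phi n%:R + 2 * k) / (2 * ga))).
    by apply/funext => n; rewrite /M; ring.
  have cp := expdec_cvg0 (expdec_phi P).
  apply: cvgM => //.
  have -> : (0 : R) = 0 * (0 + 2 * k) / (2 * ga) by rewrite !mul0r.
  apply: cvgM; last exact: cvg_cst.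
  by apply: cvgM => //; apply: cvgD => //; exact: cvg_cst.
Qed.

Lemma half_sD (f g : R -> R) b : L2r f -> L2r g ->
  \int[mu]_(x in `[0, +oo[) (f x + b * g x) ^+ 2
  <= 2 * (\int[mu]_(x in `[0, +oo[) f x ^+ 2) + 2 * b ^+ 2 * nsq g.
Proof.
move=> Lf Lg; have h := half_nsq_le Lg; rewrite !half_nsq in h *.
have -> : (fun x => chi x * (f x + b * g x)) = (fun x => chi x * f x + b * (chi x * g x)).
  by apply/funext => x; ring.
have Lcf := L2r_half Lf; have Lcg := L2r_half Lg.
apply: (le_trans (nsqD_le Lcf (L2rZ b Lcg))); rewrite nsqZ// mulrDr lerD2l mulrA.
by apply: ler_wpM2l => //; rewrite mulr_ge0// sqr_ge0.
Qed.

(** The half-lines give unrelated multiples of [p]: [hp] for [z] and [hm] for its reflection. As [p]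
    is odd, [h = (hp - hm) / 2] fits both sides as well as possible, and the mismatch [H = hp + hm]
    is the amount of [|p|] in [z]. The pairing with [s / (c - phi)] detects [H]. *)
Lemma poincare : exists2 C, 0 <= C & forall z z1,
  (forall x, der z x (z1 x)) -> continuous z1 -> z 0 = 0 -> L2r z -> L2r z1 ->
  0 <= nsq z1 + ip (fun x => V x * z x) z /\
  exists h, nsq (fun x => z x - h * p x)
    <= C * (nsq z1 + ip (fun x => V x * z x) z + ip z (fun x => s x / (c - phi x)) ^+ 2).
Proof.
have k0' := k0; have ck' := ck; have c0 := c_gt0 k0 ck.
have [x1 x10 tge] := tau_ge_far; have [M0 M00 hM0] := half_s_phi1.
pose K := (c - 2 * k) / (2 * c).
have K0 : 0 < K by rewrite divr_gt0//; lra.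
have Lp := L2r_p k0 ck P.
have t0 : 0 <= 2 :> R by [].
pose C1 := x1 * expR ((1 + 2 * 2) * x1) + K^-1 ^+ 2.
have C10 : 0 <= C1 by rewrite addr_ge0 ?sqr_ge0// mulr_ge0 ?expR_ge0// ltW.
have half1 := half_poincare (der_p P) der_F_V V_continuous V_le p_eq0 F_0_neq0 p_lt0 Lp K0 x10 t0 tau_le2 tge.
have half0 := half_form_ge0 (der_p P) der_F_V V_continuous V_le p_eq0 F_0_neq0 p_lt0 x10 t0 tau_le2.
pose sr x := s x / (c - phi x).
have Lsr : L2r sr.
  have -> : sr = (fun x => (c - phi x)^-1 * s x) by apply/funext => x; rewrite /sr mulrC.
  apply: (L2rM _ (inv_r_le P)); last exact: L2r_s k0 ck P.
  exact: continuous_meas (inv_r_continuous P).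
pose C := 4 * C1 + 3 * (nsq p / M0 ^+ 2) * (1 + C1 * nsq sr).
have nM : 0 <= nsq p / M0 ^+ 2 by rewrite divr_ge0 ?nsq_ge0// sqr_ge0.
have C0 : 0 <= C.
  have := nsq_ge0 sr => ns; apply: addr_ge0; first exact: mulr_ge0.
  apply: mulr_ge0; first exact: mulr_ge0.
  by apply: addr_ge0 => //; exact: mulr_ge0.
exists C => // z z1 dz cz1 z0 Lz Lz1.
pose zm x := z (- x); pose zm1 x := - z1 (- x).
have dzm x : der zm x (zm1 x).
  by apply: (derE (@der_comp _ z -%R x _ _ (dz _) (derN (der_id x)))); rewrite mulrN1.
have czm1 : continuous zm1.
  by move=> x; apply: cvgN; apply: (@continuous_comp _ _ _ -%R z1); [exact: opp_continuous|exact: cz1].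
have zm0 : zm 0 = 0 by rewrite /zm oppr0.
have Lzm : L2r zm by exact: L2r_oppr.
have Lzm1 : L2r zm1 by apply: L2rN; exact: L2r_oppr.
have cz := der_continuousT dz.
have LVz : L2r (fun x => V x * z x) by apply: (L2rM _ V_le) => //; exact: continuous_meas V_continuous.
pose E x := z1 x ^+ 2 + V x * z x ^+ 2.
have EE x : E x = z1 x * z1 x + V x * z x * z x by rewrite /E !expr2 mulrA.
have iE : mu.-integrable setT (EFin \o E).
  have := integrableD measurableT (L2r_mul_int Lz1 Lz1) (L2r_mul_int LVz Lz).
  by have -> : E = (fun x => z1 x * z1 x + V x * z x * z x) by apply/funext => x; exact: EE.
have Veven x : V (- x) = V x by rewrite /V (prof_even P).
pose Dp := \int[mu]_(x in `[0, +oo[) (z1 x ^+ 2 + V x * z x ^+ 2).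
pose Dm := \int[mu]_(x in `[0, +oo[) (zm1 x ^+ 2 + V x * zm x ^+ 2).
have DD : nsq z1 + ip (fun x => V x * z x) z = Dp + Dm.
  rewrite nsqE !ipE -RintegralD//; [|exact: L2r_mul_int|exact: L2r_mul_int].
  under eq_Rintegral do rewrite -EE.
  rewrite half_split//; congr (_ + _); apply: eq_Rintegral => x _.
  by rewrite /E Veven /zm1 sqrrN.
have Dp0 : 0 <= Dp by exact: half0 dz cz1 z0 Lz Lz1.
have Dm0 : 0 <= Dm by exact: half0 dzm czm1 zm0 Lzm Lzm1.
rewrite DD; split; first exact: addr_ge0.
have := half1 _ _ dz cz1 z0 Lz Lz1; have := half1 _ _ dzm czm1 zm0 Lzm Lzm1.
rewrite -/Dp -/Dm -/C1.
set hp := z x1 / p x1; set hm := zm x1 / p x1 => Hm Hp.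
pose zp x := z x - hp * p x; pose zn x := zm x - hm * p x.
have Lzp : L2r zp by apply: L2rB => //; exact: L2rZ.
have Lzn : L2r zn by apply: L2rB => //; exact: L2rZ.
have HmE : \int[mu]_(x in `[0, +oo[) zn x ^+ 2 <= C1 * Dm by exact: Hm.
have HpE : \int[mu]_(x in `[0, +oo[) zp x ^+ 2 <= C1 * Dp by exact: Hp.
pose h := (hp - hm) / 2; pose H := hp + hm.
exists h.
have Lzh : L2r (fun x => z x - h * p x) by apply: L2rB => //; exact: L2rZ.
have hH : nsq (fun x => z x - h * p x) <= 2 * C1 * (Dp + Dm) + H ^+ 2 * nsq p.
  rewrite nsqE ipE half_split; last exact: L2r_mul_int.
  have -> : \int[mu]_(x in `[0, +oo[) ((z x - h * p x) * (z x - h * p x)) =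
      \int[mu]_(x in `[0, +oo[) (zp x + H / 2 * p x) ^+ 2.
    by apply: eq_Rintegral => x _; rewrite /zp /h /H; field.
  have -> : \int[mu]_(x in `[0, +oo[) ((z (- x) - h * p (- x)) * (z (- x) - h * p (- x))) =
      \int[mu]_(x in `[0, +oo[) (zn x + H / 2 * p x) ^+ 2.
    by apply: eq_Rintegral => x _; rewrite /zn /h /H /zm p_odd; field.
  have e1 := half_sD (H / 2) Lzp Lp; have e2 := half_sD (H / 2) Lzn Lp.
  apply: (le_trans (lerD e1 e2)).
  have -> : 2 * C1 * (Dp + Dm) + H ^+ 2 * nsq p
    = (2 * (C1 * Dp) + 2 * (H / 2) ^+ 2 * nsq p) + (2 * (C1 * Dm) + 2 * (H / 2) ^+ 2 * nsq p) by field.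
  by apply: lerD; rewrite lerD2r ler_wpM2l.
set m := ip z (fun x => s x / (c - phi x)).
(* [s] is even and [p / (c - phi) = phi'], so each half-line contributes [- M0] times its own
   coefficient of [p]. *)
have half_m : m = \int[mu]_(x in `[0, +oo[) (zp x * sr x) + \int[mu]_(x in `[0, +oo[) (zn x * sr x) - H * M0.
  have Lsp := L2r_mul_int Lp Lsr.
  have iS f g : L2r f -> L2r g -> mu.-integrable `[0, +oo[ (EFin \o (fun x => f x * g x)).
    by move=> Lf Lg; apply: integrableS (L2r_mul_int Lf Lg).
  have e f b : L2r f -> \int[mu]_(x in `[0, +oo[) ((f x - b * p x) * sr x)
      = \int[mu]_(x in `[0, +oo[) (f x * sr x) + b * M0.
    move=> Lf.
    have -> : b * M0 = - b * \int[mu]_(x in `[0, +oo[) (p x * sr x).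
      rewrite mulNr -mulrN; congr (_ * _).
      rewrite -[LHS]opprK -hM0; congr (- _); apply: eq_Rintegral => x _.
      by rewrite /sr /dp_p; field; exact: r_neq0 P x.
    rewrite -RintegralZl//; last exact: iS.
    rewrite -RintegralD//; [|exact: iS|exact: (integrableZl _ (- b) (iS _ _ Lp Lsr))].
    by apply: eq_Rintegral => x _; ring.
  rewrite !e// /m ipE half_split; last exact: L2r_mul_int.
  have -> : \int[mu]_(x in `[0, +oo[) (z (- x) * (s (- x) / (c - phi (- x)))) =
     \int[mu]_(x in `[0, +oo[) (zm x * sr x).
    by apply: eq_Rintegral => x _; rewrite /zm /sr /dp_s (prof_even P).
  by rewrite /H /sr; ring.
have c1 := half_CS Lzp Lsr; have c2 := half_CS Lzn Lsr.
move: half_m c1 c2.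
set I1 := \int[mu]_(x in _) (zp x * sr x); set I2 := \int[mu]_(x in _) (zn x * sr x) => mE c1 c2.
have c1' : I1 ^+ 2 <= C1 * Dp * nsq sr.
  by apply: (le_trans c1); apply: ler_wpM2r => //; exact: nsq_ge0.
have c2' : I2 ^+ 2 <= C1 * Dm * nsq sr.
  by apply: (le_trans c2); apply: ler_wpM2r => //; exact: nsq_ge0.
have HM : (H * M0) ^+ 2 <= 3 * (m ^+ 2 + C1 * nsq sr * (Dp + Dm)).
  have -> : H * M0 = I1 + I2 - m by rewrite mE; ring.
  have q1 := sqr_ge0 (I1 - I2); have q2 := sqr_ge0 (I1 + m); have q3 := sqr_ge0 (I2 + m).
  have : (I1 + I2 - m) ^+ 2 <= 3 * (I1 ^+ 2 + I2 ^+ 2 + m ^+ 2) by nra.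
  move=> /le_trans; apply; rewrite ler_pM2l//; move: c1' c2'; clear; lra.
have HM' : H ^+ 2 <= 3 / M0 ^+ 2 * (m ^+ 2 + C1 * nsq sr * (Dp + Dm)).
  by rewrite mulrAC ler_pdivlMr ?exprn_gt0// -exprMn.
apply: (le_trans hH).
set D := Dp + Dm; have D0 : 0 <= D by exact: addr_ge0.
have np := nsq_ge0 p; have ns := nsq_ge0 sr; have m2 := sqr_ge0 m.
apply: (@le_trans _ _ (2 * C1 * D + 3 / M0 ^+ 2 * (m ^+ 2 + C1 * nsq sr * D) * nsq p)).
  by rewrite lerD2l ler_wpM2r.
rewrite /C; have q1 : 0 <= C1 * D by exact: mulr_ge0.
set W := nsq p / M0 ^+ 2 in nM *.
have -> : 3 / M0 ^+ 2 * (m ^+ 2 + C1 * nsq sr * D) * nsq p = 3 * W * (m ^+ 2 + C1 * nsq sr * D).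
  by rewrite /W; ring.
have q2 : 0 <= C1 * m ^+ 2 by exact: mulr_ge0.
have q3 : 0 <= W * D by exact: mulr_ge0.
have q4 : 0 <= W * (C1 * nsq sr * m ^+ 2) by apply: mulr_ge0 => //; apply: mulr_ge0 => //; exact: mulr_ge0.
rewrite -subr_ge0.
have -> : (4 * C1 + 3 * W * (1 + C1 * nsq sr)) * (D + m ^+ 2)
   - (2 * C1 * D + 3 * W * (m ^+ 2 + C1 * nsq sr * D))
  = 2 * (C1 * D) + 4 * (C1 * m ^+ 2) + 3 * (W * D) + 3 * (W * (C1 * nsq sr * m ^+ 2)) by ring.
by apply: addr_ge0; [apply: addr_ge0; [apply: addr_ge0|]|]; exact: mulr_ge0.
Qed.

End line_poincare.

(** * Coercivity *)

Section coercivity.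
Context {R : realType}.
Local Notation mu := (@lebesgue_measure R).
Implicit Types (f g v : R -> R) (x y a b : R).

Lemma continuous_ae_eq f g : continuous f -> continuous g -> f = g %[ae mu] -> f =1 g.
Proof.
move=> cf cg [A [mA A0 sA]] x; apply: contrapT => fgx.
have ch : {for x, continuous (fun y => f y - g y)} by apply: cvgB; [exact: cf|exact: cg].
have hx : 0 < `|f x - g x| by rewrite normr_gt0 subr_eq0; apply/eqP.
have : \forall y \near x, f y - g y != 0 by apply: cvgr_neq0 ch _; rewrite -normr_gt0.
move=> /nbhs_ballP[e /= e0 he].
have sub : `]x - e, x + e[ `<=` A.
  move=> y /=; rewrite in_itv /= => /andP[y1 y2]; apply: sA => /= H.
  have yb : ball x e y by rewrite /ball /= ltr_distlC y1 y2.
  by have := he y yb; rewrite H// subrr eqxx.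
have : (mu `](x - e)%R, (x + e)%R[ <= mu A)%E by apply: le_measure; rewrite ?inE//; exact: measurable_itv.
rewrite A0 lebesgue_measure_itv/= lte_fin ifT; last by lra.
by rewrite -EFinB lee_fin; lra.
Qed.

Lemma nsq_add3 f g h : L2r f -> L2r g -> L2r h ->
  nsq (fun x => f x + g x + h x) <= 4 * nsq f + 4 * nsq g + 2 * nsq h.
Proof.
move=> Lf Lg Lh; apply: (le_trans (nsqD_le (L2rD Lf Lg) Lh)).
by have := nsqD_le Lf Lg; move: (nsq _) => a; lra.
Qed.

Variables (c k : R) (phi phi1 phi2 : R -> R).
Hypotheses (k0 : 0 < 2 * k) (ck : 2 * k < c) (P : dp_profile c k phi phi1 phi2).
Local Notation ga := (gam c k).
Local Notation p := (dp_p c phi phi1).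
Local Notation s := (dp_s c k phi).
Local Notation V := (dp_V c k phi).

Definition dp_L v x := (c - phi x) * v x - ga * G 2 v x.
Local Notation L := dp_L.

Lemma L2r_mulr v : L2r v -> L2r (fun x => (c - phi x) * v x).
Proof. by apply: (L2rM (continuous_meas (r_continuous P)) (norm_r_le P)). Qed.

Lemma L2r_mulVr v : L2r v -> L2r (fun x => (c - phi x)^-1 * v x).
Proof. by apply: (L2rM (continuous_meas (inv_r_continuous P)) (inv_r_le P)). Qed.

Lemma nsq_mulVr v : L2r v -> nsq (fun x => (c - phi x)^-1 * v x) <= (c - phi 0)^-1 ^+ 2 * nsq v.
Proof. by apply: (nsqM (continuous_meas (inv_r_continuous P)) (inv_r_le P)). Qed.

Lemma L2r_L v : L2r v -> L2r (L v).
Proof. by move=> Lv; apply: L2rB; [exact: L2r_mulr|apply: L2rZ; exact: G_L2r]. Qed.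

Lemma LD v w : L2r v -> L2r w -> L (fun x => v x + w x) = (fun x => L v x + L w x).
Proof. by move=> Lv Lw; apply/funext => x; rewrite /L GD//; ring. Qed.

Lemma LB v w : L2r v -> L2r w -> L (fun x => v x - w x) = (fun x => L v x - L w x).
Proof. by move=> Lv Lw; apply/funext => x; rewrite /L GB//; ring. Qed.

Lemma LZ b v : L2r v -> L (fun x => b * v x) = (fun x => b * L v x).
Proof. by move=> Lv; apply/funext => x; rewrite /L GZ//; ring. Qed.

Lemma L_sym v w : L2r v -> L2r w -> ip (L v) w = ip v (L w).
Proof.
move=> Lv Lw; have h2 : 0 < 2 :> R by [].
have Lrv := L2r_mulr Lv; have Lrw := L2r_mulr Lw.
have LGv := G_L2r h2 Lv; have LGw := G_L2r h2 Lw.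
rewrite /L ipBl//; [|exact: L2rZ]; rewrite ipBr//; [|exact: L2rZ].
by rewrite ipZl// ipZr// ipMA G_sym.
Qed.

Lemma L_phi1 : L phi1 = (fun=> 0) %[ae mu].
Proof.
have gn0 : ga != 0 by rewrite gt_eqF// gam_gt0.
by apply: ae1 (G2_phi1 k0 ck P) => x h; rewrite /L h mulrA mulfV// mul1r /dp_p subrr.
Qed.

(* Both terms are nonnegative when [G 2 Z] vanishes at [0]. *)
Lemma L_form Z : L2r Z -> ip (L Z) Z = ip (L Z) (fun x => (c - phi x)^-1 * L Z x)
  + ga * (nsq (Gd 2 Z) + ip (fun x => V x * G 2 Z x) (G 2 Z)).
Proof.
move=> LZ'; have h2 : 0 < 2 :> R by [].
set z := G 2 Z; have Lz : L2r z by exact: G_L2r.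
have La := L2r_L LZ'; set a := L Z in La *.
have La' := L2r_mulVr La; have Lz' := L2r_mulVr Lz.
(* Solving [a = (c - phi) Z - gam z] for [Z] expresses all pairings through [a] and [z]. *)
have ZE : Z = (fun x => (c - phi x)^-1 * a x + ga * ((c - phi x)^-1 * z x)).
  by apply/funext => x; rewrite /a /L -/z; field; exact: r_neq0 P x.
have i1 : ip a Z = ip a (fun x => (c - phi x)^-1 * a x) + ga * ip a (fun x => (c - phi x)^-1 * z x).
  rewrite [in LHS]ZE ipDr//; last exact: L2rZ.
  by rewrite ipZr.
have i2 : ip Z z = ip (fun x => (c - phi x)^-1 * a x) z + ga * ip (fun x => (c - phi x)^-1 * z x) z.
  rewrite {1}ZE ipDl//; last exact: L2rZ.
  by rewrite ipZl.
have i3 : ip (fun x => V x * z x) z = 4 * nsq z - ga * ip (fun x => (c - phi x)^-1 * z x) z.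
  have -> : (fun x => V x * z x) = (fun x => 4 * z x - ga * ((c - phi x)^-1 * z x)).
    by apply/funext => x; rewrite /V; ring.
  by rewrite ipBl//; [rewrite !ipZl|exact: L2rZ|exact: L2rZ].
have i4 := ip_G h2 LZ'; rewrite -/z in i4.
have i5 : ip a (fun x => (c - phi x)^-1 * z x) = ip (fun x => (c - phi x)^-1 * a x) z by rewrite ipMA.
rewrite i1 i5 i3.
have -> : ip (fun x => (c - phi x)^-1 * a x) z = ip Z z - ga * ip (fun x => (c - phi x)^-1 * z x) z.
  by rewrite i2 addrK.
by rewrite i4; ring.
Qed.

(** [Y] has two roles: a multiple [b Y] corrects the value of [G 2 v] at [0], and since [<Y, s> < 0]
    the [b^2] term of [<L v, v>] becomes positive once [<s, Z>] is expressed through [<s, v>]. *)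
Lemma coercivity : exists A B : R, [/\ 0 <= A, 0 <= B & forall v, L2r v -> exists h,
  nsq (fun x => v x - h * phi1 x) <= A * ip (L v) v + B * ip s v ^+ 2].
Proof.
have k0' := k0; have ck' := ck; have c0 := c_gt0 k0 ck; have g0 := gam_gt0 k0 ck.
have h2 : 0 < 2 :> R by []; have gn0 : ga != 0 by rewrite gt_eqF.
have Ls := L2r_s k0 ck P.
have [yt [Y [LY YE cyt GY [yt0 Ys]]]] := exists_Y k0 ck P.
have [C1 C10 poin] := poincare k0 ck P.
have Gc f : L2r f -> continuous (G 2 f) by move=> Lf; exact: G_continuous.
have GY1 : G 2 Y =1 (fun x => ga^-1 * yt x).
  by apply: continuous_ae_eq => //; [exact: Gc|move=> x; apply: cvgMr; exact: cyt].
have y0 : G 2 Y 0 != 0 by rewrite GY1 mulf_neq0 ?invr_eq0// lt_eqF.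
have LYs : L Y = s.
  by apply/funext => x; rewrite /L GY1 YE; field; rewrite gn0 (r_neq0 P x).
pose N := - ip Y s; have N0 : 0 < N by rewrite oppr_gt0.
pose ri := (c - phi 0)^-1 ^+ 2; have ri0 : 0 <= ri by exact: sqr_ge0.
pose sr x := s x / (c - phi x).
have srE : sr = (fun x => (c - phi x)^-1 * s x) by apply/funext => x; rewrite /sr mulrC.
have Lsr : L2r sr by rewrite srE; exact: L2r_mulVr.
pose g2 := ga^-1 ^+ 2; have g20 : 0 <= g2 by exact: sqr_ge0.
pose A := 8 * nsq Y / N + 4 * ri * c
  + 2 * ga ^+ 2 * ri * C1 * (ga^-1 + 8 * g2 * N + 2 * g2 * nsq sr * c).
pose B := 4 * (2 * ga ^+ 2 * ri * C1 * g2).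
have nY := nsq_ge0 Y; have nsr := nsq_ge0 sr.
have gC0 : 0 <= 2 * ga ^+ 2 * ri * C1.
  by apply: mulr_ge0 => //; apply: mulr_ge0 => //; apply: mulr_ge0 => //; exact: sqr_ge0.
have gi0 : 0 <= ga^-1 by rewrite invr_ge0 ltW.
have e1 : 0 <= 8 * nsq Y / N by rewrite divr_ge0 ?mulr_ge0// ltW.
have e2 : 0 <= 4 * ri * c by apply: mulr_ge0; [exact: mulr_ge0|exact: ltW].
have e3 : 0 <= 8 * g2 * N by apply: mulr_ge0; [exact: mulr_ge0|exact: ltW].
have e4 : 0 <= 2 * g2 * nsq sr * c.
  by apply: mulr_ge0; [apply: mulr_ge0 => //; exact: mulr_ge0|exact: ltW].
have A0 : 0 <= A.
  apply: addr_ge0; first exact: addr_ge0.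
  by apply: mulr_ge0 => //; apply: addr_ge0 => //; exact: addr_ge0.
have B0 : 0 <= B by apply: mulr_ge0 => //; exact: mulr_ge0.
exists A, (A * (2 / N) + B); split=> //.
  by apply: addr_ge0 => //; apply: mulr_ge0 => //; apply: divr_ge0 => //; exact: ltW.
move=> v Lv; pose b := G 2 v 0 / G 2 Y 0.
pose Z x := v x - b * Y x.
have LZ' : L2r Z by apply: L2rB => //; exact: L2rZ.
pose z := G 2 Z.
have z0 : z 0 = 0 by rewrite /z GB//; [rewrite GZ// /b mulfVK// subrr|exact: L2rZ].
have Lz : L2r z by exact: G_L2r.
have Lz1 : L2r (Gd 2 Z) by exact: Gd_L2r.
have [D0 [h hP]] := poin _ _ (fun x => der_G h2 x LZ') (Gd_continuous h2 LZ') z0 Lz Lz1.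
have := L_form LZ'; rewrite -/z; move: D0 hP; rewrite -/z.
set D := nsq (Gd 2 Z) + _ => D0 hP LF.
pose a := L Z; have La : L2r a by exact: L2r_L.
have La' := L2r_mulVr La.
rewrite -/a in LF.
set si := ip s v.
have vE : v = (fun x => Z x + b * Y x) by apply/funext => x; rewrite /Z subrK.
have LvE : L v = (fun x => a x + b * s x).
  rewrite {1}vE LD//; last exact: L2rZ.
  by rewrite LZ// LYs.
have sZ : ip s Z = si + b * N.
  rewrite /si vE ipDr//; last exact: L2rZ.
  by rewrite ipZr// (ipC s Y) /N mulrN addrK.
have aY : ip a Y = ip s Z by rewrite /a L_sym// LYs ipC.
have qv : ip (L v) v = ip a Z + 2 * b * si + b ^+ 2 * N.
  rewrite LvE [X in ip _ X]vE.
  rewrite ipDl//; [|exact: L2rZ|by apply: L2rD => //; exact: L2rZ].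
  rewrite ipDr//; [|exact: L2rZ]; rewrite ipZr// ipZl//; last by apply: L2rD => //; exact: L2rZ.
  rewrite ipDr//; [|exact: L2rZ]; rewrite ipZr// aY sZ (ipC s Y).
  by rewrite -[ip Y s]opprK -/N; ring.
pose na := nsq a.
have aa : c^-1 * na <= ip a (fun x => (c - phi x)^-1 * a x).
  rewrite /na nsqE -ipZl// !ipE; apply: le_Rintegral => //.
  - by apply: L2r_mul_int => //; exact: L2rZ.
  - exact: L2r_mul_int.
  - move=> x _ /=; rewrite mulrC mulrCA [leRHS]mulrCA.
    apply: ler_wpM2r; first by rewrite -expr2 sqr_ge0.
    by rewrite lef_pV2 ?posrE// ?(r_le P)// (r_gt0 P).
have na0 : 0 <= na by exact: nsq_ge0.
(* The added term absorbs the cross term [2 b <s, v>] by completing the square and leaves half of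
   [b^2 N]. *)
pose S := ip (L v) v + 2 / N * si ^+ 2.
have SE : c^-1 * na + ga * D + b ^+ 2 * N / 2 <= S.
  have q := sqr_ge0 (b * N + 2 * si).
  have : 0 <= (b * N + 2 * si) ^+ 2 / (2 * N) by rewrite divr_ge0// mulr_ge0// ltW.
  have -> : (b * N + 2 * si) ^+ 2 / (2 * N) = b ^+ 2 * N / 2 + 2 * b * si + 2 / N * si ^+ 2.
    by field; rewrite gt_eqF.
  rewrite /S qv LF; move: aa; clear; move: (ip _ _) => X; lra.
have gD : 0 <= ga * D by rewrite mulr_ge0// ltW.
have cna : 0 <= c^-1 * na by rewrite mulr_ge0// invr_ge0 ltW.
have bN : 0 <= b ^+ 2 * N / 2 by rewrite divr_ge0// mulr_ge0 ?sqr_ge0// ltW.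
have n1 : b ^+ 2 <= 2 / N * S.
  rewrite mulrAC ler_pdivlMr//; lra.
have n2 : na <= c * S by rewrite -ler_pdivrMl//; lra.
have n3 : D <= ga^-1 * S by rewrite ler_pdivlMl//; lra.
have n3' : b ^+ 2 * N <= 2 * S by lra.
(* The pairing required by [poincare]. As [Z = (a + gam z) / (c - phi)], it is a combination of
   [<s, Z> = <s, v> + b N] and of a pairing with [a], both under control. *)
pose m := ip z sr.
have mE : ip s Z = ip sr a + ga * m.
  have -> : Z = (fun x => (c - phi x)^-1 * (a x + ga * z x)).
    by apply/funext => x; rewrite /a /L -/z; field; exact: r_neq0 P x.
  rewrite -ipMA -srE ipDr//; last exact: L2rZ.
  by rewrite ipZr// (ipC sr z).
have n4 : m ^+ 2 <= 2 * g2 * (2 * si ^+ 2 + 4 * N * S + nsq sr * (c * S)).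
  have -> : m = ga^-1 * (si + b * N - ip sr a) by rewrite -sZ mE; field.
  rewrite exprMn -/g2 -[leRHS]mulrA [leRHS]mulrCA; apply: ler_wpM2l => //.
  have q1 := sqr_ge0 (si + b * N + ip sr a); have q2 := sqr_ge0 (si - b * N).
  have q3 : ip sr a ^+ 2 <= nsq sr * (c * S) by apply: (le_trans (CS Lsr La)); apply: ler_wpM2l.
  have q4 : (b * N) ^+ 2 <= N * (2 * S).
    by rewrite exprMn (_ : b ^+ 2 * N ^+ 2 = N * (b ^+ 2 * N)); [apply: ler_wpM2l => //; exact: ltW|ring].
  move: q1 q2 q3 q4; move: (ip sr a) (b * N) => X1 X2; nra.
(* The factor [ga] arises because [Z] contains [ga z / (c - phi)], and [p / (c - phi) = phi']. *)
exists (ga * h).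
have Lzh : L2r (fun x => z x - h * p x) by apply: L2rB => //; apply: L2rZ; exact: L2r_p k0 ck P.
have -> : (fun x => v x - ga * h * phi1 x) = (fun x => b * Y x + (c - phi x)^-1 * a x
    + ga * ((c - phi x)^-1 * (z x - h * p x))).
  by apply/funext => x; rewrite /a /L -/z /Z /dp_p; field; exact: r_neq0 P x.
apply: (le_trans (nsq_add3 (L2rZ b LY) La' (L2rZ ga (L2r_mulVr Lzh)))).
rewrite !nsqZ//; last exact: L2r_mulVr.
have f1 := nsq_mulVr La; have f2 := nsq_mulVr Lzh; rewrite -/ri in f1 f2.
have g2' : 0 <= ga ^+ 2 by exact: sqr_ge0.
have hP' : nsq (fun x => z x - h * p x) <= C1 * (ga^-1 * S + m ^+ 2).
  by apply: (le_trans hP); apply: ler_wpM2l => //; rewrite lerD2r.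
have T1 : 4 * (b ^+ 2 * nsq Y) <= 8 * nsq Y / N * S.
  have := ler_wpM2r nY n1 => u; apply: (@le_trans _ _ (4 * (2 / N * S * nsq Y))); first by rewrite ler_pM2l.
  by rewrite le_eqVlt; apply/orP; left; apply/eqP; ring.
have T2 : 4 * nsq (fun x => (c - phi x)^-1 * a x) <= 4 * ri * c * S.
  rewrite (_ : 4 * ri * c * S = 4 * (ri * (c * S))); last by ring.
  by rewrite ler_pM2l//; apply: (le_trans f1); exact: ler_wpM2l.
have T3 : 2 * (ga ^+ 2 * nsq (fun x => (c - phi x)^-1 * (z x - h * p x)))
    <= 2 * ga ^+ 2 * ri * C1 * (ga^-1 * S + m ^+ 2).
  rewrite (_ : 2 * ga ^+ 2 * ri * C1 * (ga^-1 * S + m ^+ 2)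
    = 2 * (ga ^+ 2 * (ri * (C1 * (ga^-1 * S + m ^+ 2))))); last by ring.
  rewrite ler_pM2l//; apply: ler_wpM2l => //; apply: (le_trans f2).
  exact: ler_wpM2l.
have T4 := ler_wpM2l gC0 n4.
apply: (le_trans (lerD (lerD T1 T2) T3)).
rewrite [2 * ga ^+ 2 * ri * C1 * _]mulrDr.
apply: (@le_trans _ _ (8 * nsq Y / N * S + 4 * ri * c * S + (2 * ga ^+ 2 * ri * C1 * (ga^-1 * S)
  + 2 * ga ^+ 2 * ri * C1 * (2 * g2 * (2 * si ^+ 2 + 4 * N * S + nsq sr * (c * S)))))).
  by apply: lerD => //; apply: lerD.
rewrite le_eqVlt; apply/orP; left; apply/eqP.
have -> : A * ip (L v) v + (A * (2 / N) + B) * si ^+ 2 = A * S + B * si ^+ 2 by rewrite /S; ring.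
by rewrite /A /B; ring.
Qed.

End coercivity.

(** * The resolvent estimate *)

#[global] Opaque G Gd.
Section a_priori.
Context {R : realType}.
Local Notation mu := (@lebesgue_measure R).
Implicit Types (f g u v w : R -> R) (x y a b : R).

Lemma nsq_G a f : 0 < a -> L2r f -> nsq (G a f) <= (a^-1 ^+ 2) ^+ 2 * nsq f.
Proof.
move=> a0 Lf; have h := nrm_G a0 Lf; rewrite -(nrm_sqr f) -(nrm_sqr (G a f)) -exprMn.
by rewrite ler_sqr// nnegrE ?nrm_ge0// mulr_ge0 ?nrm_ge0// sqr_ge0.
Qed.

(** Multiplication by [a + i b] in real coordinates: the modulus grows at least by the factor
    [a]. *)
Lemma rotation_bound (al a b x1 x2 : R) : 0 < al -> al <= a ->
  x1 ^+ 2 + x2 ^+ 2 <= al^-1 ^+ 2 * ((a * x1 - b * x2) ^+ 2 + (a * x2 + b * x1) ^+ 2).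
Proof.
move=> al0 ala; rewrite exprVn ler_pdivlMl ?exprn_gt0//.
have -> : (a * x1 - b * x2) ^+ 2 + (a * x2 + b * x1) ^+ 2 = (a ^+ 2 + b ^+ 2) * (x1 ^+ 2 + x2 ^+ 2) by ring.
apply: ler_wpM2r; first by rewrite addr_ge0 ?sqr_ge0.
have a0 : 0 < a by exact: lt_le_trans ala.
have : al ^+ 2 <= a ^+ 2 by rewrite ler_sqr// nnegrE; exact: ltW.
have := sqr_ge0 b; lra.
Qed.

Lemma le_mean_of_sqr_le (l X Y : R) : 0 <= X -> 0 <= Y -> l ^+ 2 <= X * Y -> l <= (X + Y) / 2.
Proof.
move=> X0 Y0 lXY; apply: (le_trans (ler_norm l)).
rewrite -ler_sqr ?nnegrE ?divr_ge0 ?addr_ge0// real_normK ?num_real//.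
by apply: (le_trans lXY); have := sqr_ge0 (X - Y); lra.
Qed.

(** Here [g] is [(1 - d^2/dx^2)^-1 h] and [d] its derivative, so this is the skew-symmetry of
    [d/dx (1 - d^2/dx^2)^-1]. *)
Lemma resolvent_skew g d h g' d' h' : L2r g -> L2r d -> L2r h -> L2r g' -> L2r d' -> L2r h' ->
  wd g d -> wd d (fun x => g x - h x) -> wd g' d' -> wd d' (fun x => g' x - h' x) ->
  ip h d' = - ip d h'.
Proof.
move=> Lg Ld Lh Lg' Ld' Lh' w1 w2 w1' w2'.
have e1 := wd_ibp Lg Lg' Ld Ld' w1 w1'.
have := wd_ibp Ld Ld' (L2rB Lg Lh) (L2rB Lg' Lh') w2 w2'.
by rewrite ipBr// ipBl//; move: e1; move: (ip _ _) (ip _ _) (ip _ _) (ip _ _) => *; lra.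
Qed.

(** [G 1 f] always has a weak derivative and can be subtracted, so [J] has the domain of [d/dx]. *)
Lemma wd_remove_G1 f f1 : L2r f -> L2r f1 -> wd (fun x => f x + 3 * G 1 f x) f1 ->
  L2r (fun x => f1 x - 3 * Gd 1 f x) /\ wd f (fun x => f1 x - 3 * Gd 1 f x).
Proof.
move=> Lf Lf1 ff; have o : 0 < 1 :> R by [].
have LG := G_L2r o Lf; have LGd := Gd_L2r o Lf.
split; first by apply: L2rB => //; exact: L2rZ.
have := wdB (L2rD Lf (L2rZ 3 LG)) (L2rZ 3 LG) Lf1 (L2rZ 3 LGd) ff (wdZ 3 LG LGd (wd_G o Lf)).
by congr wd; apply/funext => x; rewrite addrK.
Qed.

(** Skew-symmetry of [J], the sum of [d/dx] and [3 d/dx (1 - d^2/dx^2)^-1]; [u1] and [w1] stand for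
    [J u] and [J w]. *)
Lemma G1_skew u w u1 w1 : L2r u -> L2r w -> L2r u1 -> L2r w1 ->
  wd (fun x => u x + 3 * G 1 u x) u1 -> wd (fun x => w x + 3 * G 1 w x) w1 ->
  ip u w1 = - ip u1 w.
Proof.
move=> Lu Lw Lu1 Lw1 uu ww; have o : 0 < 1 :> R by [].
have [Lu' wu] := wd_remove_G1 Lu Lu1 uu; have [Lw' ww'] := wd_remove_G1 Lw Lw1 ww.
have LGu := G_L2r o Lu; have LGdu := Gd_L2r o Lu.
have LGw := G_L2r o Lw; have LGdw := Gd_L2r o Lw.
have e1 := wd_ibp Lu Lw Lu' Lw' wu ww'.
rewrite ipBr// in e1; last exact: L2rZ.
rewrite ipBl// in e1; last exact: L2rZ.
rewrite ipZr// ipZl// in e1.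
have w2 := wd_Gd o Lu; have w2' := wd_Gd o Lw.
have E f : (fun x => 1 ^+ 2 * G 1 f x - f x) = (fun x => G 1 f x - f x).
  by apply/funext => x; rewrite expr1n mul1r.
rewrite E in w2; rewrite E in w2'.
have := resolvent_skew LGu LGdu Lu LGw LGdw Lw (wd_G o Lu) w2 (wd_G o Lw) w2'.
move: e1; move: (ip u w1) (ip u1 w) (ip u (Gd 1 w)) (ip (Gd 1 u) w).
by move=> *; lra.
Qed.

Lemma skew_balance (A a b q1 q2 q12 q21 l1 l2 e1 e2 : R) : a != 0 ->
  l1 = e1 - a * q1 + b * q12 -> l2 = e2 - a * q2 - b * q21 -> e1 = 0 -> e2 = 0 -> q12 = q21 ->
  A * (q1 + q2) = - (A / a * l1) - (A / a * l2).
Proof. by move=> a0 -> -> -> -> ->; field. Qed.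

Variables (c k : R) (phi phi1 phi2 : R -> R).
Hypotheses (k0 : 0 < 2 * k) (ck : 2 * k < c) (P : dp_profile c k phi phi1 phi2).
Local Notation ga := (gam c k).
Local Notation p := (dp_p c phi phi1).
Local Notation s := (dp_s c k phi).
Local Notation L := (dp_L c k phi).

Lemma LE v x : L v x = (c - phi x) * v x - ga * G 2 v x. Proof. by []. Qed.

(* [(4 - d^2/dx^2) (1 - d^2/dx^2)^-1 L]. *)
Definition dp_M v x := L v x + 3 * G 1 (L v) x.
Local Notation M := dp_M.

Lemma L2r_M v : L2r v -> L2r (M v).
Proof.
move=> Lv; have LLv := L2r_L P Lv.
by apply: L2rD => //; apply: L2rZ; exact: G_L2r.
Qed.

Lemma nsq_phi1_gt0 : 0 < nsq phi1.
Proof.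
have Lp := L2r_phi1 k0 ck P; rewrite lt_neqAle nsq_ge0 andbT eq_sym; apply/eqP => /(nsq_eq0 Lp) h.
have c0 : continuous (fun _ : R => 0 : R) by move=> x; exact: cvg_cst.
have /(_ 1) := continuous_ae_eq (phi1_continuous P) c0 h.
by have := prof_decr P ltr01 => /ltr0_neq0/eqP.
Qed.

Lemma L_bound : exists2 C, 0 <= C & forall v, L2r v -> nsq (L v) <= C * nsq v.
Proof.
exists (2 * (c ^+ 2 + ga ^+ 2 * (2^-1 ^+ 2) ^+ 2)) => [|v Lv].
  apply: mulr_ge0 => //; apply: addr_ge0; first exact: sqr_ge0.
  by apply: mulr_ge0; exact: sqr_ge0.
have o : 0 < 2 :> R by [].
have LG := G_L2r o Lv; have e1 := nsqM (continuous_meas (r_continuous P)) (norm_r_le P) Lv.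
have e2 := nsq_G o Lv; rewrite /dp_L; apply: (le_trans (nsqB_le (L2r_mulr P Lv) (L2rZ ga LG))).
rewrite -mulrA ler_pM2l// mulrDl; apply: lerD => //.
by rewrite nsqZ// -[leRHS]mulrA; apply: ler_wpM2l => //; exact: sqr_ge0.
Qed.

#[global] Opaque dp_L.

Lemma M_bound : exists2 C, 0 <= C & forall v, L2r v -> nsq (M v) <= C * nsq v.
Proof.
have [C C0 LC] := L_bound; exists (20 * C) => [|v Lv]; first exact: mulr_ge0.
have LL := L2r_L P Lv; have o : 0 < 1 :> R by [].
have LG := G_L2r o LL; have := nsq_G o LL; have := LC v Lv.
have := nsqD_le LL (L2rZ 3 LG); rewrite nsqZ// -/(M v) invr1 !expr1n mul1r -mulrA.
move: (nsq _) (nsq _) (nsq _) (C * _) => ? ? ? ?; rewrite expr2; lra.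
Qed.

Lemma M_sub_phi1 v h : L2r v -> L (fun x => v x - h * phi1 x) = L v %[ae mu] /\
  M (fun x => v x - h * phi1 x) = M v %[ae mu].
Proof.
move=> Lv; have Lp := L2r_phi1 k0 ck P; have o : 0 < 1 :> R by [].
have e : L (fun x => v x - h * phi1 x) = L v %[ae mu].
  rewrite LB//; last exact: L2rZ.
  rewrite LZ//; apply: ae1 (L_phi1 k0 ck P) => x ->; by rewrite mulr0 subr0.
split=> //.
have [m1 _] := L2r_L P (L2rB Lv (L2rZ h Lp)); have [m2 _] := L2r_L P Lv.
by have E := eq_G 1 m1 m2 e; apply: ae1 e => x hx; rewrite /M hx E.
Qed.

(** The linearized conservation of [S]: here [t = J L v], and [<s, J L v> = - <phi', L v> = 0]
    because [J s = phi'] and [L phi' = 0]. *)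
Lemma ip_s_M v t : L2r v -> L2r t -> wd (M v) t -> ip s t = 0.
Proof.
move=> Lv Lt vt; have o : 0 < 1 :> R by [].
have Ls := L2r_s k0 ck P; have Lp := L2r_p k0 ck P; have Lp1 := L2r_phi1 k0 ck P.
have Ls1 : L2r (fun x => phi1 x - 3 * (ga^-1 * p x)) by apply: L2rB => //; do 2 apply: L2rZ.
have LL := L2r_L P Lv; have LG := G_L2r o LL.
rewrite (wd_ibp Ls (L2r_M Lv) Ls1 Lt (wd_s k0 ck P) vt).
rewrite ipDr//; last exact: L2rZ.
rewrite ipZr// -(G_sym o Ls1 LL).
have -> : ip (G 1 (fun x => phi1 x - 3 * (ga^-1 * p x))) (L v) = ip (fun x => ga^-1 * p x) (L v).
  have [m1 _] := G_L2r o Ls1; have [m2 _] := L2rZ ga^-1 Lp; have [m3 _] := LL.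
  exact: (ae_ip m1 m2 m3 m3 (G1_s1 k0 ck P) (eq_ae (frefl (L v)))).
rewrite ipBl//; last by apply: L2rZ; exact: L2rZ.
rewrite (ipZl 3)//; last exact: L2rZ.
rewrite subrK -(L_sym P)//.
have [m1 _] := L2r_L P Lp1; have [m2 _] := Lv.
have [m0 _] : L2r (fun _ : R => 0 : R) by exact: L2r0.
have := ae_ip m1 m0 m2 m2 (L_phi1 k0 ck P) (eq_ae (frefl v)).
by move=> ->; rewrite ip0l oppr0.
Qed.

(** [v1], [v2] are the real and imaginary parts of [v], [t1], [t2] those of [J L v], and [a + i b]
    is the spectral parameter. The constant depends only on the lower bound [al] of the real part,
    as continuation in the parameter requires. *)
Lemma a_priori (al : R) : 0 < al -> exists2 C, 0 <= C & forall a b v1 v2 t1 t2,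
  al <= a -> L2r v1 -> L2r v2 -> L2r t1 -> L2r t2 -> wd (M v1) t1 -> wd (M v2) t2 ->
  nsq v1 + nsq v2 <= C * (nsq (fun x => t1 x - a * v1 x + b * v2 x)
                        + nsq (fun x => t2 x - a * v2 x - b * v1 x)).
Proof.
move=> al0; have [A [B [A0 B0 coer]]] := coercivity k0 ck P.
have [CL CL0 hL] := L_bound; have [CM CM0 hM] := M_bound.
have Ls := L2r_s k0 ck P; have Lp1 := L2r_phi1 k0 ck P; have Lp2 := L2r_phi2 k0 ck P.
pose n := nsq phi1; have n0 : 0 < n := nsq_phi1_gt0.
pose i2 := al^-1 ^+ 2; have i20 : 0 <= i2 by exact: sqr_ge0.
pose C2 := A ^+ 2 * i2 * CL + 2 * (B * (i2 * nsq s)).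
have ns := nsq_ge0 s; have np2 := nsq_ge0 phi2.
have C20 : 0 <= C2.
  apply: addr_ge0; first by apply: mulr_ge0 => //; apply: mulr_ge0 => //; exact: sqr_ge0.
  by apply: mulr_ge0 => //; apply: mulr_ge0 => //; exact: mulr_ge0.
pose C3 := i2 * (2 * (nsq phi2 * CM * C2 + n)).
have C30 : 0 <= C3.
  apply: mulr_ge0 => //; apply: mulr_ge0 => //; apply: addr_ge0; last exact: ltW.
  by apply: mulr_ge0 => //; exact: mulr_ge0.
pose C := 2 * C2 + 2 / n * (2 * C3 + 2 * n * C2).
have C0 : 0 <= C.
  apply: addr_ge0; first exact: mulr_ge0.
  apply: mulr_ge0; first by apply: divr_ge0 => //; exact: ltW.
  apply: addr_ge0; first exact: mulr_ge0.
  by apply: mulr_ge0 => //; apply: mulr_ge0 => //; exact: ltW.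
exists C => // a b v1 v2 t1 t2 ala Lv1 Lv2 Lt1 Lt2 w1 w2.
have a0 : 0 < a by exact: lt_le_trans ala.
set f1 := fun x => t1 x - a * v1 x + b * v2 x.
set f2 := fun x => t2 x - a * v2 x - b * v1 x.
have Lf1 : L2r f1 by apply: L2rD; [apply: L2rB => //; exact: L2rZ|exact: L2rZ].
have Lf2 : L2r f2 by apply: L2rB; [apply: L2rB => //; exact: L2rZ|exact: L2rZ].
have ip1 g : L2r g -> ip g f1 = ip g t1 - a * ip g v1 + b * ip g v2.
  move=> Lg; rewrite /f1 ipDr//; [|by apply: L2rB => //; exact: L2rZ|exact: L2rZ].
  by rewrite ipBr//; [rewrite !ipZr|exact: L2rZ].
have ip2 g : L2r g -> ip g f2 = ip g t2 - a * ip g v2 - b * ip g v1.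
  move=> Lg; rewrite /f2 ipBr//; [|by apply: L2rB => //; exact: L2rZ|exact: L2rZ].
  by rewrite ipBr//; [rewrite !ipZr|exact: L2rZ].
clearbody f1 f2.
have LL1 := L2r_L P Lv1; have LL2 := L2r_L P Lv2.
pose F := nsq f1 + nsq f2.
have F10 := nsq_ge0 f1; have F20 := nsq_ge0 f2.
have F0 : 0 <= F by exact: addr_ge0.
have [h1 H1] := coer v1 Lv1; have [h2 H2] := coer v2 Lv2.
pose w_ h v : R -> R := fun x => v x - h * phi1 x.
have Lw1 : L2r (w_ h1 v1) by apply: L2rB => //; exact: L2rZ.
have Lw2 : L2r (w_ h2 v2) by apply: L2rB => //; exact: L2rZ.
have [eL1 eM1] := M_sub_phi1 h1 Lv1; have [eL2 eM2] := M_sub_phi1 h2 Lv2.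
pose W1 := nsq (w_ h1 v1); pose W2 := nsq (w_ h2 v2).
have W10 : 0 <= W1 by exact: nsq_ge0.
have W20 : 0 <= W2 by exact: nsq_ge0.
(* Pairing with [L v]: [<L v, J L v> = 0], and the terms in [b] cancel by symmetry of [L]. Since
   [L v = L w] for [w = v - h phi'], the error is half of [|w|^2], small enough to be absorbed. *)
have en : A * (ip (L v1) v1 + ip (L v2) v2) <= (W1 + W2) / 2 + A ^+ 2 * i2 * CL * F / 2.
  have E1 : ip (L v1) t1 = 0.
    by have := G1_skew LL1 LL1 Lt1 Lt1 w1 w1; rewrite (ipC t1); lra.
  have E2 : ip (L v2) t2 = 0.
    by have := G1_skew LL2 LL2 Lt2 Lt2 w2 w2; rewrite (ipC t2); lra.
  have S12 : ip (L v1) v2 = ip (L v2) v1 := etrans (L_sym P Lv1 Lv2) (ipC v1 (L v2)).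
  have l1 := ip1 _ LL1; have l2 := ip2 _ LL2.
  have bnd h v f : L2r v -> L2r f -> L2r (w_ h v) -> L (w_ h v) = L v %[ae mu] ->
      - (A / a * ip (L v) f) <= (nsq (w_ h v) + A ^+ 2 * i2 * CL * nsq f) / 2.
    move=> Lv Lf Lw e; apply: le_mean_of_sqr_le; first exact: nsq_ge0.
      apply: mulr_ge0; last exact: nsq_ge0.
      by apply: mulr_ge0 => //; apply: mulr_ge0 => //; exact: sqr_ge0.
    have Llv := L2r_L P Lv; have Llw := L2r_L P Lw.
    have [m1 _] := Llv; have [m2 _] := Llw; have [m3 _] := Lf.
    rewrite sqrrN exprMn -(ae_ip m2 m1 m3 m3 e (eq_ae (frefl f))).
    have ai : (A / a) ^+ 2 <= A ^+ 2 * i2.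
      rewrite exprMn; apply: ler_wpM2l; first exact: sqr_ge0.
      by rewrite ler_sqr ?nnegrE ?invr_ge0 ?(ltW a0) ?(ltW al0)// lef_pV2 ?posrE.
    have cs : ip (L (w_ h v)) f ^+ 2 <= CL * nsq (w_ h v) * nsq f.
      by apply: (le_trans (CS Llw Lf)); apply: ler_wpM2r; [exact: nsq_ge0|exact: hL].
    apply: (le_trans (ler_pM _ _ ai cs)); rewrite ?sqr_ge0//.
    by rewrite le_eqVlt; apply/orP; left; apply/eqP; ring.
  have b1 := bnd h1 v1 f1 Lv1 Lf1 Lw1 eL1; have b2 := bnd h2 v2 f2 Lv2 Lf2 Lw2 eL2.
  have -> : A * (ip (L v1) v1 + ip (L v2) v2)
      = - (A / a * ip (L v1) f1) - (A / a * ip (L v2) f2).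
    exact: (skew_balance A (lt0r_neq0 a0) l1 l2 E1 E2 S12).
  apply: (le_trans (lerD b1 b2)); rewrite /F -/W1 -/W2.
  by rewrite le_eqVlt; apply/orP; left; apply/eqP; field.
(* [<s, J L v> = 0] turns the equation into [l <s, v> = - <s, f>]. *)
have sg : ip s v1 ^+ 2 + ip s v2 ^+ 2 <= i2 * nsq s * F.
  apply: (le_trans (rotation_bound b _ _ al0 ala)); rewrite -mulrA; apply: ler_wpM2l => //.
  have l1 := ip1 _ Ls; have l2 := ip2 _ Ls.
  rewrite (ip_s_M Lv1 Lt1 w1) in l1; rewrite (ip_s_M Lv2 Lt2 w2) in l2.
  have -> : a * ip s v1 - b * ip s v2 = - ip s f1 by rewrite l1; ring.
  have -> : a * ip s v2 + b * ip s v1 = - ip s f2 by rewrite l2; ring.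
  by rewrite !sqrrN mulrDr; apply: lerD; exact: CS.
have WF : W1 + W2 <= C2 * F.
  have B1 : B * (ip s v1 ^+ 2 + ip s v2 ^+ 2) <= B * (i2 * nsq s * F) by exact: ler_wpM2l.
  have : W1 + W2 <= A * (ip (L v1) v1 + ip (L v2) v2) + B * (ip s v1 ^+ 2 + ip s v2 ^+ 2).
    by apply: (le_trans (lerD H1 H2)); rewrite le_eqVlt; apply/orP; left; apply/eqP; ring.
  have -> : C2 * F = A ^+ 2 * i2 * CL * F + 2 * (B * (i2 * nsq s * F)) by rewrite /C2; ring.
  move: en B1; move: (A * _) (B * _) (B * _) (_ * F) => X1 X2 X3 X4; lra.
(* [<phi', J L v> = - <phi'', M v>] and [M v = M w], so [l <phi', v>] is bounded in terms of [w] and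
   [f]. *)
have gv h v t f : L2r v -> L2r t -> L2r f -> L2r (w_ h v) -> M (w_ h v) = M v %[ae mu] ->
    wd (M v) t -> (ip phi1 t - ip phi1 f) ^+ 2 <= 2 * (nsq phi2 * CM * nsq (w_ h v) + n * nsq f).
  move=> Lv Lt Lf Lw e vt; have Lmv := L2r_M Lv; have Lmw := L2r_M Lw.
  have [m1 _] := Lmv; have [m2 _] := Lmw; have [m3 _] := Lp2.
  rewrite (wd_ibp Lp1 Lmv Lp2 Lt (wd_phi1 k0 ck P) vt).
  rewrite -(ae_ip m3 m3 m2 m1 (eq_ae (frefl phi2)) e).
  have c1 : ip phi2 (M (w_ h v)) ^+ 2 <= nsq phi2 * CM * nsq (w_ h v).
    by apply: (le_trans (CS Lp2 Lmw)); rewrite -mulrA; apply: ler_wpM2l => //; exact: hM.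
  have c2 := CS Lp1 Lf; rewrite -/n in c2.
  have := sqr_ge0 (ip phi2 (M (w_ h v)) - ip phi1 f).
  move: c1 c2; move: (ip _ _) (ip _ _) (_ * nsq (w_ h v)) (n * _) => x1 x2 x3 x4; nra.
have xx : ip phi1 v1 ^+ 2 + ip phi1 v2 ^+ 2 <= C3 * F.
  apply: (le_trans (rotation_bound b _ _ al0 ala)); rewrite /C3 -mulrA; apply: ler_wpM2l => //.
  have l1 := ip1 _ Lp1; have l2 := ip2 _ Lp1.
  have -> : a * ip phi1 v1 - b * ip phi1 v2 = ip phi1 t1 - ip phi1 f1 by rewrite l1; ring.
  have -> : a * ip phi1 v2 + b * ip phi1 v1 = ip phi1 t2 - ip phi1 f2 by rewrite l2; ring.
  apply: (le_trans (lerD (gv h1 v1 t1 f1 Lv1 Lt1 Lf1 Lw1 eM1 w1) (gv h2 v2 t2 f2 Lv2 Lt2 Lf2 Lw2 eM2 w2))).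
  rewrite -/W1 -/W2 -[leRHS]mulrA.
  have -> : 2 * (nsq phi2 * CM * W1 + n * nsq f1) + 2 * (nsq phi2 * CM * W2 + n * nsq f2)
    = 2 * (nsq phi2 * CM * (W1 + W2) + n * F) by rewrite /F; ring.
  rewrite ler_pM2l// mulrDl lerD2r -[leRHS]mulrA; apply: ler_wpM2l => //; exact: mulr_ge0.
(* The coefficient [h] is recovered by pairing [w = v - h phi'] with [phi']. *)
have hh h v : L2r v -> L2r (w_ h v) ->
    (h * n) ^+ 2 <= 2 * ip phi1 v ^+ 2 + 2 * n * nsq (w_ h v).
  move=> Lv Lw.
  have e : ip phi1 (w_ h v) = ip phi1 v - h * n.
    by rewrite /w_ ipBr//; [rewrite ipZr|exact: L2rZ].
  have := CS Lp1 Lw; rewrite e -/n.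
  have := sqr_ge0 (2 * ip phi1 v - h * n).
  move: (ip _ _) (nsq _) (h * n) => X1 X2 X3; nra.
have vv h v : L2r v -> L2r (w_ h v) -> nsq v <= 2 * nsq (w_ h v) + 2 / n * (h * n) ^+ 2.
  move=> Lv Lw.
  have E : v = (fun x => w_ h v x + h * phi1 x) by apply/funext => x; rewrite /w_ subrK.
  rewrite {1}E; apply: (le_trans (nsqD_le Lw (L2rZ h Lp1))).
  rewrite nsqZ// -/n le_eqVlt; apply/orP; left; apply/eqP; field.
  by rewrite gt_eqF.
apply: (le_trans (lerD (vv h1 v1 Lv1 Lw1) (vv h2 v2 Lv2 Lw2))); rewrite -/W1 -/W2.
have q1 := hh h1 v1 Lv1 Lw1; have q2 := hh h2 v2 Lv2 Lw2; rewrite -/W1 -/W2 in q1 q2.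
have q : (h1 * n) ^+ 2 + (h2 * n) ^+ 2 <= (2 * C3 + 2 * n * C2) * F.
  have h : 2 * n * (W1 + W2) <= 2 * n * (C2 * F) by rewrite ler_pM2l// mulr_gt0.
  rewrite mulrDr in h.
  have -> : (2 * C3 + 2 * n * C2) * F = 2 * (C3 * F) + 2 * n * (C2 * F) by ring.
  move: h q1 q2 xx; move: (2 * n * W1) (2 * n * W2) (2 * n * (C2 * F)) (C3 * F).
  move: ((h1 * n) ^+ 2) ((h2 * n) ^+ 2) (ip phi1 v1 ^+ 2) (ip phi1 v2 ^+ 2) => *; lra.
have n2 : 0 <= 2 / n by apply: divr_ge0 => //; exact: ltW.
have -> : 2 * W1 + 2 / n * (h1 * n) ^+ 2 + (2 * W2 + 2 / n * (h2 * n) ^+ 2)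
  = 2 * (W1 + W2) + 2 / n * ((h1 * n) ^+ 2 + (h2 * n) ^+ 2) by ring.
have -> : C * (nsq f1 + nsq f2) = 2 * (C2 * F) + 2 / n * ((2 * C3 + 2 * n * C2) * F).
  by rewrite /C /F; ring.
by apply: lerD; [rewrite ler_pM2l|exact: ler_wpM2l].
Qed.

End a_priori.

(** * Solvability *)

Section surjectivity.
Context {R : realType}.
Local Notation mu := (@lebesgue_measure R).
Implicit Types (f g u v w : R -> R) (x y a b : R).

Variables (c k : R) (phi phi1 phi2 : R -> R).
Hypotheses (k0 : 0 < 2 * k) (ck : 2 * k < c) (P : dp_profile c k phi phi1 phi2).
Local Notation ga := (gam c k).
Local Notation L := (dp_L c k phi).
Local Notation M := (dp_M c k phi).

(* [M v = (c - phi) v + N v], where the derivative [K v] of [N v] is of order zero in [v]. *)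
Definition dp_K v x := - ga * Gd 2 v x + 3 * Gd 1 (L v) x.
Local Notation K := dp_K.

Lemma combination_sub a b x y : a - b + 3 * (x - y) = a + 3 * x - (b + 3 * y).
Proof. by ring. Qed.

Lemma combination_sub2 (d a b x y : R) :
  d * (a - b) + 3 * (x - y) = d * a + 3 * x - (d * b + 3 * y).
Proof. by ring. Qed.

Lemma combination_sub3 (m a b x y f : R) :
  m * a + x - f + (-1) * (m * b + y - f) = m * (a - b) + (x - y).
Proof. by ring. Qed.

Lemma MB v w : L2r v -> L2r w -> M (fun x => v x - w x) = (fun x => M v x - M w x).
Proof.
move=> Lv Lw; have o : 0 < 1 :> R by [].
have eL := @LB _ c k phi v w Lv Lw; have eG := GB o (L2r_L P Lv) (L2r_L P Lw).
by apply/funext => x; rewrite /dp_M eL eG; exact: combination_sub.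
Qed.

Lemma GdB a v w : 0 < a -> L2r v -> L2r w ->
  Gd a (fun x => v x - w x) = (fun x => Gd a v x - Gd a w x).
Proof.
move=> a0 Lv Lw; apply/funext => x.
apply: (der_unique (der_G a0 x (L2rB Lv Lw))); rewrite GB//.
by apply: derB; exact: der_G.
Qed.

Lemma L2r_K v : L2r v -> L2r (K v).
Proof.
move=> Lv; have o : 0 < 1 :> R by []; have o2 : 0 < 2 :> R by [].
apply: L2rD; first by apply: L2rZ; exact: Gd_L2r.
by apply: L2rZ; apply: Gd_L2r => //; exact: L2r_L P _ _.
Qed.

Lemma KB v w : L2r v -> L2r w -> K (fun x => v x - w x) = (fun x => K v x - K w x).
Proof.
move=> Lv Lw; have o : 0 < 1 :> R by []; have o2 : 0 < 2 :> R by [].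
have Lv' := L2r_L P Lv; have Lw' := L2r_L P Lw.
have eL := @LB _ c k phi v w Lv Lw; have e1 := GdB o Lv' Lw'; have e2 := GdB o2 Lv Lw.
by apply/funext => x; rewrite /K eL e1 e2; exact: combination_sub2.
Qed.

Lemma K_bound : exists2 C, 0 <= C & forall v, L2r v -> nrm (K v) <= C * nrm v.
Proof.
have c0 := c_gt0 k0 ck; have g0 := gam_gt0 k0 ck.
exists (ga + 3 * (2 * (c + ga * 2^-1 ^+ 2))) => [|v Lv].
  apply: addr_ge0; first exact: ltW.
  apply: mulr_ge0 => //; apply: mulr_ge0 => //; apply: addr_ge0; first exact: ltW.
  by apply: mulr_ge0; [exact: ltW|exact: sqr_ge0].
have o : 0 < 1 :> R by []; have o2 : 0 < 2 :> R by [].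
have LLv := L2r_L P Lv; have LG := G_L2r o2 Lv.
have LG2 := Gd_L2r o2 Lv; have LG1 := Gd_L2r o LLv.
have nL : nrm (L v) <= (c + ga * 2^-1 ^+ 2) * nrm v.
  apply: (le_trans (nrmB (L2r_mulr P Lv) (L2rZ ga LG))); rewrite mulrDl; apply: lerD.
    exact: (nrmM (ltW c0) (continuous_meas (r_continuous P)) (norm_r_le P) Lv).
  rewrite nrmZ// ger0_norm ?(ltW g0)// -mulrA; apply: ler_wpM2l; first exact: ltW.
  exact: nrm_G.
apply: (le_trans (nrmD (L2rZ (- ga) LG2) (L2rZ 3 LG1))); rewrite mulrDl; apply: lerD.
  rewrite nrmZ// normrN ger0_norm ?(ltW g0)//; apply: ler_wpM2l; first exact: ltW.
  by have := nrm_Gd o2 Lv; rewrite mulfV// mul1r.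
rewrite nrmZ// ger0_norm// -!mulrA; apply: ler_wpM2l => //.
have := nrm_Gd o LLv; rewrite divr1 => /le_trans; apply.
by apply: ler_wpM2l => //.
Qed.

Definition solves a b f1 f2 v1 v2 := exists t1 t2,
  [/\ L2r t1 /\ L2r t2, wd (M v1) t1, wd (M v2) t2,
      (fun x => t1 x - a * v1 x + b * v2 x) = f1 %[ae mu]
    & (fun x => t2 x - a * v2 x - b * v1 x) = f2 %[ae mu]].

Definition solvable a b := forall f1 f2, L2r f1 -> L2r f2 ->
  exists v1 v2, [/\ L2r v1, L2r v2 & solves a b f1 f2 v1 v2].

(* Writing [q = (c - phi) v], the equation becomes [q' - l q / (c - phi) + K v = f], which for
   large [l] is a contraction for the resolvent of [d/dx]. *)
Lemma solvable_large : exists l0, forall l, l0 <= l -> 0 < l -> solvable l 0.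
Proof.
have c0 := c_gt0 k0 ck; have r00 := r0_gt0 P.
have [CK CK0 hK] := K_bound.
pose r0 := c - phi 0.
(* This threshold gives [CK / l <= r0 / c / 2], so that the contraction factor [Q] below is smaller
   than [1]. *)
exists (2 * CK * c / r0) => l l0l lp f1 f2 Lf1 Lf2.
(* The largest value of [l / (c - phi)], so that the multiplier [m] is nonnegative and bounded away
   from [La]. *)
pose La := l / r0.
have La0 : 0 < La by rewrite divr_gt0.
pose vq (q : R -> R) x := (c - phi x)^-1 * q x.
have Lvq q : L2r q -> L2r (vq q) by move=> Lq; exact: (L2r_mulVr P Lq).
pose m x := La - l / (c - phi x).
have m_le x : `|m x| <= La - l / c.
  have rx := r_gt0 P x; have rg := r_ge P x; have rc := r_le P x.
  rewrite ger0_norm.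
    by rewrite lerD2l lerN2 ler_pM2l// lef_pV2 ?posrE.
  by rewrite subr_ge0 ler_pM2l// lef_pV2 ?posrE.
have mm : measurable_fun setT m.
  apply: continuous_meas => x; apply: cvgB; first exact: cvg_cst.
  by apply: cvgMr; exact: inv_r_continuous P x.
pose g f q x := m x * q x + K (vq q) x - f x.
have Lmq q : L2r q -> L2r (fun x => m x * q x) by move=> Lq; exact: L2rM mm m_le Lq.
have Lg f q : L2r f -> L2r q -> L2r (g f q).
  by move=> Lf Lq; apply: L2rB => //; apply: L2rD; [exact: Lmq|apply: L2r_K; exact: Lvq].
pose N f q := Rm La (g f q).
(* The sum of [(La - l / c) / La], from the multiplier, and of [CK / (r0 * La)], from [K]. *)
pose Q := 1 - r0 / c + CK / l.
have rc1 : r0 / c <= 1 by rewrite ler_pdivrMr// mul1r (r_le P).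
have Q0 : 0 <= Q by rewrite addr_ge0 ?subr_ge0// divr_ge0// ltW.
have Q1 : Q < 1.
  have : CK / l <= r0 / c / 2.
    rewrite ler_pdivrMr// mulrAC ler_pdivlMr// mulrAC ler_pdivlMr//.
    by move: l0l; rewrite ler_pdivrMr//; move=> h; rewrite (mulrC CK) mulrAC (mulrC l) in h *; move: h; rewrite mulrC.
  have : 0 < r0 / c by rewrite divr_gt0.
  by rewrite /Q; move: (r0 / c) (CK / l) => *; lra.
have Lm0 : 0 <= La - l / c by apply: le_trans (m_le 0).
have NB f q q' : L2r f -> L2r q -> L2r q' ->
    nrm (fun x => N f q x - N f q' x) <= Q * nrm (fun x => q x - q' x).
  move=> Lf Lq Lq'; have Lqq := L2rB Lq Lq'.
  have Lgq := Lg _ _ Lf Lq; have Lgq' := Lg _ _ Lf Lq'.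
  have -> : (fun x => N f q x - N f q' x) = Rm La (fun x => g f q x + (-1) * g f q' x).
    rewrite (RmD La0 Lgq (L2rZ (-1) Lgq')) RmZ//.
    by apply/funext => x; rewrite mulN1r.
  have -> : (fun x => g f q x + (-1) * g f q' x) =
     (fun x => m x * (q x - q' x) + K (vq (fun y => q y - q' y)) x).
    have -> : vq (fun y => q y - q' y) = (fun y => vq q y - vq q' y).
      by apply/funext => y; rewrite /vq mulrBr.
    have eK := KB (Lvq _ Lq) (Lvq _ Lq').
    by apply/funext => x; rewrite eK /g; exact: combination_sub3.
  have Lmqq := Lmq _ Lqq; have LKq := L2r_K (Lvq _ Lqq).
  apply: (le_trans (Rm_nrm La0 (L2rD Lmqq LKq))).
  rewrite ler_pdivrMl//.
  apply: (le_trans (nrmD Lmqq LKq)).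
  have -> : La * (Q * nrm (fun x => q x - q' x)) =
     (La - l / c) * nrm (fun x => q x - q' x) + CK * (r0^-1 * nrm (fun x => q x - q' x)).
    rewrite /Q /La; field.
    by rewrite !gt_eqF.
  apply: lerD; first exact: nrmM.
  apply: (le_trans (hK _ (Lvq _ Lqq))); apply: ler_wpM2l => //.
  apply: (nrmM _ (continuous_meas (inv_r_continuous P)) (inv_r_le P) Lqq).
  by rewrite invr_ge0 ltW.
have LN f q : L2r f -> L2r q -> L2r (N f q) by move=> Lf Lq; apply: Rm_L2r => //; exact: Lg.
have contr u1 u2 v1 v2 : L2r u1 -> L2r u2 -> L2r v1 -> L2r v2 ->
    nrm (fun x => N f1 u1 x - N f1 v1 x) + nrm (fun x => N f2 u2 x - N f2 v2 x)
    <= Q * (nrm (fun x => u1 x - v1 x) + nrm (fun x => u2 x - v2 x)).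
  by move=> Lu1 Lu2 Lv1 Lv2; rewrite mulrDr; apply: lerD; exact: NB.
have [q1 [q2 [Lq1 Lq2 F1 F2]]] := @L2r_contraction R (fun q _ => N f1 q) (fun _ q => N f2 q)
  Q Q0 Q1 (fun u1 u2 Lu1 Lu2 => conj (LN f1 u1 Lf1 Lu1) (LN f2 u2 Lf2 Lu2)) contr.
have fin f q : L2r f -> L2r q -> N f q = q %[ae mu] ->
    let t := fun x => La * q x - g f q x + K (vq q) x in
    [/\ L2r t, wd (M (vq q)) t & forall x, t x - l * vq q x = f x].
  move=> Lf Lq Fq t.
  have Lgq := Lg _ _ Lf Lq; have LNq := LN _ _ Lf Lq.
  have Lt1 : L2r (fun x => La * q x - g f q x) by apply: L2rB => //; exact: L2rZ.
  have LKq := L2r_K (Lvq _ Lq).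
  split; first exact: L2rD.
    have w1 : wd q (fun x => La * q x - g f q x).
      have Lt2 : L2r (fun x => La * N f q x - g f q x) by apply: L2rB => //; exact: L2rZ.
      have [n1 _] := LNq; have [n2 _] := Lq; have [n3 _] := Lt2; have [n4 _] := Lt1.
      apply: (wd_ae n1 n2 n3 n4 Fq _ (wd_Rm La0 Lgq)).
      by apply: ae1 Fq => x ->.
    have o : 0 < 1 :> R by []; have o2 : 0 < 2 :> R by [].
    have Lv := Lvq _ Lq; have LLv := L2r_L P Lv.
    have G2 := G_L2r o2 Lv; have Gd2 := Gd_L2r o2 Lv.
    have G1 := G_L2r o LLv; have Gd1 := Gd_L2r o LLv.
    have w2 := wdZ (- ga) G2 Gd2 (wd_G o2 Lv); have w3 := wdZ 3 G1 Gd1 (wd_G o LLv).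
    have w4 := wdD (L2rZ (- ga) G2) (L2rZ 3 G1) (L2rZ (- ga) Gd2) (L2rZ 3 Gd1) w2 w3.
    have := wdD Lq (L2rD (L2rZ (- ga) G2) (L2rZ 3 G1)) Lt1 (L2rD (L2rZ (- ga) Gd2) (L2rZ 3 Gd1)) w1 w4.
    congr wd; apply/funext => x.
    by rewrite /dp_M [in RHS]LE /vq [in RHS]mulrA mulfV ?(r_neq0 P)// mul1r mulNr addrA.
  by move=> x; rewrite /t /g /m /vq; ring.
have [Lt1 w1 E1] := fin _ _ Lf1 Lq1 F1; have [Lt2 w2 E2] := fin _ _ Lf2 Lq2 F2.
exists (vq q1), (vq q2); split; [exact: Lvq|exact: Lvq|].
eexists; eexists; split; [split; [exact: Lt1|exact: Lt2]|exact: w1|exact: w2| |].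
- by apply: eq_ae => x; rewrite mul0r addr0 E1.
- by apply: eq_ae => x; rewrite mul0r subr0 E2.
Qed.

(** A solution for the shifted parameter is a fixed point of the map sending [u] to the solution for
    the old parameter with data [f + (da + i db) u]; the a priori estimate bounds its Lipschitz
    constant. *)
Lemma solvable_step (al C a b da db : R) :
  (forall a b v1 v2 t1 t2,
    al <= a -> L2r v1 -> L2r v2 -> L2r t1 -> L2r t2 -> wd (M v1) t1 -> wd (M v2) t2 ->
    nsq v1 + nsq v2 <= C * (nsq (fun x => t1 x - a * v1 x + b * v2 x)
                          + nsq (fun x => t2 x - a * v2 x - b * v1 x))) ->
  0 <= C -> al <= a -> solvable a b -> 16 * C * (da ^+ 2 + db ^+ 2) <= 1 ->
  solvable (a + da) (b + db).
Proof.
move=> hC C0 ala S small f1 f2 Lf1 Lf2.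
pose g1 (u : (R -> R) * (R -> R)) x := f1 x + (da * u.1 x - db * u.2 x).
pose g2 (u : (R -> R) * (R -> R)) x := f2 x + (da * u.2 x + db * u.1 x).
have Lg1 (u : (R -> R) * (R -> R)) : L2r u.1 -> L2r u.2 -> L2r (g1 u).
  by move=> L1 L2; apply: L2rD => //; apply: L2rB; exact: L2rZ.
have Lg2 (u : (R -> R) * (R -> R)) : L2r u.1 -> L2r u.2 -> L2r (g2 u).
  by move=> L1 L2; apply: L2rD => //; apply: L2rD; exact: L2rZ.
(* The solution is selected by choice; the estimate [hC], applied to differences, controls any such
   selection. *)
have /choice[W HW] : forall u : (R -> R) * (R -> R), exists w : (R -> R) * (R -> R),
    L2r u.1 -> L2r u.2 -> [/\ L2r w.1, L2r w.2 & solves a b (g1 u) (g2 u) w.1 w.2].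
  move=> u; have [[L1 L2]|nL] := pselect (L2r u.1 /\ L2r u.2); last first.
    by exists u => L1 L2; exfalso; apply: nL.
  by have [v1 [v2 H]] := S _ _ (Lg1 u L1 L2) (Lg2 u L1 L2); exists (v1, v2).
have q0 : 0 <= 2^-1 :> R by [].
have q1 : 2^-1 < 1 :> R by lra.
have LW u1 u2 : L2r u1 -> L2r u2 -> L2r (W (u1, u2)).1 /\ L2r (W (u1, u2)).2.
  by move=> L1 L2; have [] := HW (u1, u2) L1 L2.
have contr u1 u2 v1 v2 : L2r u1 -> L2r u2 -> L2r v1 -> L2r v2 ->
    nrm (fun x => (W (u1, u2)).1 x - (W (v1, v2)).1 x)
    + nrm (fun x => (W (u1, u2)).2 x - (W (v1, v2)).2 x)
    <= 2^-1 * (nrm (fun x => u1 x - v1 x) + nrm (fun x => u2 x - v2 x)).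
  move=> Lu1 Lu2 Lv1 Lv2.
  have [Lw1 Lw2 [t1 [t2 [[Lt1 Lt2] w1 w2 E1 E2]]]] := HW (u1, u2) Lu1 Lu2.
  have [Lz1 Lz2 [s1 [s2 [[Ls1 Ls2] z1 z2 D1 D2]]]] := HW (v1, v2) Lv1 Lv2.
  move: (W (u1, u2)) (W (v1, v2)) Lw1 Lw2 w1 w2 E1 E2 Lz1 Lz2 z1 z2 D1 D2 => [p1 p2] [r1 r2] /=.
  move=> Lp1 Lp2 wp1 wp2 E1 E2 Lr1 Lr2 wr1 wr2 D1 D2.
  have M1 := wdB (L2r_M P Lp1) (L2r_M P Lr1) Lt1 Ls1 wp1 wr1; rewrite -MB// in M1.
  have M2 := wdB (L2r_M P Lp2) (L2r_M P Lr2) Lt2 Ls2 wp2 wr2; rewrite -MB// in M2.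
  have := hC a b _ _ _ _ ala (L2rB Lp1 Lr1) (L2rB Lp2 Lr2) (L2rB Lt1 Ls1) (L2rB Lt2 Ls2) M1 M2.
  have Lx1 := L2rB Lu1 Lv1; have Lx2 := L2rB Lu2 Lv2.
  set X1 := (fun x => u1 x - v1 x) in Lx1 *; set X2 := (fun x => u2 x - v2 x) in Lx2 *.
  have e1 : nsq (fun x => t1 x - s1 x - a * (p1 x - r1 x) + b * (p2 x - r2 x))
      = nsq (fun x => da * X1 x - db * X2 x).
    have [m1 _] : L2r (fun x => t1 x - s1 x - a * (p1 x - r1 x) + b * (p2 x - r2 x)).
      by apply: L2rD; [apply: L2rB; [exact: L2rB|apply: L2rZ; exact: L2rB]|apply: L2rZ; exact: L2rB].
    have [m2 _] : L2r (fun x => da * X1 x - db * X2 x) by apply: L2rB; exact: L2rZ.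
    apply: ae_nsq => //; apply: ae2 E1 D1 => x; rewrite /g1 /X1 /X2 /= => A1 A2.
    have -> : t1 x - s1 x - a * (p1 x - r1 x) + b * (p2 x - r2 x)
      = (t1 x - a * p1 x + b * p2 x) - (s1 x - a * r1 x + b * r2 x) by ring.
    by rewrite A1 A2; ring.
  have e2 : nsq (fun x => t2 x - s2 x - a * (p2 x - r2 x) - b * (p1 x - r1 x))
      = nsq (fun x => da * X2 x + db * X1 x).
    have [m1 _] : L2r (fun x => t2 x - s2 x - a * (p2 x - r2 x) - b * (p1 x - r1 x)).
      by apply: L2rB; [apply: L2rB; [exact: L2rB|apply: L2rZ; exact: L2rB]|apply: L2rZ; exact: L2rB].
    have [m2 _] : L2r (fun x => da * X2 x + db * X1 x) by apply: L2rD; exact: L2rZ.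
    apply: ae_nsq => //; apply: ae2 E2 D2 => x; rewrite /g2 /X1 /X2 /= => A1 A2.
    have -> : t2 x - s2 x - a * (p2 x - r2 x) - b * (p1 x - r1 x)
      = (t2 x - a * p2 x - b * p1 x) - (s2 x - a * r2 x - b * r1 x) by ring.
    by rewrite A1 A2; ring.
  rewrite e1 e2.
  have b1 := nsqB_le (L2rZ da Lx1) (L2rZ db Lx2); have b2 := nsqD_le (L2rZ da Lx2) (L2rZ db Lx1).
  rewrite !nsqZ// in b1 b2.
  rewrite -(nrm_sqr (fun x => p1 x - r1 x)) -(nrm_sqr (fun x => p2 x - r2 x)).
  rewrite -(nrm_sqr X1) -(nrm_sqr X2) in b1 b2.
  move: b1 b2 (nrm_ge0 (fun x => p1 x - r1 x)) (nrm_ge0 (fun x => p2 x - r2 x)) (nrm_ge0 X1) (nrm_ge0 X2).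
  move: (nsq _) (nsq _) (nrm (fun x => p1 x - r1 x)) (nrm (fun x => p2 x - r2 x)) (nrm X1) (nrm X2).
  move=> n2 n1 y1 y2 n3 n4 b1 b2 y10 y20 n30 n40 H.
  (* The chain is [(y1 + y2)^2 <= 2 (y1^2 + y2^2) <= 4 C (da^2 + db^2) (n3 + n4)^2]; the constant
     [16] in the smallness condition turns it into the factor [1/2]. *)
  rewrite -ler_sqr ?nnegrE ?addr_ge0//; last by rewrite mulr_ge0// addr_ge0.
  have H1 : (y1 + y2) ^+ 2 <= 2 * (y1 ^+ 2 + y2 ^+ 2) by have := sqr_ge0 (y1 - y2); lra.
  have H2 : C * (n1 + n2) <= C * (2 * (da ^+ 2 + db ^+ 2) * (n3 ^+ 2 + n4 ^+ 2)).
    by apply: ler_wpM2l => //; lra.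
  have H3 : 16 * C * (da ^+ 2 + db ^+ 2) * (n3 + n4) ^+ 2 <= (n3 + n4) ^+ 2.
    by rewrite ler_piMl ?sqr_ge0.
  have H4 : C * (da ^+ 2 + db ^+ 2) * (n3 ^+ 2 + n4 ^+ 2) <= C * (da ^+ 2 + db ^+ 2) * (n3 + n4) ^+ 2.
    apply: ler_wpM2l; first by rewrite mulr_ge0// addr_ge0 ?sqr_ge0.
    by have := mulr_ge0 n30 n40; lra.
  have H5 : C * (2 * (da ^+ 2 + db ^+ 2) * (n3 ^+ 2 + n4 ^+ 2)) = 2 * (C * (da ^+ 2 + db ^+ 2) * (n3 ^+ 2 + n4 ^+ 2)).
    by ring.
  have H6 : 16 * C * (da ^+ 2 + db ^+ 2) * (n3 + n4) ^+ 2 = 16 * (C * (da ^+ 2 + db ^+ 2) * (n3 + n4) ^+ 2).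
    by ring.
  rewrite exprMn; rewrite H5 in H2; rewrite H6 in H3.
  have -> : (2^-1) ^+ 2 = 4^-1 :> R by field.
  move: H H1 H2 H3 H4; move: ((n3 + n4) ^+ 2) ((y1 + y2) ^+ 2) (y1 ^+ 2) (y2 ^+ 2).
  move: (C * (n1 + n2)) (C * _ * (n3 ^+ 2 + n4 ^+ 2)) => Y1 Y2 Y3 Y4 Y5 Y6.
  by move: (C * _ * Y3) => *; lra.
have [v1 [v2 [Lv1 Lv2 F1 F2]]] := @L2r_contraction R (fun u1 u2 => (W (u1, u2)).1)
  (fun u1 u2 => (W (u1, u2)).2) _ q0 q1 LW contr.
have [Lw1 Lw2 [t1 [t2 [Lt w1 w2 E1 E2]]]] := HW (v1, v2) Lv1 Lv2.
exists (W (v1, v2)).1, (W (v1, v2)).2; split=> //; exists t1, t2; split=> //.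
(* Both fixed point equations are packed into a pair, so that one use of [ae2] combines them with
   [E1]. *)
- have F : (fun x => ((W (v1, v2)).1 x, (W (v1, v2)).2 x)) = (fun x => (v1 x, v2 x)) %[ae mu].
    by apply: ae2 F1 F2 => x -> ->.
  apply: ae2 F E1 => x; rewrite /g1 /= => -[<- <-] A1.
  have -> : t1 x - (a + da) * (W (v1, v2)).1 x + (b + db) * (W (v1, v2)).2 x
    = (t1 x - a * (W (v1, v2)).1 x + b * (W (v1, v2)).2 x)
      - (da * (W (v1, v2)).1 x - db * (W (v1, v2)).2 x) by ring.
  by rewrite A1 addrK.
- have F : (fun x => ((W (v1, v2)).1 x, (W (v1, v2)).2 x)) = (fun x => (v1 x, v2 x)) %[ae mu].
    by apply: ae2 F1 F2 => x -> ->.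
  apply: ae2 F E2 => x; rewrite /g2 /= => -[<- <-] A1.
  have -> : t2 x - (a + da) * (W (v1, v2)).2 x - (b + db) * (W (v1, v2)).1 x
    = (t2 x - a * (W (v1, v2)).2 x - b * (W (v1, v2)).1 x)
      - (da * (W (v1, v2)).2 x + db * (W (v1, v2)).1 x) by ring.
  by rewrite A1 addrK.
Qed.

(** Along the segment from a large real [l] to [a + i b] the real part stays at least [a], so a
    single constant [C] serves for all the steps. *)
Lemma solvable_right a b : 0 < a -> solvable a b.
Proof.
move=> a0; have [C C0 hC] := a_priori k0 ck P a0; have [l0 large] := solvable_large.
pose l := Num.max l0 a.
have al : a <= l by rewrite le_max lexx orbT.
have lp : 0 < l by exact: lt_le_trans al.
have Sl : solvable l 0 by apply: large => //; rewrite le_max lexx.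
pose D := 16 * C * ((a - l) ^+ 2 + b ^+ 2).
have D0 : 0 <= D by rewrite mulr_ge0 ?addr_ge0 ?sqr_ge0// mulr_ge0.
(* A step costs [D / n^2], which is at most [1] as soon as [n >= D] and [n >= 1]. *)
pose n := (Num.bound D).+1.
have nD : D <= n%:R by rewrite (le_trans (ltW (archi_boundP D0)))// ler_nat.
have n0 : 0 < n%:R :> R by rewrite ltr0n.
pose da := (a - l) / n%:R; pose db := b / n%:R.
have small : 16 * C * (da ^+ 2 + db ^+ 2) <= 1.
  have -> : 16 * C * (da ^+ 2 + db ^+ 2) = D / n%:R ^+ 2.
    by rewrite /D /da /db; field; rewrite gt_eqF.
  rewrite ler_pdivrMr ?exprn_gt0// mul1r; apply: (le_trans nD).
  by rewrite expr2 ler_peMl ?ler1n// ler0n.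
have H j : (j <= n)%N -> solvable (l + j%:R * da) (j%:R * db).
  elim: j => [_|j IH jn]; first by rewrite !mul0r addr0.
  have -> : l + j.+1%:R * da = (l + j%:R * da) + da by rewrite -natr1; ring.
  have -> : j.+1%:R * db = j%:R * db + db by rewrite -natr1; ring.
  apply: (solvable_step hC C0 _ (IH (ltnW jn)) small).
  have jn' : j%:R / n%:R <= 1 :> R by rewrite ler_pdivrMr// mul1r ler_nat ltnW.
  have -> : l + j%:R * da = l - j%:R / n%:R * (l - a) by rewrite /da; ring.
  have : j%:R / n%:R * (l - a) <= l - a by rewrite ler_piMl// subr_ge0.
  by rewrite lerBrDr lerBrDl; move: (_ * _) => *; lra.
have := H n (leqnn n).
have -> : l + n%:R * da = a by rewrite /da mulrC divfK ?gt_eqF// addrC subrK.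
by have -> : n%:R * db = b by rewrite /db mulrC divfK ?gt_eqF.
Qed.

End surjectivity.

(** * Complex-valued functions *)

Section complex_L2.
Context {R : realType}.
Local Notation mu := (@lebesgue_measure R).
Implicit Types (f g v w : R -> R[i]).
Local Notation re f := (fun x => complex.Re (f x)).
Local Notation im f := (fun x => complex.Im (f x)).

Lemma L2P f : L2 f <-> L2r (re f) /\ L2r (im f).
Proof. by split=> -[/L2rP h1 /L2rP h2]. Qed.

Lemma weak_derivativeP f g :
  is_weak_derivative f g <-> wd (re f) (re g) /\ wd (im f) (im g).
Proof.
split=> [H|[H1 H2] psi tp]; last by rewrite -!ipE; split; [exact: H1|exact: H2].
by split=> psi tp; have [h1 h2] := H psi tp; rewrite !ipE.
Qed.

Lemma complex_ext (z z' : R[i]) :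
  complex.Re z = complex.Re z' -> complex.Im z = complex.Im z' -> z = z'.
Proof. by case: z => a b; case: z' => a' b' /= -> ->. Qed.

Lemma ae_complexP f g : f = g %[ae mu] <-> re f = re g %[ae mu] /\ im f = im g %[ae mu].
Proof.
split=> [fg|[fg1 fg2]]; last by apply: ae2 fg1 fg2 => x; exact: complex_ext.
by split; apply: ae1 fg => x ->.
Qed.

Lemma Re_mul (z z' : R[i]) :
  complex.Re (z * z') = complex.Re z * complex.Re z' - complex.Im z * complex.Im z'.
Proof. by case: z => a b; case: z'. Qed.

Lemma Im_mul (z z' : R[i]) :
  complex.Im (z * z') = complex.Re z * complex.Im z' + complex.Im z * complex.Re z'.
Proof. by case: z => a b; case: z'. Qed.

Lemma Re_add (z z' : R[i]) : complex.Re (z + z') = complex.Re z + complex.Re z'.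
Proof. by case: z => a b; case: z'. Qed.

Lemma Im_add (z z' : R[i]) : complex.Im (z + z') = complex.Im z + complex.Im z'.
Proof. by case: z => a b; case: z'. Qed.

Lemma Re_sub (z z' : R[i]) : complex.Re (z - z') = complex.Re z - complex.Re z'.
Proof. by case: z => a b; case: z'. Qed.

Lemma Im_sub (z z' : R[i]) : complex.Im (z - z') = complex.Im z - complex.Im z'.
Proof. by case: z => a b; case: z'. Qed.

Lemma Re_scale (a : R) (z : R[i]) : complex.Re (a%:C%C * z) = a * complex.Re z.
Proof. by rewrite Re_mul /= mul0r subr0. Qed.

Lemma Im_scale (a : R) (z : R[i]) : complex.Im (a%:C%C * z) = a * complex.Im z.
Proof. by rewrite Im_mul /= mul0r addr0. Qed.

Lemma L2normE f : L2 f -> L2norm f = (Num.sqrt (nsq (re f) + nsq (im f)))%:E.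
Proof.
move=> /L2P[L1 L2'].
have n0 : 0 <= nsq (re f) + nsq (im f) by rewrite addr_ge0 ?nsq_ge0.
rewrite /L2norm unlock -powR12_sqrt// -poweR_EFin; congr (_ `^ _)%E.
rewrite EFinD -!integral_sqr_nsq// -integralD//; [|by case: L1|by case: L2'].
apply: eq_integral => x _; rewrite normc_def; case: (f x) => a b /=.
rewrite -EFinD ger0_norm ?sqrtr_ge0//.
rewrite -[LHS]/((Num.sqrt (a ^+ 2 + b ^+ 2) `^ 2%:R)%:E) powR_mulrn ?sqrtr_ge0//.
by rewrite sqr_sqrtr// addr_ge0 ?sqr_ge0.
Qed.

Lemma weakD_spec f g : L2 g -> is_weak_derivative f g ->
  L2 (weakD f) /\ is_weak_derivative f (weakD f).
Proof.
move=> Lg fg; rewrite /weakD; set S := [set _ | _].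
by have := @xgetPex _ (fun=> 0) S (ex_intro _ g (conj Lg fg)).
Qed.

Lemma weakD_ae f g : L2 g -> is_weak_derivative f g -> weakD f = g %[ae mu].
Proof.
move=> Lg fg; have [LD fD] := weakD_spec Lg fg; apply/ae_complexP.
move/L2P : Lg => [l1 l2]; move/L2P : LD => [m1 m2].
move/weak_derivativeP : fg => [w1 w2]; move/weak_derivativeP : fD => [u1 u2].
by split; [exact: wd_unique u1 w1|exact: wd_unique u2 w2].
Qed.

Lemma is_weak_derivative_ae f f' g g' : L2 f -> L2 f' -> L2 g -> L2 g' ->
  f = f' %[ae mu] -> g = g' %[ae mu] -> is_weak_derivative f g -> is_weak_derivative f' g'.
Proof.
move=> /L2P[[f1 _] [f2 _]] /L2P[[f1' _] [f2' _]] /L2P[[g1 _] [g2 _]] /L2P[[g1' _] [g2' _]].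
move=> /ae_complexP[a1 a2] /ae_complexP[b1 b2] /weak_derivativeP[w1 w2].
apply/weak_derivativeP; split.
- exact: wd_ae f1 f1' g1 g1' a1 b1 w1.
- exact: wd_ae f2 f2' g2 g2' a2 b2 w2.
Qed.

Definition cmap (T : (R -> R) -> R -> R) f : R -> R[i] :=
  fun x => Complex (T (re f) x) (T (im f) x).

(** [G s] provides a solution, so the representative picked by [xget] meets its specification;
    [G_unique], applied to real and imaginary parts, identifies the two. *)
Lemma helmholtz_inv_spec (s : R) f : 0 < s -> L2 f ->
  let w := helmholtz_inv (s ^+ 2) f in
  [/\ L2 w, w = cmap (G s) f %[ae mu] & H2 w /\ helmholtz (s ^+ 2) w = f %[ae mu]].
Proof.
move=> s0 Lf w; have [L1 L2'] := (L2P f).1 Lf.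
have LG : L2 (cmap (G s) f) by apply/L2P; split; exact: G_L2r.
have LGd : L2 (cmap (Gd s) f) by apply/L2P; split; exact: Gd_L2r.
pose G2 x := Complex (s ^+ 2 * G s (re f) x - complex.Re (f x))
   (s ^+ 2 * G s (im f) x - complex.Im (f x)).
have LG2 : L2 G2 by apply/L2P; split; apply: L2rB => //; apply: L2rZ; exact: G_L2r.
have w1 : is_weak_derivative (cmap (G s) f) (cmap (Gd s) f).
  by apply/weak_derivativeP; split; exact: wd_G.
have w2 : is_weak_derivative (cmap (Gd s) f) G2.
  by apply/weak_derivativeP; split; exact: wd_Gd.
have [LD wD] := weakD_spec LGd w1; have aD := weakD_ae LGd w1.
have w2' : is_weak_derivative (weakD (cmap (G s) f)) G2.
  by apply: (is_weak_derivative_ae LGd LD LG2 LG2 (ae_sym aD) (eq_ae (frefl _)) w2).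
have [LDD wDD] := weakD_spec LG2 w2'; have aDD := weakD_ae LG2 w2'.
have ex : exists w, H2 w /\ helmholtz (s ^+ 2) w = f %[ae mu].
  exists (cmap (G s) f); split.
    split; first by split=> //; exists (cmap (Gd s) f).
    by split=> //; exists G2.
  apply: ae1 aDD => x; rewrite /helmholtz => ->; apply: complex_ext.
    by rewrite Re_sub Re_scale /= opprB addrC subrK.
  by rewrite Im_sub Im_scale /= opprB addrC subrK.
have [H2w hw] : H2 w /\ helmholtz (s ^+ 2) w = f %[ae mu].
  by rewrite /w /helmholtz_inv; exact: (@xgetPex _ (fun=> 0) _ ex).
have [[Lw [g [Lg wg]]] [LDw [h [Lh wh]]]] := H2w.
have [_ wDw] := weakD_spec Lg wg; have [LDDw wDDw] := weakD_spec Lh wh.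
split=> //; apply/ae_complexP.
have [lw1 lw2] := (L2P _).1 Lw; have [ld1 ld2] := (L2P _).1 LDw.
have [lh1 lh2] := (L2P _).1 LDDw.
have [u1 u2] := (weak_derivativeP _ _).1 wDw; have [v1 v2] := (weak_derivativeP _ _).1 wDDw.
have [d1 _] := ld1; have [d2 _] := ld2; have [e1 _] := lh1; have [e2 _] := lh2.
have Lr1 : L2r (fun x => s ^+ 2 * complex.Re (w x) - complex.Re (f x)) by apply: L2rB => //; exact: L2rZ.
have Lr2 : L2r (fun x => s ^+ 2 * complex.Im (w x) - complex.Im (f x)) by apply: L2rB => //; exact: L2rZ.
have [r1 _] := Lr1; have [r2 _] := Lr2.
split.
- apply: (G_unique s0 lw1 ld1 L1 u1).
  apply: (wd_ae d1 d1 e1 r1 (eq_ae (frefl _)) _ v1).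
  by apply: ae1 hw => x <-; rewrite /helmholtz Re_sub Re_scale opprB addrC subrK.
- apply: (G_unique s0 lw2 ld2 L2' u2).
  apply: (wd_ae d2 d2 e2 r2 (eq_ae (frefl _)) _ v2).
  by apply: ae1 hw => x <-; rewrite /helmholtz Im_sub Im_scale opprB addrC subrK.
Qed.

End complex_L2.

(** * The right half-plane lies in the resolvent set *)

Section resolvent.
Context {R : realType}.
Local Notation mu := (@lebesgue_measure R).
Implicit Types (v w : R -> R[i]).
Local Notation re f := (fun x => complex.Re (f x)).
Local Notation im f := (fun x => complex.Im (f x)).

Variables (c k : R) (phi phi1 phi2 : R -> R).
Hypotheses (k0 : 0 < 2 * k) (ck : 2 * k < c) (P : dp_profile c k phi phi1 phi2).
Local Notation ga := (gam c k).
Local Notation L := (dp_L c k phi).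
Local Notation M := (dp_M c k phi).
Local Notation Lc := (Lc c k phi).
Local Notation D := (dom_JLc c k phi).

Lemma Lc_spec v : L2 v -> L2 (Lc v) /\ Lc v = cmap L v %[ae mu].
Proof.
move=> Lv; have [L1 L2'] := (L2P v).1 Lv.
have o2 : 0 < 2 :> R by [].
have [] := helmholtz_inv_spec o2 Lv.
rewrite (_ : 2 ^+ 2 = 4); last by rewrite -natrX.
set w := helmholtz_inv 4 v => Lw ew _; have [l1 l2] := (L2P w).1 Lw.
have RE : re (Lc v) = (fun x => (c - phi x) * complex.Re (v x) - ga * complex.Re (w x)).
  by apply/funext => x; rewrite /Lc Re_sub !Re_scale.
have IE : im (Lc v) = (fun x => (c - phi x) * complex.Im (v x) - ga * complex.Im (w x)).
  by apply/funext => x; rewrite /Lc Im_sub !Im_scale.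
split.
  have LR : L2r (re (Lc v)) by rewrite RE; exact: L2rB (L2r_mulr P L1) (L2rZ ga l1).
  have LI : L2r (im (Lc v)) by rewrite IE; exact: L2rB (L2r_mulr P L2') (L2rZ ga l2).
  exact/L2P.
have [e1 e2] := (ae_complexP _ _).1 ew.
apply: ae2 e1 e2 => x h1 h2; apply: complex_ext; rewrite /= LE.
- by rewrite Re_sub !Re_scale h1.
- by rewrite Im_sub !Im_scale h2.
Qed.

(* [(4 - d^2/dx^2) (1 - d^2/dx^2)^-1 = 1 + 3 (1 - d^2/dx^2)^-1]. *)
Lemma M_spec v : L2 v -> let F := helmholtz 4 (helmholtz_inv 1 (Lc v)) in
  L2 F /\ F = cmap M v %[ae mu].
Proof.
move=> Lv; have [LW eW] := Lc_spec Lv; set W := Lc v in LW eW *.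
have o : 0 < 1 :> R by [].
have [] := helmholtz_inv_spec o LW; rewrite expr1n.
set h := helmholtz_inv 1 W => Lh eh [H2h hh].
have [_ [LDh [d [Ld hd]]]] := H2h.
have [LDD _] := weakD_spec Ld hd.
have [h1 h2] := (L2P h).1 Lh; have [d1 d2] := (L2P _).1 LDD.
have [v1 v2] := (L2P v).1 Lv; have [W1 W2] := (L2P W).1 LW.
have [eW1 eW2] := (ae_complexP _ _).1 eW; have [eh1 eh2] := (ae_complexP _ _).1 eh.
have [m1 _] := W1; have [m2 _] := W2.
have [n1 _] := L2r_L P v1; have [n2 _] := L2r_L P v2.
have g1 : G 1 (re W) = G 1 (L (re v)) by exact: eq_G m1 n1 eW1.
have g2 : G 1 (im W) = G 1 (L (im v)) by exact: eq_G m2 n2 eW2.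
move=> F; split.
  have LR : L2r (re F).
    have -> : re F = (fun x => 4 * complex.Re (h x) - complex.Re (weakD (weakD h) x)).
      by apply/funext => x; rewrite /F /helmholtz Re_sub Re_scale.
    exact: L2rB (L2rZ 4 h1) d1.
  have LI : L2r (im F).
    have -> : im F = (fun x => 4 * complex.Im (h x) - complex.Im (weakD (weakD h) x)).
      by apply/funext => x; rewrite /F /helmholtz Im_sub Im_scale.
    exact: L2rB (L2rZ 4 h2) d2.
  exact: ((L2P F).2 (conj LR LI)).
have eF : F = (fun x => W x + 3%:C%C * h x) %[ae mu].
  apply: ae1 hh => x <-; rewrite /F /helmholtz.
  by apply: complex_ext; rewrite ?Re_add ?Im_add ?Re_sub ?Im_sub ?Re_scale ?Im_scale; ring.
apply: (ae_trans eF); apply/ae_complexP; split.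
- apply: ae2 eW1 eh1 => x /= e1 e2.
  by rewrite Re_add Re_scale e1 e2 g1.
- apply: ae2 eW2 eh2 => x /= e1 e2.
  by rewrite Im_add Im_scale e1 e2 g2.
Qed.

(** [J] picks a representative, so its value is characterized as a weak derivative of [M], the form
    in which the real estimates are stated. *)
Lemma J_spec v : D v -> let T := J (Lc v) in
  [/\ L2 T, wd (M (re v)) (re T) & wd (M (im v)) (im T)].
Proof.
move=> [Lv [_ [g [Lg Wg]]]] T.
have [LW eW] := Lc_spec Lv; have [LF eF] := M_spec Lv.
set W := Lc v in LW eW Wg; set F := helmholtz _ _ in LF eF.
have o : 0 < 1 :> R by [].
have [v1 v2] := (L2P v).1 Lv; have [g1 g2] := (L2P g).1 Lg.
have [W1 W2] := (L2P W).1 LW; have [F1 F2] := (L2P F).1 LF.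
have [eW1 eW2] := (ae_complexP _ _).1 eW; have [eF1 eF2] := (ae_complexP _ _).1 eF.
have [w1 w2] := (weak_derivativeP _ _).1 Wg.
have key (f f1 u : R -> R) : L2r f -> L2r f1 -> L2r u -> wd f f1 -> f = L u %[ae mu] ->
    L2r (fun x => f1 x + 3 * Gd 1 (L u) x) /\ wd (M u) (fun x => f1 x + 3 * Gd 1 (L u) x).
  move=> Lf Lf1 Lu ff fu; have LLu := L2r_L P Lu.
  have LG := L2rZ 3 (G_L2r o LLu); have LGd := L2rZ 3 (Gd_L2r o LLu).
  split; first exact: L2rD.
  have [m1 _] := Lf; have [m2 _] := LLu; have [m3 _] := Lf1.
  apply: wdD => //; first exact: (wd_ae m1 m2 m3 m3 fu (eq_ae (frefl f1)) ff).
  by apply: wdZ; [exact: G_L2r|exact: Gd_L2r|exact: wd_G].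
have [k1 K1] := key _ _ _ W1 g1 v1 w1 eW1; have [k2 K2] := key _ _ _ W2 g2 v2 w2 eW2.
pose g' x := Complex (complex.Re (g x) + 3 * Gd 1 (L (re v)) x) (complex.Im (g x) + 3 * Gd 1 (L (im v)) x).
have Lg' : L2 g' := (L2P g').2 (conj k1 k2).
have LM : L2 (cmap M v) := (L2P (cmap M v)).2 (conj (L2r_M P v1) (L2r_M P v2)).
have Mg' : is_weak_derivative (cmap M v) g' := (weak_derivativeP (cmap M v) g').2 (conj K1 K2).
have Fg' := is_weak_derivative_ae LM LF Lg' Lg' (ae_sym eF) (eq_ae (frefl g')) Mg'.
have [LT FT] := weakD_spec Lg' Fg'.
have MT := is_weak_derivative_ae LF LM LT LT eF (eq_ae (frefl _)) FT.
by have [t1 t2] := (weak_derivativeP _ _).1 MT.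
Qed.

(** Puts the solutions supplied by [solvable] in the domain: the smoothing term [3 G 1 (L v)] is
    removed from [M v]. *)
Lemma dom_wd v (t1 t2 : R -> R) : L2 v -> L2r t1 -> L2r t2 ->
  wd (M (re v)) t1 -> wd (M (im v)) t2 -> D v.
Proof.
move=> Lv Lt1 Lt2 w1 w2; split=> //.
have [LW eW] := Lc_spec Lv; split=> //; set W := Lc v in LW eW *.
have o : 0 < 1 :> R by [].
have [v1 v2] := (L2P v).1 Lv; have [W1 W2] := (L2P W).1 LW.
have [eW1 eW2] := (ae_complexP _ _).1 eW.
have key (f t u : R -> R) : L2r f -> L2r t -> L2r u -> wd (M u) t -> f = L u %[ae mu] ->
    L2r (fun x => t x - 3 * Gd 1 (L u) x) /\ wd f (fun x => t x - 3 * Gd 1 (L u) x).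
  move=> Lf Lt Lu ut fu; have LLu := L2r_L P Lu.
  have [Lr wr] := wd_remove_G1 LLu Lt ut; split=> //.
  have [m1 _] := Lf; have [m2 _] := LLu; have [m3 _] := Lr.
  exact: (wd_ae m2 m1 m3 m3 (ae_sym fu) (eq_ae (frefl _)) wr).
have [k1 K1] := key _ _ _ W1 Lt1 v1 w1 eW1; have [k2 K2] := key _ _ _ W2 Lt2 v2 w2 eW2.
pose g x := Complex (t1 x - 3 * Gd 1 (L (re v)) x) (t2 x - 3 * Gd 1 (L (im v)) x).
exists g; split; first exact: ((L2P g).2 (conj k1 k2)).
exact: ((weak_derivativeP W g).2 (conj K1 K2)).
Qed.

Lemma shifted_re v (T : R -> R[i]) (l : R[i]) : re (fun x => T x - l * v x)
  = (fun x => complex.Re (T x) - complex.Re l * complex.Re (v x) + complex.Im l * complex.Im (v x)).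
Proof. by apply/funext => x; rewrite Re_sub Re_mul opprB addrA addrAC. Qed.

Lemma shifted_im v (T : R -> R[i]) (l : R[i]) : im (fun x => T x - l * v x)
  = (fun x => complex.Im (T x) - complex.Re l * complex.Im (v x) - complex.Im l * complex.Re (v x)).
Proof. by apply/funext => x; rewrite Im_sub Im_mul opprD addrA. Qed.

Lemma L2_shifted v (T : R -> R[i]) (l : R[i]) : L2 v -> L2 T -> L2 (fun x => T x - l * v x).
Proof.
move=> /L2P[v1 v2] /L2P[t1 t2].
have a := L2rD (L2rB t1 (L2rZ (complex.Re l) v1)) (L2rZ (complex.Im l) v2).
have b := L2rB (L2rB t2 (L2rZ (complex.Re l) v2)) (L2rZ (complex.Im l) v1).
by rewrite -shifted_re in a; rewrite -shifted_im in b; exact: ((L2P (fun x => T x - l * v x)).2 (conj a b)).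
Qed.

(** Injectivity is the a priori estimate for a difference, the bound on the inverse is the estimate
    itself, and surjectivity is [solvable_right]. *)
Lemma resolvent_right_half_plane (l : R[i]) : 0 < complex.Re l ->
  resolvent_set D (fun v => J (Lc v)) l.
Proof.
move=> l0; have [C C0 hC] := a_priori k0 ck P l0.
split.
- move=> v w Dv Dw E.
  have [Lv _] := Dv; have [Lw _] := Dw.
  have [LTv tv1 tv2] := J_spec Dv; have [LTw tw1 tw2] := J_spec Dw.
  move: E tv1 tv2 tw1 tw2 LTv LTw; move: (J (Lc v)) (J (Lc w)) => Tv Tw E tv1 tv2 tw1 tw2 LTv LTw.
  have [v1 v2] := (L2P v).1 Lv; have [w1 w2] := (L2P w).1 Lw.
  have [a1 a2] := (L2P Tv).1 LTv; have [b1 b2] := (L2P Tw).1 LTw.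
  have M1 := wdB (L2r_M P v1) (L2r_M P w1) a1 b1 tv1 tw1; rewrite -(MB P)// in M1.
  have M2 := wdB (L2r_M P v2) (L2r_M P w2) a2 b2 tv2 tw2; rewrite -(MB P)// in M2.
  have L1 := L2rB v1 w1; have L2' := L2rB v2 w2; have A1 := L2rB a1 b1; have A2 := L2rB a2 b2.
  have := hC _ (complex.Im l) _ _ _ _ (lexx _) L1 L2' A1 A2 M1 M2.
  have [z0 _] : L2r (fun _ : R => 0 : R) by exact: L2r0.
  have n0 : nsq (fun _ : R => 0 : R) = 0 by rewrite nsqE ip0l.
  set f1 := (fun x => _ + complex.Im l * _); set f2 := (fun x => _ - complex.Im l * _).
  have Lf1 : L2r f1 by apply: L2rD; [apply: L2rB => //; exact: L2rZ|exact: L2rZ].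
  have Lf2 : L2r f2 by apply: L2rB; [apply: L2rB => //; exact: L2rZ|exact: L2rZ].
  have [m1 _] := Lf1; have [m2 _] := Lf2.
  have -> : nsq f1 = 0.
    rewrite -n0; apply: ae_nsq => //; apply: ae1 E => x E.
    have : complex.Re (Tv x - l * v x) = complex.Re (Tw x - l * w x) by rewrite E.
    by rewrite !Re_sub !Re_mul /f1 => h; lra.
  have -> : nsq f2 = 0.
    rewrite -n0; apply: ae_nsq => //; apply: ae1 E => x E.
    have : complex.Im (Tv x - l * v x) = complex.Im (Tw x - l * w x) by rewrite E.
    by rewrite !Im_sub !Im_mul /f2 => h; lra.
  rewrite addr0 mulr0 => h.
  have p1 := nsq_ge0 (fun x => complex.Re (v x) - complex.Re (w x)).
  have p2 := nsq_ge0 (fun x => complex.Im (v x) - complex.Im (w x)).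
  have q1 : nsq (fun x => complex.Re (v x) - complex.Re (w x)) = 0.
    by apply/eqP; rewrite eq_le p1 andbT; apply: le_trans h; rewrite lerDl.
  have q2 : nsq (fun x => complex.Im (v x) - complex.Im (w x)) = 0.
    by apply/eqP; rewrite eq_le p2 andbT; apply: le_trans h; rewrite lerDr.
  apply/ae_complexP; split.
  + by apply: ae1 (nsq_eq0 L1 q1) => x /eqP; rewrite subr_eq0 => /eqP.
  + by apply: ae1 (nsq_eq0 L2' q2) => x /eqP; rewrite subr_eq0 => /eqP.
- move=> f Lf; have [f1 f2] := (L2P f).1 Lf.
  have [v1 [v2 [Lv1 Lv2 [t1 [t2 [[Lt1 Lt2] w1 w2 E1 E2]]]]]] :=
    solvable_right k0 ck P (complex.Im l) l0 f1 f2.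
  pose v x := Complex (v1 x) (v2 x).
  have Lv : L2 v := (L2P v).2 (conj Lv1 Lv2).
  have Dv : D v by exact: dom_wd Lv Lt1 Lt2 w1 w2.
  exists v => //.
  have [LT u1 u2] := J_spec Dv; have [T1 T2] := (L2P _).1 LT.
  have e1 := wd_unique T1 Lt1 u1 w1; have e2 := wd_unique T2 Lt2 u2 w2.
  apply: ((ae_complexP (fun x => J (Lc v) x - l * v x) f).2); split.
  + by apply: ae2 e1 E1 => x h1 <-; rewrite Re_sub Re_mul h1 /=; ring.
  + by apply: ae2 e2 E2 => x h1 <-; rewrite Im_sub Im_mul h1 /=; ring.
- exists (Num.sqrt C) => v Dv; have [Lv _] := Dv.
  have [LT u1 u2] := J_spec Dv; have [T1 T2] := (L2P _).1 LT; have [v1 v2] := (L2P v).1 Lv.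
  rewrite !L2normE//; last exact: L2_shifted.
  rewrite -EFinM lee_fin -sqrtrM//; apply: ler_wsqrtr.
  rewrite shifted_re shifted_im.
  exact: (hC _ (complex.Im l) _ _ _ _ (lexx _) v1 v2 T1 T2 u1 u2).
Qed.

End resolvent.

Theorem theorem1p2 (R : realType) (c k : R) (phi : R -> R)
    (k_gt0 : 0 < 2 * k) (c_gt2k : 2 * k < c)
    (phi_wave : smooth_solitary_wave c k phi)
    (phi_even : forall x : R, phi (- x) = phi x) :
  spectrally_stable c k phi.
Proof.
move=> l sl l0; apply: sl.
exact: resolvent_right_half_plane k_gt0 c_gt2k (wave_profile k_gt0 c_gt2k phi_wave phi_even) _ l0.
Qed.
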